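(* Let $\omega>0$ be fixed. The rotation number function $\rho(B,A)$ is a real-analytic function of the parameters $(B,A)$ on the set $U=\rho^{-1}(\mathbb R\setminus\mathbb Z)\subset\mathbb R^2$, which is the complement to the union of the phase-lock areas. Moreover, its restriction to $U$ is an analytic submersion $U\to\mathbb R\setminus\mathbb Z$ inducing an analytic fibration by the curves $$L_r=\{(B,A)\in\mathbb R^2\mid\rho(B,A)=r\},\quad r\in\mathbb R\setminus\mathbb Z,$$ and these curves are graphs $\{B=g_r(A)\}$ of analytic functions in the variable $A$ defined for all $A\in\mathbb R$.
   Context: Fix $\omega>0$. For $(B,A)\in\mathbb R^2$ put $l=\frac B\omega$, $\mu=\frac A{2\omega}$ and consider the vector field $$\dot\phi=-\frac{\sin\phi}{\omega}+l+2\mu\cos\tau,\qquad \dot\tau=1$$ on the two-torus $\mathbb T^2=\mathbb R^2/2\pi\mathbb Z^2$ with coordinates $(\phi,\tau)$. Its rotation number is $$\rho(B,A)=\lim_{k\to+\infty}\frac{\phi(2\pi k)}{2\pi k},$$ where $\phi(\tau)$ is an arbitrary real-valued solution of $\frac{d\phi}{d\tau}=-\frac{\sin\phi}\omega+l+2\mu\cos\tau$ (the limit does not depend on the solution). A phase-lock area is a level set $\{\rho=r\}\subset\mathbb R^2$ having non-empty interior; it is known that this happens exactly for integer $r$. *)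

(* Defs.v *)
From HB Require Import structures.
From mathcomp Require Import all_boot all_order all_algebra.
From mathcomp Require Import all_classical all_reals all_analysis.
Import Order.TTheory GRing.Theory Num.Theory.
Import numFieldNormedType.Exports.

Set Implicit Arguments.
Unset Strict Implicit.
Unset Printing Implicit Defensive.

Local Open Scope classical_set_scope.
Local Open Scope ring_scope.

Definition analytic1_at (R : realType) (g : R -> R) (x : R) : Prop :=
  exists (a : nat -> R) (e : R), 0 < e /\
    forall u : R, `|u| < e -> pseries a u n @[n --> \oo] --> g (x + u).

(* A double series has no canonical order of summation, so its convergence is
   required to be absolute; its sum is then the limit of its square partial
   sums. *)
Definition analytic2_at (R : realType) (f : R * R -> R) (p : R * R) : Prop :=
  exists (a : nat -> nat -> R) (e : R), 0 < e /\
    forall u v : R, `|u| < e -> `|v| < e ->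
      cvgn (fun n => \sum_(i < n) \sum_(j < n) `|a i j * u ^+ i * v ^+ j|) /\
      (\sum_(i < n) \sum_(j < n) a i j * u ^+ i * v ^+ j) @[n --> \oo]
        --> f (p.1 + u, p.2 + v).

(* The expansion at p describes f on a full neighbourhood of p, so this is
   meant for open D. *)
Definition analytic2_on (R : realType) (D : set (R * R)) (f : R * R -> R) :
  Prop := forall p, D p -> analytic2_at f p.

Definition analytic_map_on (R : realType) (D : set (R * R))
    (h : R * R -> R * R) : Prop :=
  analytic2_on D (fun p => (h p).1) /\ analytic2_on D (fun p => (h p).2).

Definition analytic_diffeo (R : realType) (D E : set (R * R))
    (h : R * R -> R * R) : Prop :=
  [/\ open D, open E, analytic_map_on D h, set_fun D E h &
      exists k : R * R -> R * R,
        [/\ analytic_map_on E k, set_fun E D k,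
            {in D, cancel h k} & {in E, cancel k h}]].

Definition analytic_submersion (R : realType) (U : set (R * R)) (W : set R)
    (f : R * R -> R) : Prop :=
  [/\ open U, open W, set_fun U W f, analytic2_on U f &
      forall p, U p -> differentiable f p /\ set_surj setT setT ('d f p)].

(* Analytically locally trivial fibration f : U -> W with fibre the line:
   every point of W has a neighbourhood V over which f is analytically
   isomorphic to the first projection V x R -> V. *)
Definition analytic_fibration (R : realType) (U : set (R * R)) (W : set R)
    (f : R * R -> R) : Prop :=
  forall r, W r -> exists V : set R,
    [/\ open V, V r, V `<=` W &
        exists h : R * R -> R * R,
          analytic_diffeo (U `&` f @^-1` V) (V `*` setT) h /\
          forall p, (U `&` f @^-1` V) p -> (h p).1 = f p].

Definition is_solution (R : realType) (omega B A : R) (phi : R -> R) : Prop :=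
  let l := B / omega in
  let mu := A / (2 * omega) in
  forall tau : R, is_derive tau (1 : R) phi
    (- (sin (phi tau) / omega) + l + 2 * mu * cos tau).

(* The real number to which phi (2 pi k) / (2 pi k) converges for every
   solution phi; the default 0 of xget only stands in for a missing limit. *)
Definition rotation_number (R : realType) (omega : R) (p : R * R) : R :=
  xget 0 [set r : R | forall phi : R -> R, is_solution omega p.1 p.2 phi ->
    phi (2 * pi * k%:R) / (2 * pi * k%:R) @[k --> \oo] --> r].

(* Points of the parameter plane are pairs (B, A), in this order. *)
Definition level (R : realType) (omega r : R) : set (R * R) :=
  [set p | rotation_number omega p = r].

Definition phase_lock_area (R : realType) (omega : R) (D : set (R * R)) :
  Prop := exists r : R, D = level omega r /\ interior D !=set0.

Definition nonintegers (R : realType) : set R := [set r | r \isn't a Num.int].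

(* Main.v *)
(* Writing phi = 2 arg (x, y) linearises the equation: with k = 1 / (2 omega) and
   F = B + A cos t, (x, y) solves x' = k (x - F y), y' = k (F x - y). The
   solutions of this system are power series in t, with coefficients polynomial
   in (B, A), so its monodromy M, of determinant 1, and its trace T are analytic
   in (B, A). If T^2 >= 4 a real eigenvector gives a solution phi with
   phi (2 pi) - phi 0 in 2 pi Z, and rho is an integer; if T^2 < 4 then rho is
   not an integer and T = 2 cos (pi rho), with the sign of sin (pi rho) that of
   M21. Moreover dT/dB = k int tr (M J X^T X) dt for the fundamental matrix X,
   and when T^2 <= 4 and M is not scalar the integrand has constant sign, that of
   -M21 unless M21 = 0. Hence on noninteger levels rho is strictly
   increasing in B, the implicit function theorem makes rho and the level curves
   analytic, and each such level is a graph over the A-axis.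

   The remaining point is that each level {rho = n}, n integer, has interior,
   i.e. contains a point with T^2 > 4. Otherwise T would be extremal along the
   level, so M would be scalar and every solution with rho = n would satisfy
   phi (2 pi) = phi 0 + 2 pi n. With x = A / omega, averaging the equation twice
   along the fast phase n t + x sin t would then give J_n(-x) = O (1 / x), whereas
   J_n is not O (1 / x). *)

Require Import Defs.
From HB Require Import structures.
From mathcomp Require Import all_boot all_order all_algebra.
From mathcomp Require Import all_classical all_reals all_analysis.
From mathcomp Require Import ring lra zify.
Import Order.TTheory GRing.Theory Num.Theory.
Import numFieldNormedType.Exports.

Set Implicit Arguments.
Unset Strict Implicit.
Unset Printing Implicit Defensive.

Local Open Scope classical_set_scope.
Local Open Scope ring_scope.

(** * Differential inequalities *)

(** Analyticity is handled through the l^1 norm of coefficients on a rescaled square; sums,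
    products, composition and a contraction argument in this algebra give the implicit function
    theorem. The nonzero derivative it requires enters as a linear lower bound on increments, so no
    derivative of the trace in B is taken: with X_u the fundamental matrix at B + u, the function tr
    (M X_0^{-1} X_u) of time runs from T(B) to T(B + u) over one period, and its time derivative is
    explicit. The rotation number is used through bounded deviation from a linear drift, uniform in
    the solution and the parameters; this uniformity is what yields its continuity. Two averagings
    are needed because the integral of exp (i (n t + x sin t)) is only O(x^{-1/2}), the size of J_n
    itself. The first, with periodicity, bounds the detuning B / omega - n by O(x^{-1/2}). The
    second leaves one term of that order, but it is the same for all solutions, so the difference of
    two solutions started half a turn apart isolates J_n up to O(1 / x). *)

Lemma der1_eq (R : realType) (f : R -> R) (x a b : R) :
  is_derive x (1 : R) f a -> a = b -> is_derive x (1 : R) f b.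
Proof. by move=> ? <-. Qed.

Lemma der1_cst (R : realType) (c x : R) : is_derive x (1 : R) (fun=> c) 0.
Proof. exact: is_derive_cst. Qed.

Lemma der1_id (R : realType) (x : R) : is_derive x (1 : R) (fun t : R => t) 1.
Proof. exact: is_derive_id. Qed.

Lemma der1_add (R : realType) (f g : R -> R) (x a b : R) :
  is_derive x (1 : R) f a -> is_derive x (1 : R) g b ->
  is_derive x (1 : R) (fun t => f t + g t) (a + b).
Proof. by move=> fa gb; exact: (@is_deriveD _ _ _ f g x 1 a b fa gb). Qed.

Lemma der1_opp (R : realType) (f : R -> R) (x a : R) :
  is_derive x (1 : R) f a -> is_derive x (1 : R) (fun t => - f t) (- a).
Proof. by move=> fa; exact: (@is_deriveN _ _ _ f x 1 a fa). Qed.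

Lemma der1_mul (R : realType) (f g : R -> R) (x a b : R) :
  is_derive x (1 : R) f a -> is_derive x (1 : R) g b ->
  is_derive x (1 : R) (fun t => f t * g t) (a * g x + f x * b).
Proof.
move=> fa gb; apply: (der1_eq (@is_deriveM _ _ f g x 1 a b fa gb)).
by rewrite /GRing.scale /= addrC [g x * a]mulrC.
Qed.

Lemma der1_exp (R : realType) (f : R -> R) n (x a : R) :
  is_derive x (1 : R) f a ->
  is_derive x (1 : R) (fun t => f t ^+ n) (n%:R * f x ^+ n.-1 * a).
Proof. move=> fa; elim: n => [|n IH].
  by rewrite !mul0r; exact: der1_cst.
rewrite (_ : (fun t => _) = (fun t => f t * f t ^+ n)); last first.
  by apply/funext => t; rewrite exprS.
apply: der1_eq (der1_mul fa IH) _ => /=; clear IH; case: n => [|n] /=.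
  by ring.
by rewrite !exprS -[n.+2]addn1 natrD; ring. Qed.

Lemma der1_comp (R : realType) (f g : R -> R) (x a b : R) :
  is_derive x (1 : R) g b -> is_derive (g x) (1 : R) f a ->
  is_derive x (1 : R) (fun t => f (g t)) (a * b).
Proof. by move=> gb fa; exact: (@is_derive1_comp _ f g x a b). Qed.

Lemma der1_inv (R : realType) (f : R -> R) (x a : R) : f x != 0 ->
  is_derive x (1 : R) f a ->
  is_derive x (1 : R) (fun t => (f t)^-1) (- a / f x ^+ 2).
Proof.
move=> fx fa; apply: (der1_eq (@is_deriveV _ f x a 1 fx fa)).
by rewrite /GRing.scale /= mulNr mulrC mulNr.
Qed.

(** [der] leaves the value of the derivative to be filled in from the syntax of the function, so
    that only an algebraic identity remains to be proved. *)
Ltac der1_step :=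
  match goal with
  | H : is_derive ?x _ ?f _ |- is_derive ?x _ ?f _ => exact: H
  | H : forall t, is_derive t _ ?f _ |- is_derive _ _ ?f _ => eapply H
  | |- is_derive _ _ (fun t => t) _ => eapply der1_id
  | |- is_derive _ _ (fun _ => ?c) _ => eapply der1_cst
  | |- is_derive _ _ (fun t => @?f t + @?g t) _ => eapply (@der1_add _ f g)
  | |- is_derive _ _ (fun t => - @?f t) _ => eapply (@der1_opp _ f)
  | |- is_derive _ _ (fun t => @?f t * @?g t) _ => eapply (@der1_mul _ f g)
  | |- is_derive _ _ (fun t => @?f t ^+ ?n) _ => eapply (@der1_exp _ f n)
  | |- is_derive _ _ sin _ => eapply is_derive_sin
  | |- is_derive _ _ cos _ => eapply is_derive_cos
  | |- is_derive _ _ expR _ => eapply is_derive_expR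
  | |- is_derive _ _ atan _ => eapply is_derive1_atan
  | |- is_derive _ _ (fun t => (@?f t)^-1) _ => eapply (@der1_inv _ f)
  | |- is_derive _ _ (fun t => ?f (@?g t)) _ => eapply (@der1_comp _ f g)
  end.
Ltac der := eapply der1_eq; [repeat der1_step|].

Lemma der1_continuous (R : realType) (f f' : R -> R) :
  (forall t, is_derive t (1 : R) f (f' t)) -> continuous f.
Proof.
move=> df x; apply: differentiable_continuous; apply/derivable1_diffP.
by have [] := df x.
Qed.

Lemma der1_mvt (R : realType) (f f' : R -> R) (a b : R) :
  (forall t, is_derive t (1 : R) f (f' t)) -> a <= b ->
  exists2 c, a <= c <= b & f b - f a = f' c * (b - a).
Proof.
move=> df ab.
have cf : {within `[a, b], continuous f}.
  by apply: continuous_subspaceT; exact: der1_continuous df.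
have [c cab ->] := MVT_segment ab (fun x _ => df x) cf.
by exists c => //; move: cab; rewrite in_itv.
Qed.

Lemma der1_le (R : realType) (f f' : R -> R) (a b : R) :
  (forall t, is_derive t (1 : R) f (f' t)) ->
  (forall t, a <= t <= b -> 0 <= f' t) -> a <= b -> f a <= f b.
Proof.
move=> df f0 ab; rewrite -subr_ge0; have [c cab ->] := der1_mvt df ab.
by rewrite mulr_ge0 ?f0// subr_ge0.
Qed.

Lemma der1_cmp (R : realType) (f f' g g' : R -> R) (a b : R) :
  (forall t, is_derive t (1 : R) f (f' t)) ->
  (forall t, is_derive t (1 : R) g (g' t)) ->
  (forall t, a <= t <= b -> f' t <= g' t) -> a <= b ->
  f b - f a <= g b - g a.
Proof.
move=> df dg fg ab.
have : g a - f a <= g b - f b.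
  apply: (@der1_le _ (fun t => g t - f t) (fun t => g' t - f' t)) => // t /fg.
  by rewrite subr_ge0.
lra.
Qed.

Lemma der1_norm (R : realType) (f f' g g' : R -> R) (a b : R) :
  (forall t, is_derive t (1 : R) f (f' t)) ->
  (forall t, is_derive t (1 : R) g (g' t)) ->
  (forall t, a <= t <= b -> `|f' t| <= g' t) -> a <= b ->
  `|f b - f a| <= g b - g a.
Proof.
move=> df dg fg ab; rewrite ler_norml; apply/andP; split.
  have : - f b - - f a <= g b - g a.
    apply: (@der1_cmp _ (fun t => - f t) (fun t => - f' t) _ g') => // t /fg.
    by rewrite ler_norml => /andP[]; lra.
  lra.
by apply: (der1_cmp df dg) => // t /fg; rewrite ler_norml => /andP[].
Qed.

Lemma der1_bound (R : realType) (f f' : R -> R) (a b C : R) :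
  (forall t, is_derive t (1 : R) f (f' t)) ->
  (forall t, a <= t <= b -> `|f' t| <= C) -> a <= b ->
  `|f b - f a| <= C * (b - a).
Proof.
move=> df fC ab; rewrite mulrBr.
apply: (@der1_norm _ f f' (fun t => C * t) (fun=> C)) => // t; der.
by rewrite mul0r add0r mulr1.
Qed.

Lemma der1_zero (R : realType) (f : R -> R) :
  (forall t, is_derive t (1 : R) f 0) -> forall x y, f x = f y.
Proof. by move=> df x y; exact: is_derive_0_is_cst. Qed.

Lemma gronwall (R : realType) (f f' : R -> R) (K C a b : R) : 0 < K ->
  (forall t, is_derive t (1 : R) f (f' t)) ->
  (forall t, a <= t <= b -> f' t <= K * f t + C) -> a <= b ->
  f b <= (f a + C / K) * expR (K * (b - a)) - C / K.
Proof.
move=> K0 df fle ab.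
pose g t := (f t + C / K) * expR (- K * t).
have dg t : is_derive t (1 : R) g
    ((f' t - K * f t - C) * expR (- K * t)).
  rewrite /g; der; field; exact: lt0r_neq0.
have : g b <= g a.
  rewrite -lerN2; apply: (@der1_le _ (fun t => - g t)
    (fun t => - ((f' t - K * f t - C) * expR (- K * t)))) => // t /fle h.
  rewrite oppr_ge0 mulr_le0_ge0 ?expR_ge0//; lra.
rewrite /g lerBrDr => h.
have -> : K * (b - a) = (- K * a) + K * b by ring.
rewrite expRD mulrA -ler_pdivrMr ?expR_gt0//.
by rewrite -expRN -mulNr.
Qed.

Lemma gronwall0 (R : realType) (f f' : R -> R) (K a b : R) : 0 < K ->
  (forall t, is_derive t (1 : R) f (f' t)) ->
  (forall t, a <= t <= b -> f' t <= K * f t) -> a <= b ->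
  f b <= f a * expR (K * (b - a)).
Proof.
move=> K0 df fle ab.
have := @gronwall _ f f' K 0 a b K0 df _ ab.
by rewrite mul0r addr0 subr0; apply=> t /fle; rewrite addr0.
Qed.

(** The fundamental theorem of calculus differentiates the integral from a base point - N only to
    the right of - N. Subtracting the value at 0 makes different base points agree where both apply,
    so the base point may move with x; near t it can be frozen at - (|t| + 2). *)
Lemma antiderivative (R : realType) (f : R -> R) : continuous f ->
  exists F : R -> R, F 0 = 0 /\ forall t, is_derive t (1 : R) F (f t).
Proof.
move=> cf; pose mu := @lebesgue_measure R.
pose G (N x : R) : R := \int[mu]_(t in `[- N, x]) f t - \int[mu]_(t in `[- N, 0]) f t.
have dG (N x : R) : - N < x -> is_derive x (1 : R) (G N) (f x).
  move=> Nx; have [||d1 d2] := @continuous_FTC1_closed R f (- N) x (x + 1) _ _ Nx (cf x).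
  - lra.
  - apply: continuous_compact_integrable; first exact: segment_compact.
    exact: continuous_subspaceT.
  have h : is_derive x (1 : R) (fun x => (\int[mu]_(t in [set` `[- N, x]]) f t)%R) (f x).
    by apply: DeriveDef => //; rewrite -derive1E.
  rewrite -[f x]addr0; exact: (der1_add h (der1_cst (- \int[mu]_(t in `[- N, 0]) f t) x)).
have G0 (N : R) : G N 0 = 0 by rewrite /G subrr.
have GG (N M x : R) : - N < 0 -> - M < 0 -> - N < x -> - M < x -> G N x = G M x.
  move=> N0 M0 Nx Mx; apply/eqP; rewrite -subr_eq0; apply/eqP.
  pose d t := G N t - G M t.
  have dd (t : R) : Num.min x 0 <= t -> is_derive t (1 : R) d 0.
    move=> xt; have Nt : - N < t by case: (leP x 0) xt => ?; lra.
    have Mt : - M < t by case: (leP x 0) xt => ?; lra.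
    by have := dG _ _ Nt; have := dG _ _ Mt => ? ?; rewrite /d; der; rewrite subrr.
  have dc (a b : R) : Num.min x 0 <= a -> a <= b -> d b = d a.
    move=> xa ab.
    have [||c _] := @MVT_segment R d (fun=> 0) a b ab.
    - by move=> t; rewrite in_itv /= => /andP[at_ _]; apply: dd; lra.
    - apply: derivable_within_continuous => t; rewrite in_itv /= => /andP[at_ _].
      by have [] := dd t (le_trans xa at_).
    by rewrite mul0r => /eqP; rewrite subr_eq0 => /eqP.
  have d0 : d 0 = 0 by rewrite /d !G0 subrr.
  case: (leP x 0) dc => [x0 dc|x0 dc].
    by rewrite -[LHS]/(d x) -d0 (dc x 0).
  by rewrite -[LHS]/(d x) (dc 0 x)// ltW.
exists (fun x => G (`|x| + 1) x); split; first exact: G0.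
move=> t; apply: (@near_eq_is_derive _ _ _ (G (`|t| + 2))) => //.
  near=> x.
  have xt : `|x - t| < 1.
    rewrite distrC; near: x; exact: (@nbhsx_ballx _ R t 1 ltr01).
  have := ler_normB x t; have := ler_norm x; have := ler_norm (- x).
  have := ler_norm t; have := ler_norm (- t); rewrite !normrN.
  have := ler_normD (x - t) t; rewrite subrK.
  have := normr_ge0 x; have := normr_ge0 t => *.
  apply: GG; lra.
apply: dG; have := ler_norm (- t); rewrite normrN; lra.
Unshelve. all: by end_near. Qed.

(** * Absolutely convergent double power series *)

Lemma cvg_seq_addl (R : realType) (s : nat -> R) (l : R) M :
  s n @[n --> \oo] --> l -> s (M + n)%N @[n --> \oo] --> l.
Proof.
rewrite -(cvg_shiftn M); apply: cvg_trans; apply: near_eq_cvg.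
by apply: nearW => p /=; rewrite addnC.
Qed.

Lemma cvg_norm_le (R : realType) (s : nat -> R) (l K : R) :
  s n @[n --> \oo] --> l -> (forall n, `|s n| <= K) -> `|l| <= K.
Proof.
move=> sl sK; have h : `|s n| @[n --> \oo] --> `|l| by exact: cvg_norm.
rewrite -(cvg_lim (@Rhausdorff R) h); apply: limr_le; first exact: cvgP h.
exact: nearW.
Qed.

Definition sqsum (R : realType) n (a : nat -> nat -> R) : R :=
  \sum_(i < n) \sum_(j < n) a i j.

Definition sqnorm (R : realType) n (a : nat -> nat -> R) : R :=
  sqsum n (fun i j => `|a i j|).

Definition term2 (R : realType) (a : nat -> nat -> R) (u v : R) i j : R :=
  a i j * u ^+ i * v ^+ j.

(* On the closed unit square f is the sum of a double power series whose
   coefficients have l^1 norm at most K: for this norm these functions form a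
   Banach algebra. *)
Definition isA (R : realType) (K : R) (f : R -> R -> R) : Prop :=
  exists a : nat -> nat -> R, (forall n, sqnorm n a <= K) /\
    forall u v : R, `|u| <= 1 -> `|v| <= 1 ->
      sqsum n (term2 a u v) @[n --> \oo] --> f u v.

Section sqsum.
Context {R : realType}.
Implicit Types a b : nat -> nat -> R.

Lemma sqsumS n a : sqsum n.+1 a =
  sqsum n a + (\sum_(i < n) a i n + \sum_(j < n.+1) a n j).
Proof.
rewrite /sqsum big_ord_recr/= addrA; congr (_ + _).
by rewrite -big_split/=; apply: eq_bigr => i _; rewrite big_ord_recr.
Qed.

Lemma sqsum_ge0 n a : (forall i j, 0 <= a i j) -> 0 <= sqsum n a.
Proof. by move=> a0; do 2!apply: sumr_ge0 => ? _. Qed.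

Lemma sqnorm_ge0 n a : 0 <= sqnorm n a.
Proof. exact: sqsum_ge0. Qed.

Lemma sqsum_le n a b : (forall i j, a i j <= b i j) -> sqsum n a <= sqsum n b.
Proof. by move=> ab; do 2!apply: ler_sum => ? _. Qed.

Lemma sqsum_homo m n a : (forall i j, 0 <= a i j) -> (m <= n)%N ->
  sqsum m a <= sqsum n a.
Proof.
move=> a0 /subnK <-; elim: (n - m)%N => [//|k IH].
rewrite addSn sqsumS (le_trans IH)// lerDl.
by rewrite addr_ge0// sumr_ge0.
Qed.

Lemma ler_norm_sqsum n a : `|sqsum n a| <= sqnorm n a.
Proof.
apply: le_trans (ler_norm_sum _ _ _) _; apply: ler_sum => i _.
exact: ler_norm_sum.
Qed.

Lemma sqsumD n a b : sqsum n (fun i j => a i j + b i j) = sqsum n a + sqsum n b.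
Proof. by rewrite /sqsum -big_split; apply: eq_bigr => i _; rewrite -big_split. Qed.

Lemma sqsumB n a b : sqsum n (fun i j => a i j - b i j) = sqsum n a - sqsum n b.
Proof.
rewrite /sqsum -sumrB; apply: eq_bigr => i _; by rewrite -sumrB.
Qed.

Lemma sqsumZ n c a : sqsum n (fun i j => c * a i j) = c * sqsum n a.
Proof.
rewrite /sqsum mulr_sumr; apply: eq_bigr => i _; by rewrite mulr_sumr.
Qed.

Lemma eq_sqsum n a b : (forall i j, a i j = b i j) -> sqsum n a = sqsum n b.
Proof. by move=> ab; do 2!apply: eq_bigr => ? _. Qed.

Lemma sqsum_sum (I : Type) (r : seq I) n (a : I -> nat -> nat -> R) :
  sqsum n (fun i j => \sum_(k <- r) a k i j) = \sum_(k <- r) sqsum n (a k).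
Proof.
rewrite /sqsum [RHS]exchange_big; apply: eq_bigr => i _.
by rewrite exchange_big.
Qed.

Lemma cvg_sqsum n (b : nat -> nat -> nat -> R) a :
  (forall i j, b m i j @[m --> \oo] --> a i j) ->
  sqsum n (b m) @[m --> \oo] --> sqsum n a.
Proof.
move=> ba; rewrite /sqsum; apply: cvg_big => [|i _].
  exact: (@add_continuous R).
by apply: cvg_big => [|j _]; [exact: (@add_continuous R)|exact: ba].
Qed.

Lemma term2_le a u v i j : `|u| <= 1 -> `|v| <= 1 ->
  `|term2 a u v i j| <= `|a i j|.
Proof.
move=> u1 v1; rewrite /term2 !normrM !normrX -mulrA ler_piMr//.
by rewrite mulr_ile1// ?exprn_ge0// exprn_ile1.
Qed.

Lemma sqnorm_term2 n a u v : `|u| <= 1 -> `|v| <= 1 ->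
  sqnorm n (term2 a u v) <= sqnorm n a.
Proof. by move=> u1 v1; apply: sqsum_le => i j; exact: term2_le. Qed.

Lemma term2D a b u v i j :
  term2 (fun i j => a i j + b i j) u v i j = term2 a u v i j + term2 b u v i j.
Proof. by rewrite /term2 !mulrDl. Qed.

Lemma term2Z c a u v i j :
  term2 (fun i j => c * a i j) u v i j = c * term2 a u v i j.
Proof. by rewrite /term2 !mulrA. Qed.

Lemma sqnorm_coef n a i j : (i < n)%N -> (j < n)%N -> `|a i j| <= sqnorm n a.
Proof.
move=> ni nj; rewrite /sqnorm /sqsum (bigD1 (Ordinal ni))//= (bigD1 (Ordinal nj))//=.
rewrite -addrA lerDl addr_ge0//; first exact: sumr_ge0.
by do 2!apply: sumr_ge0 => ? _.
Qed.

End sqsum.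

Section isA.
Context {R : realType}.
Implicit Types (f g : R -> R -> R) (K L : R).

Lemma isA_ge0 K f : isA K f -> 0 <= K.
Proof. by move=> [a [aK _]]; apply: le_trans (aK 0%N); exact: sqnorm_ge0. Qed.

Lemma isA_le K L f : K <= L -> isA K f -> isA L f.
Proof.
by move=> KL [a [aK af]]; exists a; split => // n; exact: le_trans KL.
Qed.

Lemma isA_ext K f g : (forall u v, `|u| <= 1 -> `|v| <= 1 -> f u v = g u v) ->
  isA K f -> isA K g.
Proof.
move=> fg [a [aK af]]; exists a; split => // u v u1 v1.
by rewrite -fg//; exact: af.
Qed.

Lemma isA_norm K f u v : isA K f -> `|u| <= 1 -> `|v| <= 1 -> `|f u v| <= K.
Proof.
move=> [a [aK af]] u1 v1.
apply: (cvg_norm_le (af u v u1 v1)) => n; apply: le_trans (ler_norm_sqsum _ _) _.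
by apply: le_trans (aK n); exact: sqnorm_term2.
Qed.

Lemma sqsum_delta n k l (x : R) : (k < n)%N -> (l < n)%N ->
  sqsum n (fun i j : nat => if (i == k) && (j == l) then x else 0) = x.
Proof.
move=> kn ln; rewrite /sqsum (bigD1 (Ordinal kn))//= (bigD1 (Ordinal ln))//=.
rewrite !eqxx/= [X in _ + X + _]big1 => [|j]; last first.
  by rewrite -val_eqE/= => /negPf->.
by rewrite big1 ?addr0// => i; rewrite -val_eqE/= => /negPf->; rewrite big1.
Qed.

Lemma isA_mono k l : isA 1 (fun u v : R => u ^+ k * v ^+ l).
Proof.
exists (fun i j : nat => if (i == k) && (j == l) then 1 else (0 : R)); split.
  move=> n; apply: (@le_trans _ _ (sqnorm (n + k.+1 + l.+1) (fun i j : nat => if (i == k) && (j == l) then 1 else (0 : R)))).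
    by apply: sqsum_homo => //; rewrite -addnA leq_addr.
  rewrite /sqnorm (@eq_sqsum _ _ _ (fun i j => if (i == k) && (j == l) then 1 else (0 : R))).
    by rewrite sqsum_delta//; lia.
  by move=> i j; case: ifP; rewrite ?normr1 ?normr0.
move=> u v _ _; apply: cvg_near_cst; near=> n.
rewrite (@eq_sqsum _ _ _ (fun i j => if (i == k) && (j == l) then u ^+ k * v ^+ l else 0)).
  rewrite sqsum_delta//; near: n; exact: nbhs_infty_gt.
move=> i j; rewrite /term2; case: ifP => [/andP[/eqP-> /eqP->]|_]; first by rewrite mul1r.
by rewrite !mul0r.
Unshelve. all: by end_near. Qed.

Lemma isA_scale K f c : isA K f -> isA (`|c| * K) (fun u v => c * f u v).
Proof.
move=> [a [aK af]]; exists (fun i j => c * a i j); split.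
  move=> n; apply: le_trans (ler_wpM2l (normr_ge0 c) (aK n)).
  by rewrite -sqsumZ; apply: sqsum_le => i j; rewrite normrM.
move=> u v u1 v1; under eq_fun do rewrite (eq_sqsum _ (term2Z _ _ _ _)) sqsumZ.
by apply: cvgMr; exact: af.
Qed.

Lemma isA_cst (c : R) : isA `|c| (fun _ _ : R => c).
Proof.
have := isA_scale c (isA_mono 0 0); rewrite mulr1.
by apply: isA_ext => u v _ _; rewrite !expr0 !mulr1.
Qed.

Lemma isA_add K L f g : isA K f -> isA L g ->
  isA (K + L) (fun u v => f u v + g u v).
Proof.
move=> [a [aK af]] [b [bL bg]]; exists (fun i j => a i j + b i j); split.
  move=> n; apply: le_trans (lerD (aK n) (bL n)).
  by rewrite -sqsumD; apply: sqsum_le => i j; exact: ler_normD.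
move=> u v u1 v1; under eq_fun do rewrite (eq_sqsum _ (term2D _ _ _ _)) sqsumD.
by apply: cvgD; [exact: af|exact: bg].
Qed.

Lemma isA_opp K f : isA K f -> isA K (fun u v => - f u v).
Proof.
move=> /(isA_scale (-1)); rewrite normrN1 mul1r; apply: isA_ext => u v _ _.
by rewrite mulN1r.
Qed.

Lemma isA_sub K L f g : isA K f -> isA L g ->
  isA (K + L) (fun u v => f u v - g u v).
Proof. by move=> fK /isA_opp; exact: isA_add. Qed.

Lemma isA_sum n (d : nat -> R) (F : nat -> R -> R -> R) :
  (forall i, (i < n)%N -> isA (d i) (F i)) ->
  isA (\sum_(i < n) d i) (fun u v => \sum_(i < n) F i u v).
Proof.
elim: n => [|n IH] dF.
  rewrite big_ord0; have := isA_cst 0; rewrite normr0; apply: isA_ext => u v _ _.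
  by rewrite /= big_ord0.
rewrite big_ord_recr/=.
apply: isA_ext (isA_add (IH _) (dF n _)) => //.
  by move=> u v _ _; rewrite big_ord_recr.
by move=> i ni; apply: dF; rewrite ltnS ltnW.
Qed.

(** Completeness of the algebra. The coefficients are summed termwise; the limits over the square
    size n and over the number M of summands may be interchanged because the tail after M summands
    is at most D minus the M-th partial sum of [d], uniformly in n. *)
Lemma isA_series (K : R) (d : nat -> R) (F : nat -> R -> R -> R) f :
  (forall m, isA (d m) (F m)) -> (forall n, \sum_(m < n) d m <= K) ->
  (forall u v, `|u| <= 1 -> `|v| <= 1 ->
    \sum_(m < n) F m u v @[n --> \oo] --> f u v) ->
  isA K f.
Proof.
move=> dF dK Ff; have d0 m : 0 <= d m by exact: isA_ge0 (dF m).
have /choice[a aP] : forall m, exists a : nat -> nat -> R,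
  (forall n, sqnorm n a <= d m) /\ forall u v : R, `|u| <= 1 -> `|v| <= 1 ->
      sqsum n (term2 a u v) @[n --> \oo] --> F m u v.
  by move=> m; have [a ?] := dF m; exists a.
have sdc : cvgn (fun n => \sum_(m < n) d m).
  apply: nondecreasing_is_cvgn.
    by apply/nondecreasing_seqP => n; rewrite big_ord_recr/= lerDl.
  by exists K => _ [n _ <-].
pose D := limn (fun n => \sum_(m < n) d m).
have sdD : \sum_(m < n) d m @[n --> \oo] --> D by exact: sdc.
have sdle n : \sum_(m < n) d m <= D.
  apply: nondecreasing_cvgn_le => //.
  by apply/nondecreasing_seqP => k; rewrite big_ord_recr/= lerDl.
have coefle m i j : `|a m i j| <= d m.
  apply: le_trans ((aP m).1 (maxn i j).+1).
  by apply: sqnorm_coef; rewrite ltnS ?leq_maxl ?leq_maxr.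
have scd : cvgn (series d).
  by rewrite (_ : series d = (fun n => \sum_(m < n) d m))//; apply/funext => n; rewrite /series/= big_mkord.
pose sa N i j := \sum_(m < N) a m i j.
pose b i j := limn (fun N => sa N i j).
have sab i j : sa N i j @[N --> \oo] --> b i j.
  have : cvgn (series (fun m => a m i j)).
    apply: normed_cvg; apply: (series_le_cvg _ _ (fun m => coefle m i j) scd) => //.
  rewrite (_ : series _ = (fun N => sa N i j)) //.
  by apply/funext => n; rewrite /series/= big_mkord.
have dgap M p : \sum_(m < M + p) d m - \sum_(m < M) d m <= D - \sum_(m < M) d m.
  by rewrite lerB.
have gapsum M p (G : nat -> R) : (forall m, `|G m| <= d m) ->
    `|\sum_(m < M + p) G m - \sum_(m < M) G m| <= D - \sum_(m < M) d m.
  move=> Gd; apply: le_trans (dgap M p); elim: p => [|p IH].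
    by rewrite addn0 !subrr normr0.
  rewrite addnS !big_ord_recr/= !(addrAC _ _ (- _)).
  by rewrite (le_trans (ler_normD _ _))// lerD.
exists b; split=> [n|u v u1 v1].
  have : sqnorm n (sa N) @[N --> \oo] --> sqnorm n b.
    by apply: cvg_sqsum => i j; exact: cvg_norm.
  move=> h; rewrite -(cvg_lim (@Rhausdorff R) h); apply: limr_le; first exact: cvgP h.
  apply: nearW => N; apply: le_trans (dK N); rewrite /sa.
  elim: N => [|N IH].
    by rewrite big_ord0 /sqnorm /sqsum big1// => i _; rewrite big1// => j _; rewrite big_ord0 normr0.
  rewrite big_ord_recr/=; apply: le_trans (lerD IH ((aP N).1 n)).
  rewrite -sqsumD; apply: sqsum_le => i j; rewrite big_ord_recr/=; exact: ler_normD.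
have sqsa n N : sqsum n (term2 (sa N) u v) = \sum_(m < N) sqsum n (term2 (a m) u v).
  rewrite -(sqsum_sum (index_enum 'I_N) n (fun m => term2 (a m) u v)).
  by apply: eq_sqsum => i j; rewrite /term2 !mulr_suml.
have sqad n m : `|sqsum n (term2 (a m) u v)| <= d m.
  apply: le_trans (ler_norm_sqsum _ _) _.
  by apply: le_trans ((aP m).1 n); exact: sqnorm_term2.
have tailb M n : `|sqsum n (term2 b u v) - \sum_(m < M) sqsum n (term2 (a m) u v)| <= D - \sum_(m < M) d m.
  apply: (@cvg_norm_le _ (fun p => sqsum n (term2 (sa (M + p)) u v) - \sum_(m < M) sqsum n (term2 (a m) u v))).
    apply: cvgB; last exact: cvg_cst.
    apply: (@cvg_sqsum _ _ (fun p => term2 (sa (M + p)%N) u v)) => i j.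
    apply: cvgMl; apply: cvgMl; exact: (cvg_seq_addl M (sab i j)).
  by move=> p; rewrite sqsa; exact: (gapsum M p (fun m => sqsum n (term2 (a m) u v))).
have tailf M : `|f u v - \sum_(m < M) F m u v| <= D - \sum_(m < M) d m.
  apply: (@cvg_norm_le _ (fun p => \sum_(m < M + p) F m u v - \sum_(m < M) F m u v)).
    apply: cvgB; last exact: cvg_cst.
    exact: (cvg_seq_addl M (Ff u v u1 v1)).
  by move=> p; apply: (gapsum M p (fun m => F m u v)) => m; exact: isA_norm (dF m) u1 v1.
apply/cvgrPdist_lt => e e0.
have e3 : 0 < e / 3 by lra.
have /cvgrPdist_lt/(_ _ e3)[M _ /(_ M (leqnn M)) hM] := sdD.
have hM' : D - \sum_(m < M) d m < e / 3 by apply: le_lt_trans hM; exact: ler_norm.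
have hn : (\sum_(m < M) sqsum n (term2 (a m) u v)) @[n --> \oo] --> \sum_(m < M) F m u v.
  apply: cvg_big => [|m _]; first exact: (@add_continuous R).
  by apply: (aP m).2.
move/cvgrPdist_lt: hn => /(_ _ e3) hn.
near=> n.
have h1 : `|\sum_(m < M) F m u v - \sum_(m < M) sqsum n (term2 (a m) u v)| < e / 3 by near: n.
have h2 := tailb M n; have h3 := tailf M.
set x := \sum_(m < M) sqsum n _ in h1 h2; set y := \sum_(m < M) F m u v in h1 h3.
set w := sqsum n _ in h2 *.
have -> : f u v - w = (f u v - y) + (y - x) + (x - w) by ring.
apply: le_lt_trans (ler_normD _ _) _; rewrite [X in _ + X]distrC.
have := ler_normD (f u v - y) (y - x); lra.
Unshelve. all: by end_near. Qed.

(** The square is cut into the hooks max (i, j) = m. This turns a limit of square partial sums into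
    an ordinary series, to which [isA_series] applies. *)
Lemma sqsum_tele n (a : nat -> nat -> R) : sqsum n a =
  \sum_(m < n) (\sum_(i < m) a i m + \sum_(j < m.+1) a m j).
Proof.
elim: n => [|n IH]; first by rewrite /sqsum !big_ord0.
by rewrite sqsumS IH [RHS]big_ord_recr.
Qed.

Lemma isA_square K (d : nat -> nat -> R) (g : nat -> nat -> R -> R -> R) f :
  (forall i j, isA (d i j) (g i j)) -> (forall n, sqsum n d <= K) ->
  (forall u v, `|u| <= 1 -> `|v| <= 1 ->
    sqsum n (fun i j => g i j u v) @[n --> \oo] --> f u v) ->
  isA K f.
Proof.
move=> dg dK gf.
apply: (@isA_series K (fun m => \sum_(i < m) d i m + \sum_(j < m.+1) d m j)
  (fun m u v => \sum_(i < m) g i m u v + \sum_(j < m.+1) g m j u v)).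
- move=> m; apply: isA_add; first by apply: (@isA_sum m (d^~ m) (g^~ m)).
  by apply: (@isA_sum m.+1 (d m) (g m)).
- by move=> n; rewrite -sqsum_tele.
- move=> u v u1 v1; under eq_fun do rewrite -(sqsum_tele _ (fun i j => g i j u v)).
  exact: gf.
Qed.

Lemma isA_mul_mono K k l f : isA K f -> isA K (fun u v => f u v * (u ^+ k * v ^+ l)).
Proof.
move=> [a [aK af]].
apply: (@isA_square K (fun i j => `|a i j|) (fun i j u v => a i j * (u ^+ (i + k) * v ^+ (j + l)))) => //.
  by move=> i j; have := isA_scale (a i j) (isA_mono (i + k) (j + l)); rewrite mulr1.
move=> u v u1 v1; have h : sqsum n (term2 a u v) * (u ^+ k * v ^+ l) @[n --> \oo] -->
    f u v * (u ^+ k * v ^+ l) by apply: cvgMl; exact: af.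
apply: cvg_trans h; apply: near_eq_cvg; apply: nearW => n.
rewrite mulrC -sqsumZ; apply: eq_sqsum => i j; rewrite /term2 !exprD; ring.
Qed.

(** Only g is expanded: f g is the double series of the functions b i j f u^i v^j, each of norm at
    most |b i j| K. No convolution of double series is formed. *)
Lemma isA_mul K L f g : isA K f -> isA L g -> isA (K * L) (fun u v => f u v * g u v).
Proof.
move=> fK [b [bL bg]].
apply: (@isA_square (K * L) (fun i j => `|b i j| * K)
   (fun i j u v => b i j * (f u v * (u ^+ i * v ^+ j)))).
- by move=> i j; apply: isA_scale; exact: isA_mul_mono.
- move=> n; rewrite (@eq_sqsum _ _ _ (fun i j => K * `|b i j|)); last by move=> *; rewrite mulrC.
  by rewrite sqsumZ ler_wpM2l//; [exact: (isA_ge0 fK)|exact: bL].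
- move=> u v u1 v1; have h : f u v * sqsum n (term2 b u v) @[n --> \oo] --> f u v * g u v.
    by apply: cvgMr; exact: bg.
  apply: cvg_trans h; apply: near_eq_cvg; apply: nearW => n.
  rewrite -sqsumZ; apply: eq_sqsum => i j; rewrite /term2; ring.
Qed.

Lemma isA_exp K f n : isA K f -> isA (K ^+ n) (fun u v => f u v ^+ n).
Proof.
move=> fK; elim: n => [|n IH].
  have := isA_cst 1; rewrite normr1; apply: isA_ext => u v _ _.
  by rewrite expr0.
by rewrite exprS; apply: isA_ext (isA_mul fK IH) => u v _ _; rewrite exprS.
Qed.

End isA.

(** * Taylor remainders, rescaling and composition *)

Section analytic.
Context {R : realType}.
Implicit Types (F f g G w Y : R -> R -> R) (a c : nat -> nat -> R).

Definition has_coef (K : R) a f : Prop := (forall n, sqnorm n a <= K) /\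
  forall u v : R, `|u| <= 1 -> `|v| <= 1 ->
    sqsum n (term2 a u v) @[n --> \oo] --> f u v.

Lemma sqsum_origin n a : sqsum n.+1 (term2 a 0 0) = a 0%N 0%N.
Proof.
rewrite -[RHS](@sqsum_delta _ n.+1 0 0 (a 0%N 0%N))//; apply: eq_sqsum.
by move=> [|i] [|j]; rewrite /term2 /= ?expr0 ?mulr1// !exprS !mul0r ?mulr0 ?mul0r.
Qed.

Lemma has_coef_origin K a f : has_coef K a f -> f 0 0 = a 0%N 0%N.
Proof.
move=> [_ /(_ 0 0)]; rewrite normr0 => /(_ ler01 ler01) h.
rewrite -(cvg_lim (@Rhausdorff R) h); apply: lim_near_cst => //.
near=> n; have n0 : (0 < n)%N by near: n; exact: nbhs_infty_gt.
by rewrite -(prednK n0) sqsum_origin.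
Unshelve. all: by end_near. Qed.

(** Since s <= 1, every monomial of total degree at least 2 is at most s^2 on the square of side s,
    so the coefficient norm K bounds the whole remainder. *)
Lemma has_coef_taylor K a f (s x y : R) : has_coef K a f -> s <= 1 ->
  `|x| <= s -> `|y| <= s ->
  `|f x y - (a 0%N 0%N + a 1%N 0%N * x + a 0%N 1%N * y)| <= K * s ^+ 2.
Proof.
move=> [aK af] s1 xs ys; have s0 : 0 <= s by apply: le_trans xs.
pose b i j := if (i + j < 2)%N then 0 else a i j * x ^+ i * y ^+ j.
have hb : sqsum n.+2 b @[n --> \oo] -->
    f x y - (a 0%N 0%N + a 1%N 0%N * x + a 0%N 1%N * y).
  have h : sqsum n (term2 a x y) @[n --> \oo] --> f x y.
    by apply: af; exact: le_trans s1.
  have h2 : sqsum (2 + n) (term2 a x y) - (a 0%N 0%N + a 1%N 0%N * x + a 0%N 1%N * y)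
      @[n --> \oo] --> f x y - (a 0%N 0%N + a 1%N 0%N * x + a 0%N 1%N * y).
    by apply: cvgB; [exact: (cvg_seq_addl 2 h)|exact: cvg_cst].
  apply: cvg_trans h2; apply: near_eq_cvg; apply: nearW => n /=.
  rewrite add2n; apply/esym; rewrite -(@sqsum_delta _ n.+2 0 0 (a 0%N 0%N))//.
  rewrite -(@sqsum_delta _ n.+2 1 0 (a 1%N 0%N * x))//.
  rewrite -(@sqsum_delta _ n.+2 0 1 (a 0%N 1%N * y))//.
  rewrite -!sqsumD -sqsumB; apply: eq_sqsum.
  case=> [|[|i]] [|[|j]]; rewrite /b /term2 /= ?addr0 ?add0r ?subr0//.
  - by rewrite !expr0 !mulr1 subrr.
  - by rewrite expr0 mulr1 subrr.
  - by rewrite expr0 mulr1 expr1 subrr.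
apply: (cvg_norm_le hb) => n; apply: le_trans (ler_norm_sqsum _ _) _.
rewrite mulrC; apply: le_trans (ler_wpM2l (sqr_ge0 s) (aK n.+2)).
rewrite -sqsumZ; apply: sqsum_le => i j; rewrite /b; case: ltnP => [_|ij].
  by rewrite normr0 mulr_ge0// sqr_ge0.
rewrite -mulrA normrM mulrC ler_wpM2r// normrM !normrX.
apply: (@le_trans _ _ (s ^+ i * s ^+ j)).
  by rewrite ler_pM// ?exprn_ge0// lerXn2r// ?nnegrE.
by rewrite -exprD -(subnK ij) exprD ler_piMl ?sqr_ge0// exprn_ile1.
Qed.

(** Without a linear term |f x 0| would be at most K x^2, which is below c |x| for small x. This
    lets a lower bound on increments stand for a nonzero partial derivative. *)
Lemma has_coef_neq0 K a f (e c : R) : has_coef K a f -> f 0 0 = 0 ->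
  0 < e -> 0 < c -> (forall x, `|x| <= e -> c * `|x| <= `|f x 0|) ->
  a 1%N 0%N != 0.
Proof.
move=> fa f0 e0 c0 fc; apply/eqP => a0.
have K0 : 0 <= K by apply: le_trans (fa.1 0%N); exact: sqnorm_ge0.
pose x : R := Num.min 1 (Num.min e (c / (2 * (K + 1)))).
have xK : 0 < c / (2 * (K + 1)) by rewrite divr_gt0// mulr_gt0//; lra.
have x0 : 0 < x by rewrite !lt_min ltr01 e0.
have x1 : x <= 1 by rewrite /x ge_min lexx.
have xe : x <= e by rewrite /x !ge_min lexx orbT.
have xc : x <= c / (2 * (K + 1)) by rewrite /x !ge_min lexx !orbT.
have nx : `|x| = x by rewrite gtr0_norm.
have := fc x; rewrite nx => /(_ xe).
have := has_coef_taylor (s := x) (x := x) (y := 0) fa x1.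
rewrite nx normr0 lexx => /(_ isT (ltW x0)).
rewrite -(has_coef_origin fa) f0 a0 mul0r mulr0 !addr0 subr0 => h1 h2.
move: xc; rewrite ler_pdivlMr; last by lra.
have := le_trans h2 h1; rewrite expr2 mulrA ler_pM2r//; nra.
Qed.

(** Without a constant term every coefficient gains at least one factor d. All smallness conditions
    of the implicit function theorem are met in this way. *)
Lemma isA_rescale K f (d : R) : isA K f -> f 0 0 = 0 -> 0 <= d <= 1 ->
  isA (d * K) (fun u v => f (d * u) (d * v)).
Proof.
move=> [a fa] f0 /andP[d0 d1]; have a0 := has_coef_origin fa; rewrite f0 in a0.
have [aK af] := fa.
exists (fun i j => a i j * d ^+ (i + j)); split.
  move=> n; apply: le_trans (ler_wpM2l d0 (aK n)).
  rewrite -sqsumZ; apply: sqsum_le => i j.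
  case: i j => [|i] [|j]; rewrite ?normrM ?(ger0_norm (exprn_ge0 _ d0)).
  - by rewrite -a0 normr0 mul0r mulr0.
  - by rewrite add0n exprS mulrCA ler_wpM2l// ler_piMr// exprn_ile1.
  - by rewrite addn0 exprS mulrCA ler_wpM2l// ler_piMr// exprn_ile1.
  - by rewrite addSn exprS mulrCA ler_wpM2l// ler_piMr// exprn_ile1.
have du u : `|u| <= 1 -> `|d * u| <= 1.
  by move=> u1; rewrite normrM mulr_ile1// ger0_norm.
move=> u v u1 v1; have h := af _ _ (du u u1) (du v v1).
apply: cvg_trans h; apply: near_eq_cvg; apply: nearW => n.
by apply: eq_sqsum => i j; rewrite /term2 exprD !exprMn; ring.
Qed.

(** As in the Schwarz lemma: f - f 0 0 is rescaled by |u| and evaluated at u / |u|, which lies on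
    the boundary of the square. *)
Lemma isA_lip K f (u : R) : isA K f -> `|u| <= 1 ->
  `|f u 0 - f 0 0| <= 2 * K * `|u|.
Proof.
move=> fK u1; have [->|u0] := eqVneq u 0; first by rewrite subrr normr0 mulr0.
have n0 : `|(0 : R)| <= 1 by rewrite normr0.
have := isA_rescale (d := `|u|) (isA_sub fK (isA_cst (f 0 0))).
rewrite subrr normr_ge0 u1 => /(_ erefl isT) h.
have su : `|u / `|u| | <= 1 by rewrite normrM normfV normr_id divff ?normr_eq0.
have := isA_norm h su n0; rewrite mulrCA divff ?normr_eq0// mulr1 mulr0 => H.
apply: le_trans H _; rewrite mulrC ler_wpM2r//.
by have := isA_norm fK n0 n0; lra.
Qed.

(** Absolute convergence at the single corner (d, d) says that the rescaled coefficients have finite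
    l^1 norm. *)
Lemma analytic2_isA (f : R * R -> R) p : analytic2_at f p ->
  exists e K : R, 0 < e /\ isA K (fun u v => f (p.1 + e * u, p.2 + e * v)).
Proof.
move=> [a [e [e0 fa]]]; pose d := e / 2.
have d0 : 0 < d by rewrite divr_gt0.
have de : d < e by rewrite /d; lra.
have nd : `|d| = d by rewrite gtr0_norm.
have nde : `|d| < e by rewrite nd.
have [cN _] := fa d d nde nde.
pose K := limn (fun n => sqsum n (fun i j => `|a i j * d ^+ i * d ^+ j|)).
exists d, K; split => //; exists (fun i j => a i j * d ^+ i * d ^+ j); split.
  move=> n; apply: (@nondecreasing_cvgn_le _ (fun n => sqsum n (fun i j => `|a i j * d ^+ i * d ^+ j|)) _ cN n).
  by move=> m k mk; apply: sqsum_homo.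
move=> u v u1 v1.
have du (x : R) : `|x| <= 1 -> `|d * x| < e.
  by move=> x1; rewrite normrM nd (le_lt_trans _ de)// ler_piMr// ltW.
have [_ h] := fa _ _ (du u u1) (du v v1).
apply: cvg_trans h; apply: near_eq_cvg; apply: nearW => n.
by do 2!(apply: eq_bigr => ? _); rewrite /term2 !exprMn; ring.
Qed.

Lemma isA_analytic2 (f : R * R -> R) p (e K : R) : 0 < e ->
  isA K (fun u v => f (p.1 + e * u, p.2 + e * v)) -> analytic2_at f p.
Proof.
move=> e0 [a [aK af]]; exists (fun i j => a i j * e^-1 ^+ i * e^-1 ^+ j), e; split=> // u v ue ve.
have eu (x : R) : `|x| < e -> `|e^-1 * x| <= 1.
  by move=> xe; rewrite normrM gtr0_norm ?invr_gt0// mulrC ler_pdivrMr// mul1r ltW.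
have E i j : term2 a (e^-1 * u) (e^-1 * v) i j
   = a i j * e^-1 ^+ i * e^-1 ^+ j * u ^+ i * v ^+ j.
  by rewrite /term2 !exprMn; ring.
split.
  apply: nondecreasing_is_cvgn.
    by move=> m k mk; apply: (@sqsum_homo _ m k (fun i j => `|a i j * e^-1 ^+ i * e^-1 ^+ j * u ^+ i * v ^+ j|)).
  exists K => _ [n _ <-]; apply: le_trans (aK n).
  by do 2!(apply: ler_sum => ? _); rewrite -E; apply: term2_le; exact: eu.
have h := af _ _ (eu u ue) (eu v ve).
rewrite !mulrA divff ?lt0r_neq0// !mul1r in h.
apply: cvg_trans h; apply: near_eq_cvg; apply: nearW => n.
by do 2!(apply: eq_bigr => ? _); rewrite E.
Qed.

Lemma isA_comp K c G f g : has_coef K c G -> isA 1 f -> isA 1 g ->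
  isA K (fun u v => G (f u v) (g u v)).
Proof.
move=> [cK cG] f1 g1.
apply: (@isA_square _ K (fun i j => `|c i j|)
  (fun i j u v => c i j * (f u v ^+ i * g u v ^+ j))) => //.
  move=> i j; have := isA_scale (c i j) (isA_mul (isA_exp i f1) (isA_exp j g1)).
  by rewrite !expr1n !mulr1.
move=> u v u1 v1; have h := cG _ _ (isA_norm f1 u1 v1) (isA_norm g1 u1 v1).
apply: cvg_trans h; apply: near_eq_cvg; apply: nearW => n.
by apply: eq_sqsum => i j; rewrite /term2; ring.
Qed.

(** On the ball of radius 1 / 2 the power map has Lipschitz constant n / 2^(n - 1), at most 1 for
    every n; the radius 1 would give the factor n. *)
Lemma isA_subX D f g n : isA (1 / 2) f -> isA (1 / 2) g ->
  isA D (fun u v => f u v - g u v) ->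
  isA D (fun u v => f u v ^+ n - g u v ^+ n).
Proof.
move=> fh gh fg; have D0 := isA_ge0 fg; elim: n => [|[|n] IH].
- have := isA_cst (0 : R); rewrite normr0 => /(isA_le D0); apply: isA_ext => u v _ _.
  by rewrite !expr0 subrr.
- by apply: isA_ext fg => u v _ _; rewrite !expr1.
- have h := isA_add (isA_mul fh IH) (isA_mul fg (isA_exp n.+1 gh)).
  apply: isA_ext (isA_le _ h).
    by move=> u v _ _; rewrite ![_ ^+ n.+2]exprS; ring.
  have : (1 / 2) ^+ n.+1 <= 1 / 2 :> R.
    by rewrite exprS ler_piMr ?exprn_ile1//; lra.
  by move=> hn; have := ler_wpM2l D0 hn; lra.
Qed.

Lemma isA_comp_sub K D c G f g Y : has_coef K c G -> isA (1 / 2) f ->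
  isA (1 / 2) g -> isA D (fun u v => f u v - g u v) -> isA 1 Y ->
  isA (K * D) (fun u v => G (f u v) (Y u v) - G (g u v) (Y u v)).
Proof.
move=> [cK cG] fh gh fg Y1; have D0 := isA_ge0 fg.
have half1 h : isA (1 / 2 : R) h -> isA 1 h by apply: isA_le; lra.
apply: (@isA_square _ (K * D) (fun i j => `|c i j| * D)
  (fun i j u v => c i j * ((f u v ^+ i - g u v ^+ i) * Y u v ^+ j))) => //.
- move=> i j; apply: isA_scale.
  by have := isA_mul (isA_subX i fh gh fg) (isA_exp j Y1); rewrite expr1n mulr1.
- move=> n; rewrite (@eq_sqsum _ _ _ (fun i j => D * `|c i j|)); last first.
    by move=> *; rewrite mulrC.
  by rewrite sqsumZ mulrC ler_wpM2r//; exact: cK.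
- move=> u v u1 v1.
  have hf := cG _ _ (isA_norm (half1 _ fh) u1 v1) (isA_norm Y1 u1 v1).
  have hg := cG _ _ (isA_norm (half1 _ gh) u1 v1) (isA_norm Y1 u1 v1).
  have h : sqsum n (term2 c (f u v) (Y u v)) - sqsum n (term2 c (g u v) (Y u v))
      @[n --> \oo] --> G (f u v) (Y u v) - G (g u v) (Y u v) by exact: cvgB.
  apply: cvg_trans h; apply: near_eq_cvg; apply: nearW => n.
  by rewrite -sqsumB; apply: eq_sqsum => i j; rewrite /term2; ring.
Qed.

End analytic.

(** * The implicit function theorem in the coefficient algebra *)

Section implicit.
Context {R : realType}.
Implicit Types (F f g G w Y : R -> R -> R) (a c : nat -> nat -> R).

Lemma isA_half_cst (x : R) : `|x| <= 1 / 2 -> isA (1 / 2) (fun _ _ => x).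
Proof. by move=> xh; apply: isA_le xh _; exact: isA_cst. Qed.

(** The pointwise estimate is the norm estimate [isA_comp_sub] applied to constant functions. *)
Lemma has_coef_lipschitz K c G (x x' y : R) : has_coef K c G ->
  `|x| <= 1 / 2 -> `|x'| <= 1 / 2 -> `|y| <= 1 ->
  `|G x y - G x' y| <= K * `|x - x'|.
Proof.
move=> cG xh xh' y1.
apply: (@isA_norm _ _ (fun _ _ => G x y - G x' y) 0 0); rewrite ?normr0//.
apply: (isA_comp_sub cG (isA_half_cst xh) (isA_half_cst xh') (isA_cst _)).
by apply: isA_le y1 _; exact: isA_cst.
Qed.

Lemma isA_fixpoint c G w Y : has_coef (1 / 8) c G -> isA (1 / 8) w -> isA 1 Y ->
  exists xi, isA (1 / 2) xi /\ forall u v, `|u| <= 1 -> `|v| <= 1 ->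
    xi u v + G (xi u v) (Y u v) = w u v.
Proof.
move=> cG wh Y1.
pose x := fix x n : R -> R -> R :=
  if n is n'.+1 then fun u v => w u v - G (x n' u v) (Y u v) else fun _ _ => 0.
have xS n u v : x n.+1 u v = w u v - G (x n u v) (Y u v) by [].
have xh n : isA (1 / 2) (x n).
  elim: n => [|n IH]; first by apply: isA_half_cst; rewrite normr0; lra.
  have h1 : isA 1 (x n) by apply: isA_le IH; lra.
  by apply: isA_le (isA_sub wh (isA_comp cG h1 Y1)); lra.
(* The first iterate has norm at most 1 / 8 + 1 / 8, and G contracts by 1 / 8 on the ball of radius
   1 / 2. The weaker ratio 1 / 2 already keeps the sum of all steps at 1 / 2. *)
pose d n : R := 1 / 4 * (1 / 2) ^+ n.
have xd n : isA (d n) (fun u v => x n.+1 u v - x n u v).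
  elim: n => [|n IH].
    have h1 : isA 1 (x 0%N) by apply: isA_le (xh 0%N); lra.
    apply: isA_le (isA_ext _ (isA_sub wh (isA_comp cG h1 Y1))).
      by rewrite /d expr0; lra.
    by move=> u v _ _; rewrite xS (_ : x 0%N u v = 0)// subr0.
  have h := isA_opp (isA_comp_sub cG (xh n.+1) (xh n) IH Y1).
  apply: isA_ext (isA_le _ h).
    by move=> u v _ _; rewrite (xS n.+1) (xS n); ring.
  have : 0 <= (1 / 2) ^+ n :> R by apply: exprn_ge0; lra.
  by rewrite /d exprS; lra.
have sumd n : \sum_(m < n) d m = 1 / 2 - 1 / 2 * (1 / 2) ^+ n.
  elim: n => [|n IH]; first by rewrite big_ord0 expr0; lra.
  by rewrite big_ord_recr/= IH /d exprS; field.
have tele n u v : \sum_(m < n) (x m.+1 u v - x m u v) = x n u v.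
  elim: n => [|n IH]; first by rewrite big_ord0.
  by rewrite big_ord_recr/= IH; ring.
pose xi u v := limn (fun n => x n u v).
have xcv u v : `|u| <= 1 -> `|v| <= 1 -> x n u v @[n --> \oo] --> xi u v.
  move=> u1 v1.
  have : cvgn (series (fun m => x m.+1 u v - x m u v)).
    apply: normed_cvg; apply: (series_le_cvg _ _ (fun m => isA_norm (xd m) u1 v1)) => //.
      by move=> n; exact: isA_ge0 (xd n).
    apply: is_cvg_geometric_series; rewrite ger0_norm; lra.
  rewrite (_ : series _ = (fun n => x n u v)) //.
  by apply/funext => n; rewrite /series/= big_mkord tele.
exists xi; split.
  apply: (@isA_series _ (1 / 2) d (fun n u v => x n.+1 u v - x n u v)) => //.
    move=> n; rewrite sumd; have : 0 <= (1 / 2) ^+ n :> R by apply: exprn_ge0; lra.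
    lra.
  by move=> u v u1 v1; under eq_fun do rewrite tele; exact: xcv.
move=> u v u1 v1.
have Gcv : G (x n u v) (Y u v) @[n --> \oo] --> G (xi u v) (Y u v).
  have xih : `|xi u v| <= 1 / 2.
    by apply: (cvg_norm_le (xcv u v u1 v1)) => n; exact: isA_norm (xh n) u1 v1.
  apply/cvgrPdist_le => e e0.
  have /cvgrPdist_le/(_ _ e0) := xcv u v u1 v1; apply: filterS => n h.
  apply: le_trans (has_coef_lipschitz cG xih (isA_norm (xh n) u1 v1) (isA_norm Y1 u1 v1)) _.
  by have := normr_ge0 (xi u v - x n u v); lra.
have h1 : x n.+1 u v @[n --> \oo] --> w u v - G (xi u v) (Y u v).
  apply: cvgB; [exact: cvg_cst|exact: Gcv].
have h2 : x n.+1 u v @[n --> \oo] --> xi u v.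
  exact: (@cvg_seq_addl _ (fun n => x n u v) _ 1 (xcv u v u1 v1)).
have E : w u v - G (xi u v) (Y u v) = xi u v := cvg_unique (@Rhausdorff R) h1 h2.
by rewrite -[X in X + _]E subrK.
Qed.

(* After rescaling the unknown by r and the second argument by r^2, everything
   but the linear term in the unknown is small, hence isA_fixpoint applies. *)
Lemma isA_implicit Kf Kw Ky (e c eta : R) F w Y : isA Kf F -> isA Kw w -> isA Ky Y ->
  F 0 0 = 0 -> w 0 0 = 0 -> Y 0 0 = 0 ->
  0 < e -> 0 < c -> (forall x, `|x| <= e -> c * `|x| <= `|F x 0|) -> 0 < eta ->
  exists (d L : R) xi, [/\ 0 < d <= 1, isA L xi &
    forall u v, `|u| <= 1 -> `|v| <= 1 ->
      `|xi u v| <= eta /\ F (xi u v) (Y (d * u) (d * v)) = w (d * u) (d * v)].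
Proof.
move=> [a Fa] wK YK F0 w0 Y0 e0 c0 Fc eta0.
have a10 := has_coef_neq0 Fa F0 e0 c0 Fc.
have a00 := has_coef_origin Fa; rewrite F0 in a00.
have [aK aF] := Fa.
have Kf0 : 0 <= Kf by apply: le_trans (aK 0%N); exact: sqnorm_ge0.
have Kw0 := isA_ge0 wK; have Ky0 := isA_ge0 YK.
set A := a 1%N 0%N in a10; have A0 : 0 < `|A| by rewrite normr_gt0.
pose r := Num.min 1 (Num.min eta (`|A| / (8 * (Kf + 1)))).
have r0 : 0 < r.
  by rewrite !lt_min ltr01 eta0 divr_gt0// mulr_gt0//; lra.
have r1 : r <= 1 by rewrite /r ge_min lexx.
have reta : r <= eta by rewrite /r !ge_min lexx orbT.
have rA : r * (8 * (Kf + 1)) <= `|A|.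
  by rewrite -ler_pdivlMr ?mulr_gt0//; [rewrite /r !ge_min lexx !orbT|lra].
have nr : `|r| = r by rewrite gtr0_norm.
have rn0 : r != 0 by rewrite lt0r_neq0.
(* Coefficients of F (r x, r^2 y) / (A r) without its term x. All other nonzero terms have i + 2 j
   >= 2, so a factor r / |A| is left over; the choice of r makes it beat 8 Kf. *)
pose cc i j := if (i == 1)%N && (j == 0)%N then 0 else
  a i j * r ^+ (i + 2 * j) / (A * r).
pose G x y := F (r * x) (r ^+ 2 * y) / (A * r) - x.
have r21 : r ^+ 2 <= 1 by rewrite exprn_ile1// ltW.
have ccG : has_coef (1 / 8) cc G.
  split.
    move=> n; apply: (@le_trans _ _ (r / `|A| * Kf)); last first.
      by rewrite mulrAC ler_pdivrMr//; nra.
    apply: le_trans (ler_wpM2l _ (aK n)); last by rewrite divr_ge0// ltW.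
    rewrite -sqsumZ; apply: sqsum_le => i j; rewrite /cc.
    have P : 0 <= r / `|A| * `|a i j| by rewrite mulr_ge0// divr_ge0// ltW.
    case: ifP => [_|ij]; first by rewrite normr0.
    case: (ltnP (i + 2 * j) 2) => ij2.
      have [-> ->] : i = 0%N /\ j = 0%N.
        by case: i j ij ij2 {P} => [|[|i]] [|[|j]] //=; lia.
      by rewrite -a00 !mul0r !normr0 mulr0.
    rewrite !normrM normfV normrM nr normrX nr -(subnK ij2) exprD.
    have -> : `|a i j| * (r ^+ (i + 2 * j - 2) * r ^+ 2) / (`|A| * r)
            = r ^+ (i + 2 * j - 2) * (r / `|A| * `|a i j|).
      by field; rewrite rn0 lt0r_neq0.
    by rewrite ler_piMl// exprn_ile1// ltW.
  move=> x y x1 y1.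
  have h : sqsum n (term2 a (r * x) (r ^+ 2 * y)) / (A * r) - x @[n --> \oo] --> G x y.
    apply: cvgB; last exact: cvg_cst.
    apply: cvgMl; apply: aF; rewrite normrM mulr_ile1//; first by rewrite nr.
    by rewrite ger0_norm ?exprn_ge0// ltW.
  have h' := cvg_seq_addl 2 h.
  suff : sqsum (2 + n) (term2 cc x y) @[n --> \oo] --> G x y.
    move=> hh; rewrite -(cvg_shiftn 2); apply: cvg_trans hh.
    by apply: near_eq_cvg; apply: nearW => n /=; rewrite addnC.
  apply: cvg_trans h'; apply: near_eq_cvg; apply: nearW => n.
  rewrite -[X in _ - X](@sqsum_delta _ (2 + n) 1 0 x)// mulrC -sqsumZ -sqsumB; apply: eq_sqsum => i j.
  rewrite /term2 /cc [(r * x) ^+ i]exprMn [(r ^+ 2 * y) ^+ j]exprMn -exprM exprD.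
  case: ifP => [/andP[/eqP-> /eqP->]|_]; last by field; rewrite rn0.
  by rewrite muln0 !expr0 !expr1 -/A; field; rewrite rn0.
(* The second scale d makes w / (A r) of norm at most 1 / 8 and Y / r^2 of norm at most 1, as
   [isA_fixpoint] requires. *)
pose d := Num.min 1 (Num.min (`|A| * r / (8 * (Kw + 1))) (r ^+ 2 / (Ky + 1))).
have d0 : 0 < d.
  rewrite !lt_min ltr01/= !divr_gt0 ?exprn_gt0 ?mulr_gt0//; lra.
have d1 : d <= 1 by rewrite /d ge_min lexx.
have dw : d * (8 * (Kw + 1)) <= `|A| * r.
  by rewrite -ler_pdivlMr ?mulr_gt0//; [rewrite /d !ge_min lexx !orbT|lra].
have dY : d * (Ky + 1) <= r ^+ 2.
  by rewrite -ler_pdivlMr; [rewrite /d !ge_min lexx !orbT|lra].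
have d01 : 0 <= d <= 1 by rewrite d1 ltW.
have w' : isA (1 / 8) (fun u v => (A * r)^-1 * w (d * u) (d * v)).
  apply: isA_le (isA_scale _ (isA_rescale wK w0 d01)).
  by rewrite normfV normrM nr ler_pdivrMl ?mulr_gt0//; nra.
have Y' : isA 1 (fun u v => (r ^+ 2)^-1 * Y (d * u) (d * v)).
  apply: isA_le (isA_scale _ (isA_rescale YK Y0 d01)).
  by rewrite normfV normrX nr ler_pdivrMl ?exprn_gt0//; nra.
have [xi [xih xiE]] := isA_fixpoint ccG w' Y'.
exists d, (`|r| * (1 / 2)), (fun u v => r * xi u v); split.
- by rewrite d0 d1.
- exact: isA_scale.
- move=> u v u1 v1; split.
    rewrite normrM nr; apply: le_trans reta.
    by rewrite ler_piMr ?ltW//; have := isA_norm xih u1 v1; lra.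
  have := xiE u v u1 v1; rewrite /G addrC subrK mulrA divff ?expf_neq0// mul1r => h.
  have Arn : A * r != 0 by rewrite mulf_neq0.
  by apply: (mulfI (invr_neq0 Arn)); rewrite -h mulrC.
Qed.

End implicit.

(** * Power series solutions of the linear system *)

Definition entire (R : realType) (c : nat -> R) : Prop :=
  forall r : R, 0 < r -> exists K : R, forall m, `|c m| * r ^+ m <= K.

Definition psum (R : realType) (c : nat -> R) (t : R) : R := limn (pseries c t).

Definition cauchy_conv (R : realType) (a b : nat -> R) m : R :=
  \sum_(j < m.+1) a j * b (m - j)%N.

Section entire.
Context {R : realType}.
Implicit Types a b c : nat -> R.

Lemma entire_bound c (r : R) : entire c -> 0 < r ->
  exists K : R, 0 <= K /\ forall m, `|c m| <= K * r^-1 ^+ m.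
Proof.
move=> ce r0; have [K cK] := ce r r0; exists K; split.
  by apply: le_trans (cK 0%N); rewrite mulr_ge0// exprn_ge0// ltW.
move=> m; rewrite exprVn ler_pdivlMr ?exprn_gt0//; exact: cK.
Qed.

Lemma entire_geometric c (t : R) : entire c ->
  exists K : R, 0 <= K /\ forall m, `|c m * t ^+ m| <= K * (1 / 8) ^+ m.
Proof.
move=> ce; have r0 : 0 < 8 * (`|t| + 1) by have := normr_ge0 t; lra.
have [K [K0 cK]] := entire_bound ce r0; exists K; split => // m.
rewrite normrM normrX.
apply: le_trans (ler_wpM2r (exprn_ge0 _ (normr_ge0 t)) (cK m)) _.
rewrite -mulrA ler_wpM2l// -exprMn lerXn2r// ?nnegrE; last first.
  rewrite ler_pdivrMl//; have := normr_ge0 t; lra.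
  lra.
by rewrite mulr_ge0// invr_ge0 ltW.
Qed.

Lemma entire_cvg c (t : R) : entire c -> cvgn (pseries c t).
Proof.
move=> /entire_geometric -/(_ t)[K [K0 cK]].
apply: normed_cvg; apply: (series_le_cvg _ _ cK) => //.
  by move=> n; rewrite mulr_ge0// exprn_ge0//; lra.
apply: is_cvg_geometric_series; rewrite ger0_norm; lra.
Qed.

Lemma psum_cvg c (t : R) : entire c ->
  (\sum_(m < n) c m * t ^+ m) @[n --> \oo] --> psum c t.
Proof.
move=> ce; have : pseries c t n @[n --> \oo] --> psum c t by exact: entire_cvg.
apply: cvg_trans; apply: near_eq_cvg; apply: nearW => n.
by rewrite /pseries /series /= big_mkord.
Qed.

Lemma entire_diffs c : entire c -> entire (pseries_diffs c).
Proof.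
move=> ce r r0; have r2 : 0 < 2 * r by lra.
have [K cK] := ce _ r2; exists (K / r) => m.
rewrite /pseries_diffs normrM ler_pdivlMr// ger0_norm//.
apply: le_trans (cK m.+1); rewrite exprMn.
have P : 0 <= `|c m.+1| * r ^+ m.+1 by rewrite mulr_ge0// exprn_ge0// ltW.
have -> : m.+1%:R * `|c m.+1| * r ^+ m * r = m.+1%:R * (`|c m.+1| * r ^+ m.+1).
  by rewrite exprSr; ring.
rewrite [leRHS]mulrCA ler_wpM2r// -natrX ler_nat; exact: ltnW (ltn_expl _ _).
Qed.

Lemma psum_der c (t : R) : entire c ->
  is_derive t (1 : R) (psum c) (psum (pseries_diffs c) t).
Proof.
move=> ce; have h := entire_cvg.
apply: (@pseries_snd_diffs _ c (`|t| + 1)).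
- exact: entire_cvg.
- exact: entire_cvg (entire_diffs ce).
- exact: entire_cvg (entire_diffs (entire_diffs ce)).
- have h1 := normr_ge0 t; rewrite [ltRHS]ger0_norm; lra.
Qed.

Lemma psum0 c : psum c 0 = c 0%N.
Proof.
rewrite /psum; apply/cvg_lim; first exact: Rhausdorff.
apply: cvg_near_cst; near=> n; have n0 : (0 < n)%N by near: n; exact: nbhs_infty_gt.
rewrite /pseries /series /= -(prednK n0) big_nat_recl// big1 ?addr0 ?expr0 ?mulr1//.
by move=> i _; rewrite exprS mul0r mulr0.
Unshelve. all: by end_near. Qed.

Lemma sum_triangle n (F : nat -> nat -> R) :
  \sum_(m < n) \sum_(j < m.+1) F j (m - j)%N = \sum_(j < n) \sum_(k < n - j) F j k.
Proof.
elim: n => [|n IH]; first by rewrite !big_ord0.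
rewrite big_ord_recr/= IH.
have -> : \sum_(j < n.+1) \sum_(k < n.+1 - j) F j k =
    \sum_(j < n.+1) (\sum_(k < n - j) F j k + F j (n - j)%N).
  by apply: eq_bigr => j _; rewrite subSn -1?ltnS// big_ord_recr.
rewrite big_split/=; congr (_ + _).
by rewrite [RHS]big_ord_recr/= subnn big_ord0 addr0.
Qed.

Lemma sum_tail_bound (s : nat -> R) (K : R) n m : 0 <= K -> (m <= n)%N ->
  (forall k, `|s k| <= K * (1 / 8) ^+ k) ->
  `|\sum_(k < n) s k - \sum_(k < m) s k| <= n%:R * (K * (1 / 8) ^+ m).
Proof.
move=> K0 mn sK.
rewrite -!(big_mkord xpredT s) (big_cat_nat (leq0n m) mn)/= [X in `|X|]addrC addKr.
apply: le_trans (ler_norm_sum _ _ _) _.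
apply: (@le_trans _ _ (\sum_(m <= k < n) K * (1 / 8) ^+ m)).
  rewrite [leRHS]big_nat_cond [leLHS]big_nat_cond.
  apply: ler_sum => k /andP[/andP[mk _] _]; apply: le_trans (sK k) _.
  by rewrite ler_wpM2l// -(subnK mk) exprD ler_piMl ?exprn_ge0 ?exprn_ile1//; lra.
rewrite sumr_const_nat -[leLHS]mulr_natl ler_wpM2r//.
  by rewrite mulr_ge0// exprn_ge0//; lra.
by rewrite ler_nat leq_subr.
Qed.

(** The square partial sum and the triangular one differ by the products of A j with the tail of B
    after n - j terms. There are at most n^2 products, each at most K L / 8^n, and n^2 <= 4^n, so
    the difference is at most K L / 2^n. *)
Lemma cauchy_product a b (t : R) : entire a -> entire b ->
  (\sum_(m < n) cauchy_conv a b m * t ^+ m) @[n --> \oo] --> psum a t * psum b t.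
Proof.
move=> ae be.
have [K [K0 aK]] := entire_geometric t ae; have [L [L0 bL]] := entire_geometric t be.
pose A j := a j * t ^+ j; pose B j := b j * t ^+ j.
have E n : \sum_(m < n) cauchy_conv a b m * t ^+ m = \sum_(j < n) \sum_(k < n - j) A j * B k.
  rewrite -(sum_triangle n (fun j k => A j * B k)); apply: eq_bigr => m _.
  rewrite /cauchy_conv mulr_suml; apply: eq_bigr => j _; rewrite /A /B.
  have -> : t ^+ m = t ^+ j * t ^+ (m - j) by rewrite -exprD subnKC// -ltnS.
  ring.
have P n : (\sum_(j < n) A j) * (\sum_(k < n) B k) - \sum_(m < n) cauchy_conv a b m * t ^+ m
    = \sum_(j < n) A j * (\sum_(k < n) B k - \sum_(k < n - j) B k).
  rewrite E mulr_suml -sumrB; apply: eq_bigr => j _.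
  by rewrite mulrBr -mulr_sumr.
have Q n : `|(\sum_(j < n) A j) * (\sum_(k < n) B k) - \sum_(m < n) cauchy_conv a b m * t ^+ m|
    <= K * L * (1 / 2) ^+ n.
  rewrite P; apply: le_trans (ler_norm_sum _ _ _) _.
  apply: (@le_trans _ _ (\sum_(j < n) n%:R * (K * L * (1 / 8) ^+ n))).
    apply: ler_sum => j _; rewrite normrM.
    apply: le_trans (ler_pM _ _ (aK j) (sum_tail_bound L0 (leq_subr j n) bL)) _ => //.
    rewrite -[X in _ <= _ * (_ * _ ^+ X)](subnKC (ltnW (ltn_ord j))) exprD.
    by rewrite le_eqVlt; apply/orP; left; apply/eqP; ring.
  rewrite sumr_const card_ord -[leLHS]mulr_natl mulrA -natrM.
  have -> : (1 / 8 : R) = (1 / 4) * (1 / 2) by field.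
  rewrite exprMn; have hp : (n * n)%:R * (1 / 4) ^+ n <= 1 :> R.
    rewrite div1r exprVn ler_pdivrMr ?exprn_gt0// mul1r -natrX ler_nat.
    have h := ltn_expl n (isT : 1 < 2)%N.
    by rewrite -[4%N]/(2 ^ 2)%N -expnM mul2n -addnn expnD leq_mul// ltnW.
  have q0 : 0 <= K * L * (1 / 2) ^+ n by rewrite !mulr_ge0// exprn_ge0//; lra.
  have := ler_wpM2l q0 hp; rewrite mulr1; apply: le_trans.
  by rewrite le_eqVlt; apply/orP; left; apply/eqP; ring.
have lim0 : (\sum_(j < n) A j) * (\sum_(k < n) B k) - \sum_(m < n) cauchy_conv a b m * t ^+ m
    @[n --> \oo] --> 0.
  have g0 : K * L * (1 / 2) ^+ n @[n --> \oo] --> 0.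
    by rewrite -[0](mulr0 (K * L)); apply: cvgMr; apply: cvg_expr; rewrite ger0_norm; lra.
  apply/cvgr0Pnorm_le => e e0.
  move/cvgr0Pnorm_le : g0 => /(_ _ e0); apply: filterS => n h.
  by apply: le_trans (Q n) (le_trans (ler_norm _) h).
have h : (\sum_(j < n) A j) * (\sum_(k < n) B k) - ((\sum_(j < n) A j) * (\sum_(k < n) B k)
    - \sum_(m < n) cauchy_conv a b m * t ^+ m) @[n --> \oo] --> psum a t * psum b t - 0.
  by apply: cvgB lim0; apply: cvgM; exact: psum_cvg.
rewrite subr0 in h; apply: cvg_trans h; apply: near_eq_cvg; apply: nearW => n /=.
by rewrite subKr.
Qed.

End entire.

Definition cosc (R : realType) n : R := (~~ odd n)%:R * (-1) ^+ n./2 * (n`!%:R)^-1.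

(* Taylor coefficients of B + A cos t. *)
Definition forcing (R : realType) (B A : R) n : R :=
  (if n is 0 then B else 0) + A * cosc R n.

Definition lin_next (R : realType) (k B A : R) (z : nat -> R * R) m : R * R :=
  (k / m.+1%:R * ((z m).1 - cauchy_conv (forcing B A) (fun i => (z i).2) m),
   k / m.+1%:R * (cauchy_conv (forcing B A) (fun i => (z i).1) m - (z m).2)).

(** The convolution in [lin_next] needs all earlier coefficients, so stage n carries the whole
    sequence, correct up to index n; [lin_coef] reads off the diagonal. *)
Fixpoint lin_approx (R : realType) (k : R) (z0 : R * R) (B A : R) n : nat -> R * R :=
  if n is n'.+1 then
    fun i => if (i <= n')%N then lin_approx k z0 B A n' i
             else lin_next k B A (lin_approx k z0 B A n') n'
  else fun _ => z0.

Definition lin_coef (R : realType) (k : R) (z0 : R * R) (B A : R) n : R * R :=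
  lin_approx k z0 B A n n.

Section linear.
Context {R : realType}.
Variables (k : R) (z0 : R * R).
Hypothesis k0 : 0 < k.

Lemma lin_approxE B A n i : (i <= n)%N ->
  lin_approx k z0 B A n i = lin_coef k z0 B A i.
Proof.
elim: n => [|n IH]; first by rewrite leqn0 => /eqP ->.
rewrite leq_eqVlt => /orP[/eqP->//|]; rewrite ltnS => ni.
by rewrite /= ni IH.
Qed.

Lemma lin_coefS B A m :
  lin_coef k z0 B A m.+1 = lin_next k B A (lin_coef k z0 B A) m.
Proof.
rewrite {1}/lin_coef /= ltnn /lin_next lin_approxE//.
by congr (_ * (_ - _), _ * (_ - _)); apply: eq_bigr => j _;
  rewrite lin_approxE// leq_subr.
Qed.

Lemma cosc_le n : `|cosc R n| <= (n`!%:R)^-1.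
Proof.
rewrite /cosc !normrM normfV !normr_nat normrX normrN1 expr1n mulr1.
by rewrite ler_piMl// lern1 leq_b1.
Qed.

Lemma cosc_entire : entire (cosc R).
Proof.
move=> r r0; exists (expR r) => m.
apply: le_trans (ler_wpM2r (exprn_ge0 _ (ltW r0)) (cosc_le m)) _.
case: m => [|m]; first by rewrite fact0 invr1 expr0 mulr1 -expR0 ler_expR ltW.
have := expR_ge1Dxn m (ltW r0); rewrite mulrC; lra.
Qed.

Lemma entireD (a b : nat -> R) : entire a -> entire b -> entire (fun n => a n + b n : R).
Proof.
move=> ae be r r0; have [K aK] := ae r r0; have [L bL] := be r r0.
exists (K + L) => m; apply: le_trans (lerD (aK m) (bL m)).
rewrite -mulrDl; apply: ler_wpM2r; [exact: exprn_ge0 (ltW r0)|exact: ler_normD].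
Qed.

Lemma entireZ (a : nat -> R) (c : R) : entire a -> entire (fun n => c * a n : R).
Proof.
move=> ae r r0; have [K aK] := ae r r0; exists (`|c| * K) => m.
by rewrite normrM -mulrA; apply: ler_wpM2l; [exact: normr_ge0|exact: aK].
Qed.

Lemma entire_first (c : R) : entire (fun n => if n is 0 then c else 0 : R).
Proof.
move=> r r0; exists `|c| => -[|m]; first by rewrite expr0 mulr1.
by rewrite normr0 mul0r.
Qed.

Lemma forcing_entire (B A : R) : entire (forcing B A).
Proof. exact: entireD (entire_first B) (entireZ A cosc_entire). Qed.

Lemma psumE (a : nat -> R) (t l : R) : (\sum_(m < n) a m * t ^+ m) @[n --> \oo] --> l ->
  psum a t = l.
Proof.
move=> h; apply/cvg_lim; first exact: Rhausdorff.
apply: cvg_trans h; apply: near_eq_cvg; apply: nearW => n.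
by rewrite /pseries /series /= big_mkord.
Qed.

Lemma psumD (a b : nat -> R) (t : R) : entire a -> entire b ->
  psum (fun n => a n + b n) t = psum a t + psum b t.
Proof.
move=> ae be; apply: psumE; under eq_fun.
  move=> n; under eq_bigr do rewrite mulrDl; rewrite big_split; over.
by apply: cvgD; exact: psum_cvg.
Qed.

Lemma psumZ (a : nat -> R) (t c : R) : entire a -> psum (fun n => c * a n) t = c * psum a t.
Proof.
move=> ae; apply: psumE; under eq_fun.
  move=> n; under eq_bigr do rewrite -mulrA; rewrite -mulr_sumr; over.
by apply: cvgMr; exact: psum_cvg.
Qed.

Lemma psum_cosc (t : R) : psum (cosc R) t = cos t.
Proof. by rewrite cosE. Qed.

Lemma psum_first (c t : R) : psum (fun n => if n is 0 then c else 0 : R) t = c.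
Proof.
apply: psumE; apply: cvg_near_cst; near=> n.
have n0 : (0 < n)%N by near: n; exact: nbhs_infty_gt.
rewrite -(prednK n0) big_ord_recl big1 ?addr0 ?expr0 ?mulr1// => i _.
by rewrite /= mul0r.
Unshelve. all: by end_near. Qed.

Lemma psum_forcing (B A t : R) : psum (forcing B A) t = B + A * cos t.
Proof.
rewrite psumD ?psumZ ?psum_first ?psum_cosc//.
- exact: cosc_entire.
- exact: entire_first.
- exact: entireZ cosc_entire.
Qed.

Section at_parameters.
Variables (B0 A0 : R).
Let x m u v := (lin_coef k z0 (B0 + u) (A0 + v) m).1.
Let y m u v := (lin_coef k z0 (B0 + u) (A0 + v) m).2.
Let C := `|B0| + `|A0| + 2.

Lemma isA_shift_u (b : R) : isA (`|b| + 1) (fun u _ : R => b + u).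
Proof.
apply: isA_add; first exact: isA_cst.
by have := @isA_mono R 1 0; apply: isA_ext => u v _ _; rewrite expr0 mulr1 expr1.
Qed.

Lemma isA_shift_v (b : R) : isA (`|b| + 1) (fun _ v : R => b + v).
Proof.
apply: isA_add; first exact: isA_cst.
by have := @isA_mono R 0 1; apply: isA_ext => u v _ _; rewrite expr0 mul1r expr1.
Qed.

Lemma isA_forcing j : isA (C / j`!%:R) (fun u v => forcing (B0 + u) (A0 + v) j).
Proof.
have hA : isA ((`|A0| + 1) / j`!%:R) (fun u v : R => (A0 + v) * cosc R j).
  apply: isA_le _ (isA_mul (isA_shift_v A0) (isA_cst (cosc R j))).
  by rewrite ler_wpM2l ?cosc_le//; have := normr_ge0 A0; lra.
have nA := normr_ge0 A0; have nB := normr_ge0 B0.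
case: j hA => [|j] hA.
  apply: isA_le (isA_add (isA_shift_u B0) hA).
  by rewrite fact0 !divr1 /C; lra.
apply: isA_ext (isA_le _ hA); first by move=> u v _ _; rewrite /forcing add0r.
by rewrite ler_wpM2r ?invr_ge0// /C; lra.
Qed.

Lemma isA_cauchy_conv (N : nat -> R) (z : nat -> R -> R -> R) m :
  (forall i, (i <= m)%N -> isA (N i) (z i)) ->
  isA (\sum_(j < m.+1) C / j`!%:R * N (m - j)%N)
    (fun u v => cauchy_conv (forcing (B0 + u) (A0 + v)) (fun i => z i u v) m).
Proof.
move=> zN; apply: (@isA_sum _ m.+1 (fun j => C / j`!%:R * N (m - j)%N)
  (fun j u v => forcing (B0 + u) (A0 + v) j * z (m - j)%N u v)) => j jm.
by apply: isA_mul; [exact: isA_forcing|apply: zN; rewrite leq_subr].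
Qed.

Lemma isA_lin_step (N : nat -> R) m :
  (forall i, (i <= m)%N -> isA (N i) (x i) /\ isA (N i) (y i)) ->
  let K := k / m.+1%:R * (N m + \sum_(j < m.+1) C / j`!%:R * N (m - j)%N) in
  isA K (x m.+1) /\ isA K (y m.+1).
Proof.
move=> xyN K; have km : `|k / m.+1%:R| = k / m.+1%:R by rewrite ger0_norm// divr_ge0// ltW.
have hx : forall i, (i <= m)%N -> isA (N i) (x i) by move=> i /xyN[].
have hy : forall i, (i <= m)%N -> isA (N i) (y i) by move=> i /xyN[].
split.
- have := isA_scale (k / m.+1%:R) (isA_sub (hx m (leqnn m)) (isA_cauchy_conv hy)).
  rewrite km; apply: isA_ext => u v _ _; by rewrite [x m.+1 u v]/x lin_coefS.
- have := isA_scale (k / m.+1%:R) (isA_sub (isA_cauchy_conv hx) (hy m (leqnn m))).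
  rewrite km addrC; apply: isA_ext => u v _ _; by rewrite [y m.+1 u v]/y lin_coefS.
Qed.

Lemma isA_lin_some m : exists K : R, forall i, (i <= m)%N -> isA K (x i) /\ isA K (y i).
Proof.
elim: m => [|m [K IH]].
  exists (`|z0.1| + `|z0.2|) => i; rewrite leqn0 => /eqP->; split.
    by apply: isA_le (isA_cst z0.1); rewrite lerDl.
  by apply: isA_le (isA_cst z0.2); rewrite lerDr.
have [hx hy] := isA_lin_step IH; set L := (k / _ * _) in hx hy.
have L0 := isA_ge0 hx; have K0 := isA_ge0 (IH 0%N isT).1.
exists (K + L) => i; rewrite leq_eqVlt => /orP[/eqP->|].
  by split; [apply: isA_le hx|apply: isA_le hy]; rewrite lerDr.
by rewrite ltnS => /IH[? ?]; split; [apply: isA_le (_ : K <= _) _|apply: isA_le (_ : K <= _) _] => //; rewrite lerDl.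
Qed.

Lemma exp_partial_sum (r : R) n : 0 <= r -> \sum_(j < n) r ^+ j / j`!%:R <= expR r.
Proof.
move=> r0; rewrite -(big_mkord xpredT (fun j => r ^+ j / j`!%:R)).
apply: (@nondecreasing_cvgn_le _ (series (exp_coeff r)) _ (is_cvg_series_exp_coeff r) n).
by apply: nondecreasing_series => i _ /=; rewrite divr_ge0// exprn_ge0.
Qed.

(** If the bound holds up to m, the convolution contributes at most C expR r times K / r^m, so the
    next coefficient gains the factor k (1 + C expR r) / (m + 1). This is at most 1 / r once m + 1
    >= L. The finitely many earlier coefficients are absorbed by the factor (1 + r)^N in K. *)
Lemma isA_lin_geometric (r : R) : 0 < r ->
  exists K : R, forall m, isA (K * r^-1 ^+ m) (x m) /\ isA (K * r^-1 ^+ m) (y m).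
Proof.
move=> r0; pose L := k * r * (1 + C * expR r).
have nA := normr_ge0 A0; have nB := normr_ge0 B0; have C0 : 0 <= C by rewrite /C; lra.
have [N LN] : exists N : nat, L <= N%:R.
  exists (Num.bound `|L|); apply: le_trans (ler_norm _) _; exact: ltW (archi_boundP (normr_ge0 L)).
have [K1 xyK] := isA_lin_some N.
have K10 : 0 <= K1 := isA_ge0 (xyK 0%N isT).1.
pose K := K1 * (1 + r) ^+ N; exists K.
have K0 : 0 <= K by rewrite mulr_ge0// exprn_ge0//; lra.
have small m : (m <= N)%N -> K1 <= K * r^-1 ^+ m.
  move=> mN; rewrite exprVn ler_pdivlMr ?exprn_gt0// ler_wpM2l//.
  apply: (@le_trans _ _ ((1 + r) ^+ m)); first by rewrite lerXn2r// ?nnegrE; lra.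
  by rewrite ler_weXn2l//; lra.
elim/ltn_ind => -[|m] IH.
  by have [? ?] := xyK 0%N isT; split; [apply: isA_le (small 0%N isT) _|apply: isA_le (small 0%N isT) _].
case: (leqP m.+1 N) => mN.
  by have [? ?] := xyK m.+1 mN; split; [apply: isA_le (small m.+1 mN) _|apply: isA_le (small m.+1 mN) _].
have h := @isA_lin_step (fun i => K * r^-1 ^+ i) m (fun i im => IH i im).
have hle : k / m.+1%:R * (K * r^-1 ^+ m + \sum_(j < m.+1) C / j`!%:R * (K * r^-1 ^+ (m - j)))
    <= K * r^-1 ^+ m.+1.
  have E : \sum_(j < m.+1) C / j`!%:R * (K * r^-1 ^+ (m - j)) =
      C * K * r^-1 ^+ m * \sum_(j < m.+1) r ^+ j / j`!%:R.
    rewrite mulr_sumr; apply: eq_bigr => j _.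
    have -> : r^-1 ^+ m = r^-1 ^+ j * r^-1 ^+ (m - j) by rewrite -exprD subnKC// -ltnS.
    have rj : r ^+ j * r^-1 ^+ j = 1 by rewrite exprVn divff// expf_neq0// lt0r_neq0.
    rewrite [RHS](_ : _ = C / j`!%:R * (K * r^-1 ^+ (m - j)) * (r ^+ j * r^-1 ^+ j)).
      by rewrite rj mulr1.
    by ring.
  have q0 : 0 <= K * r^-1 ^+ m by rewrite mulr_ge0// exprn_ge0// invr_ge0 ltW.
  have e1 := exp_partial_sum m.+1 (ltW r0).
  have : \sum_(j < m.+1) C / j`!%:R * (K * r^-1 ^+ (m - j)) <= C * K * r^-1 ^+ m * expR r.
    by rewrite E ler_wpM2l// -mulrA mulr_ge0.
  set S := \sum_(j < m.+1) _ => hS.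
  have : k * (K * r^-1 ^+ m + S) <= k * (K * r^-1 ^+ m * (1 + C * expR r)).
    by apply: ler_wpM2l; [exact: ltW|lra].
  have Lm : L <= m.+1%:R by apply: le_trans LN _; rewrite ler_nat ltnW.
  have := ler_wpM2l q0 Lm; rewrite /L => h2 h1.
  rewrite mulrAC ler_pdivrMr// exprSr.
  have -> : K * (r^-1 ^+ m * r^-1) * m.+1%:R = K * r^-1 ^+ m * m.+1%:R / r by ring.
  by rewrite ler_pdivlMr//; apply: le_trans _ h2; apply: le_trans (ler_wpM2r (ltW r0) h1) _;
    rewrite le_eqVlt; apply/orP; left; apply/eqP; ring.
by split; apply: isA_le hle _; case: h.
Qed.

(** The radius 2 (b + 1) leaves a geometric factor 1 / 2 for every |t| <= b. One K serves all these
    times, which later makes estimates uniform over a period. *)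
Lemma lin_psum_isA (b : R) : 0 <= b -> exists K : R, forall t, `|t| <= b ->
  isA K (fun u v => psum (fun m => x m u v) t) /\ isA K (fun u v => psum (fun m => y m u v) t).
Proof.
move=> b0; have r0 : 0 < 2 * (b + 1) by lra.
have [K xyK] := isA_lin_geometric r0.
have K0 : 0 <= K by have := isA_ge0 (xyK 0%N).1; rewrite expr0 mulr1.
have S n : \sum_(m < n) K * (1 / 2) ^+ m <= 2 * K.
  have -> : \sum_(m < n) K * (1 / 2) ^+ m = 2 * K - 2 * K * (1 / 2) ^+ n.
    elim: n => [|n IH]; first by rewrite big_ord0 expr0; ring.
    by rewrite big_ord_recr/= IH exprS; field.
  have : 0 <= (1 / 2) ^+ n :> R by rewrite exprn_ge0//; lra.
  by nra.
exists (2 * K) => t tb.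
have gen (z : nat -> R -> R -> R) :
    (forall r, 0 < r -> exists L, forall m, isA (L * r^-1 ^+ m) (z m)) ->
    (forall m, isA (K * (2 * (b + 1))^-1 ^+ m) (z m)) ->
    isA (2 * K) (fun u v => psum (fun m => z m u v) t).
  move=> ze zK; apply: (@isA_series _ _ (fun m => K * (1 / 2) ^+ m) (fun m u v => t ^+ m * z m u v)) => //.
    move=> m; apply: isA_le _ (isA_scale (t ^+ m) (zK m)).
    rewrite mulrCA ler_wpM2l// normrX -exprMn lerXn2r// ?nnegrE.
    - by rewrite mulr_ge0// invr_ge0 ltW.
    - by rewrite divr_ge0.
    - by rewrite ler_pdivrMr//; lra.
  move=> u v u1 v1; under eq_fun do under eq_bigr do rewrite mulrC.
  apply: psum_cvg => r rp; have [L zL] := ze r rp; exists L => m.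
  by have := isA_norm (zL m) u1 v1; rewrite exprVn ler_pdivlMr// exprn_gt0.
by split; apply: gen => [r /isA_lin_geometric[L xyL]|m]; try exists L => m;
  [case: (xyL m)|case: (xyK m)|case: (xyL m)|case: (xyK m)].
Qed.

End at_parameters.

Lemma lin_coef_entire (B A : R) :
  entire (fun m => (lin_coef k z0 B A m).1) /\ entire (fun m => (lin_coef k z0 B A m).2).
Proof.
split=> r rp; have [L xyL] := isA_lin_geometric B A rp; exists L => m.
  have := isA_norm (xyL m).1 (u := 0) (v := 0); rewrite normr0 !addr0 => /(_ ler01 ler01).
  by rewrite exprVn ler_pdivlMr// exprn_gt0.
have := isA_norm (xyL m).2 (u := 0) (v := 0); rewrite normr0 !addr0 => /(_ ler01 ler01).
by rewrite exprVn ler_pdivlMr// exprn_gt0.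
Qed.

Definition linx (B A t : R) : R := psum (fun m => (lin_coef k z0 B A m).1) t.
Definition liny (B A t : R) : R := psum (fun m => (lin_coef k z0 B A m).2) t.

Lemma linx0 (B A : R) : linx B A 0 = z0.1. Proof. exact: psum0. Qed.
Lemma liny0 (B A : R) : liny B A 0 = z0.2. Proof. exact: psum0. Qed.

Lemma psum_cauchy_conv (a b : nat -> R) (t : R) : entire a -> entire b ->
  psum (cauchy_conv a b) t = psum a t * psum b t.
Proof. by move=> ae be; apply: psumE; exact: cauchy_product. Qed.

Lemma eq_psum (a b : nat -> R) (t : R) : (forall m, a m = b m) -> psum a t = psum b t.
Proof. by move=> ab; congr psum; apply/funext. Qed.

(** Boundedness at the radius 2 r leaves a factor 2^m, which absorbs the m + 1 terms of the
    convolution. *)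
Lemma entire_cauchy_conv (a b : nat -> R) : entire a -> entire b -> entire (cauchy_conv a b).
Proof.
move=> ae be r r0; have r2 : 0 < 2 * r by lra.
have [K aK] := ae _ r2; have [L bL] := be _ r2; exists (K * L) => m.
have K0 : 0 <= K by apply: le_trans (aK 0%N); rewrite expr0 mulr1.
have L0 : 0 <= L by apply: le_trans (bL 0%N); rewrite expr0 mulr1.
have rm : 0 < r ^+ m by rewrite exprn_gt0.
have h j : (j < m.+1)%N -> `|a j * b (m - j)%N| * (2 * r) ^+ m <= K * L.
  move=> jm; rewrite normrM -(subnKC (jm : (j <= m)%N)) exprD.
  have -> : (j + (m - j) - j = m - j)%N by lia.
  rewrite mulrACA ler_pM// ?mulr_ge0// ?exprn_ge0//; lra.
have : `|cauchy_conv a b m| * (2 * r) ^+ m <= \sum_(j < m.+1) (K * L).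
  apply: le_trans (ler_wpM2r _ (ler_norm_sum _ _ _)) _; first by rewrite exprn_ge0//; lra.
  by rewrite mulr_suml; apply: ler_sum => j _; exact: h.
rewrite sumr_const card_ord exprMn -[X in _ <= X]mulr_natl => h2.
have h3 : m.+1%:R <= 2 ^+ m :> R by rewrite -natrX ler_nat ltn_expl.
have p2 : 0 < 2 ^+ m :> R by rewrite exprn_gt0.
rewrite -(ler_pM2l p2) mulrCA; apply: le_trans h2 _.
by rewrite ler_wpM2r// mulr_ge0.
Qed.

Lemma linx_der (B A t : R) :
  is_derive t (1 : R) (linx B A) (k * (linx B A t - (B + A * cos t) * liny B A t)).
Proof.
have [xe ye] := lin_coef_entire B A; have fe := forcing_entire B A.
apply: der1_eq (psum_der t xe) _.
rewrite (@eq_psum _ (fun m => k * ((lin_coef k z0 B A m).1 +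
    - 1 * cauchy_conv (forcing B A) (fun i => (lin_coef k z0 B A i).2) m))); last first.
  by move=> m; rewrite /pseries_diffs lin_coefS /= mulN1r; field; rewrite lt0r_neq0.
have ce := entire_cauchy_conv fe ye.
rewrite psumZ; last exact: entireD xe (entireZ _ ce).
by rewrite psumD// ?psumZ// ?psum_cauchy_conv ?psum_forcing// ?mulN1r//; exact: entireZ.
Qed.

Lemma liny_der (B A t : R) :
  is_derive t (1 : R) (liny B A) (k * ((B + A * cos t) * linx B A t - liny B A t)).
Proof.
have [xe ye] := lin_coef_entire B A; have fe := forcing_entire B A.
apply: der1_eq (psum_der t ye) _.
rewrite (@eq_psum _ (fun m => k * (cauchy_conv (forcing B A) (fun i => (lin_coef k z0 B A i).1) m
    + - 1 * (lin_coef k z0 B A m).2))); last first.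
  by move=> m; rewrite /pseries_diffs lin_coefS /= mulN1r; field; rewrite lt0r_neq0.
have ce := entire_cauchy_conv fe xe.
rewrite psumZ; last exact: entireD ce (entireZ _ ye).
by rewrite psumD// ?psumZ// ?psum_cauchy_conv ?psum_forcing// ?mulN1r//; exact: entireZ.
Qed.

End linear.

(** * Growth, uniqueness and Wronskian of the linear system *)

Definition is_lin (R : realType) (k B A : R) (x y : R -> R) : Prop :=
  forall t : R, is_derive t (1 : R) x (k * (x t - (B + A * cos t) * y t)) /\
                is_derive t (1 : R) y (k * ((B + A * cos t) * x t - y t)).

Section growth.
Context {R : realType}.

Lemma growth_right (f f' : R -> R) (K a b : R) : 0 < K ->
  (forall t, is_derive t (1 : R) f (f' t)) -> (forall t, `|f' t| <= K * f t) ->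
  a <= b -> f b <= f a * expR (K * (b - a)).
Proof.
move=> K0 df fK ab; apply: (gronwall0 K0 df) => // t _.
exact: le_trans (ler_norm _) (fK t).
Qed.

Lemma growth (f f' : R -> R) (K a b : R) : 0 < K ->
  (forall t, is_derive t (1 : R) f (f' t)) -> (forall t, `|f' t| <= K * f t) ->
  f b <= f a * expR (K * `|b - a|).
Proof.
move=> K0 df fK; case: (leP a b) => ab.
  by rewrite ger0_norm ?subr_ge0//; exact: growth_right df fK ab.
pose g t := f (- t); pose g' t := - f' (- t).
have dg t : is_derive t (1 : R) g (g' t).
  by rewrite /g /g'; der; rewrite mulrN1.
have gK t : `|g' t| <= K * g t by rewrite /g' normrN.
have := growth_right K0 dg gK (a := - a) (b := - b).
rewrite lerN2 => /(_ (ltW ab)); rewrite /g !opprK ltr0_norm ?subr_lt0// opprB.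
by rewrite addrC.
Qed.

Lemma IVT_zero (f : R -> R) (a b : R) : continuous f -> f a <= 0 -> 0 <= f b ->
  exists2 c, (Num.min a b <= c <= Num.max a b) & f c = 0.
Proof.
move=> cf fa fb; case: (leP a b) => ab.
  have [||c] := @IVT R f a b 0 ab; first exact: continuous_subspaceT.
    by rewrite ge_min fa/= le_max fb orbT.
  by rewrite in_itv => ? ?; exists c.
have [||c] := @IVT R f b a 0 (ltW ab); first exact: continuous_subspaceT.
  by rewrite ge_min fa/= orbT le_max fb.
by rewrite in_itv => ? ?; exists c.
Qed.

Lemma nonzero_pos (f : R -> R) (a : R) : continuous f -> (forall t, f t != 0) ->
  0 < f a -> forall t, 0 < f t.
Proof.
move=> cf fn0 fa t; case: (ltP 0 (f t)) => // ft.
have [c _ /eqP] := IVT_zero cf ft (ltW fa).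
by rewrite (negPf (fn0 c)).
Qed.

Lemma sin_lip (a b : R) : `|sin a - sin b| <= `|a - b|.
Proof.
wlog ab : a b / b <= a.
  move=> h; case: (leP b a) => [/h//|/ltW/h]; by rewrite distrC [leRHS]distrC.
have := @der1_bound R sin cos b a 1 (fun t => is_derive_sin t) _ ab.
by rewrite mul1r [`|a - b|]ger0_norm ?subr_ge0//; apply=> t _; exact: cos_max.
Qed.

Lemma cos_lip (a b : R) : `|cos a - cos b| <= `|a - b|.
Proof. by rewrite -!sinDpihalf; apply: le_trans (sin_lip _ _) _; rewrite opprD addrACA subrr addr0. Qed.

End growth.

Section lin.
Context {R : realType}.
Variables (k B A : R).
Hypothesis k0 : 0 < k.
Implicit Types x y : R -> R.

Lemma is_lin_comb x y x' y' (a b : R) : is_lin k B A x y -> is_lin k B A x' y' ->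
  is_lin k B A (fun t => a * x t + b * x' t) (fun t => a * y t + b * y' t).
Proof.
move=> h h' t; have [d1 d2] := h t; have [d1' d2'] := h' t.
by split; der; ring.
Qed.

Lemma is_lin_sqr x y : is_lin k B A x y -> forall t,
  is_derive t (1 : R) (fun t => x t ^+ 2 + y t ^+ 2) (2 * k * (x t ^+ 2 - y t ^+ 2)).
Proof. by move=> h t; have [d1 d2] := h t; der; ring. Qed.

Lemma is_lin_sqr_le x y : is_lin k B A x y -> forall t,
  `|2 * k * (x t ^+ 2 - y t ^+ 2)| <= 2 * k * (x t ^+ 2 + y t ^+ 2).
Proof.
move=> h t; have hx := mulr_ge0 (ltW k0) (sqr_ge0 (x t)).
have hy := mulr_ge0 (ltW k0) (sqr_ge0 (y t)).
by rewrite ler_norml; apply/andP; split; lra.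
Qed.

Lemma is_lin_growth x y (a b : R) : is_lin k B A x y ->
  x b ^+ 2 + y b ^+ 2 <= (x a ^+ 2 + y a ^+ 2) * expR (2 * k * `|b - a|).
Proof.
move=> h; have K0 : 0 < 2 * k by rewrite mulr_gt0.
exact: (growth a b K0 (is_lin_sqr h) (is_lin_sqr_le h)).
Qed.

Lemma is_lin_zero x y (a : R) : is_lin k B A x y -> x a = 0 -> y a = 0 ->
  forall t, x t = 0 /\ y t = 0.
Proof.
move=> h xa ya t; have := is_lin_growth a t h.
rewrite xa ya expr0n addr0 mul0r => q.
have := sqr_ge0 (x t); have := sqr_ge0 (y t) => *.
by split; apply/eqP; rewrite -sqrf_eq0; apply/eqP; lra.
Qed.

Lemma is_lin_pos x y (a : R) : is_lin k B A x y -> 0 < x a ^+ 2 + y a ^+ 2 ->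
  forall t, 0 < x t ^+ 2 + y t ^+ 2.
Proof.
move=> h a0 t; have := is_lin_growth t a h.
have := expR_gt0 (2 * k * `|a - t|); set e := expR _ => e0 q.
by rewrite -(pmulr_lgt0 _ e0); apply: lt_le_trans q.
Qed.

Lemma is_lin_wronskian x y x' y' : is_lin k B A x y -> is_lin k B A x' y' ->
  forall s t, x s * y' s - x' s * y s = x t * y' t - x' t * y t.
Proof.
move=> h h' s t.
apply: (@der1_zero R (fun t => x t * y' t - x' t * y t)) => u.
by have [d1 d2] := h u; have [d1' d2'] := h' u; der; ring.
Qed.

Lemma is_lin_shift x y (s : R) n : s = 2 * pi * n%:R -> is_lin k B A x y ->
  is_lin k B A (fun t => x (t + s)) (fun t => y (t + s)).
Proof.
move=> -> h t; have cE : cos (t + 2 * pi * n%:R) = cos t.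
  have -> : 2 * pi * n%:R = pi *+ 2 *+ n :> R by rewrite -[RHS]mulr_natr -[pi *+ 2]mulr_natl.
  exact: (periodicn (@cosD2pi R)).
have [d1 d2] := h (t + 2 * pi * n%:R); rewrite cE in d1 d2.
by split; der; ring.
Qed.

End lin.

(** * The monodromy matrix and its trace *)

Section monodromy.
Context {R : realType}.
Variable k : R.
Hypothesis k0 : 0 < k.

Lemma lin_is_lin z0 (B A : R) : is_lin k B A (linx k z0 B A) (liny k z0 B A).
Proof. by move=> t; split; [exact: linx_der|exact: liny_der]. Qed.

Lemma is_lin_basis (B A : R) x y : is_lin k B A x y -> forall t,
  x t = x 0 * linx k (1, 0) B A t + y 0 * linx k (0, 1) B A t /\
  y t = x 0 * liny k (1, 0) B A t + y 0 * liny k (0, 1) B A t.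
Proof.
move=> h t.
have h2 := is_lin_comb (x 0) (y 0) (lin_is_lin (1, 0) B A) (lin_is_lin (0, 1) B A).
have [||h3 h4] := is_lin_zero k0 (a := 0) (is_lin_comb 1 (-1) h h2) _ _ t.
- by rewrite !linx0 /=; ring.
- by rewrite !liny0 /=; ring.
- split; apply/eqP; rewrite -subr_eq0; apply/eqP.
    by rewrite -[RHS]h3; ring.
  by rewrite -[RHS]h4; ring.
Qed.

Definition mono11 (B A : R) := linx k (1, 0) B A (2 * pi).
Definition mono12 (B A : R) := linx k (0, 1) B A (2 * pi).
Definition mono21 (B A : R) := liny k (1, 0) B A (2 * pi).
Definition mono22 (B A : R) := liny k (0, 1) B A (2 * pi).
Definition trmono (B A : R) := mono11 B A + mono22 B A.

Lemma det_mono (B A : R) :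
  mono11 B A * mono22 B A - mono12 B A * mono21 B A = 1.
Proof.
have := is_lin_wronskian (lin_is_lin (1, 0) B A) (lin_is_lin (0, 1) B A) (2 * pi) 0.
by rewrite !linx0 !liny0 /= mulr1 mulr0 subr0.
Qed.

Lemma is_lin_mono (B A : R) x y n : is_lin k B A x y ->
  x (2 * pi * n.+1%:R) = mono11 B A * x (2 * pi * n%:R) + mono12 B A * y (2 * pi * n%:R) /\
  y (2 * pi * n.+1%:R) = mono21 B A * x (2 * pi * n%:R) + mono22 B A * y (2 * pi * n%:R).
Proof.
move=> h; have := is_lin_basis (is_lin_shift (erefl (2 * pi * n%:R)) h) (2 * pi).
rewrite !add0r (_ : 2 * pi + 2 * pi * n%:R = 2 * pi * n.+1%:R); last first.
  by rewrite -[n.+1%:R]natr1; ring.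
by move=> [-> ->]; rewrite /mono11 /mono12 /mono21 /mono22; split; ring.
Qed.

Lemma trmono_analytic p : analytic2_at (fun p => trmono p.1 p.2) p.
Proof.
have p2 : 0 <= 2 * pi :> R by rewrite mulr_ge0// pi_ge0.
have p2' : `|2 * pi| <= 2 * pi :> R by rewrite ger0_norm.
have [K /(_ _ p2')[hK _]] := lin_psum_isA (1, 0) k0 p.1 p.2 p2.
have [L /(_ _ p2')[_ hL]] := lin_psum_isA (0, 1) k0 p.1 p.2 p2.
apply: (@isA_analytic2 _ _ _ 1 (K + L)) => //.
by apply: isA_ext (isA_add hK hL) => u v _ _; rewrite !mul1r.
Qed.

End monodromy.

(** * The phase equation *)

Section phase.
Context {R : realType}.
Variable omega : R.
Hypothesis omega0 : 0 < omega.
Let k := (2 * omega)^-1.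
Implicit Types phi psi : R -> R.

Lemma rate_gt0 : 0 < k.
Proof. by rewrite invr_gt0 mulr_gt0. Qed.
Let k0 := rate_gt0.

Lemma is_solutionE (B A : R) phi : is_solution omega B A phi <->
  forall t, is_derive t (1 : R) phi (2 * k * (B + A * cos t - sin (phi t))).
Proof.
split=> [h t|h l mu t].
  by apply: der1_eq (h t) _; rewrite /k; field; rewrite lt0r_neq0.
by apply: der1_eq (h t) _; rewrite /l /mu /k; field; rewrite lt0r_neq0.
Qed.

Lemma solution_continuous (B A : R) phi : is_solution omega B A phi -> continuous phi.
Proof. by move=> /is_solutionE; exact: der1_continuous. Qed.

(** Squaring the difference d avoids differentiating an absolute value: (d^2)' <= 4 k d^2 + 2 |d|
    eta <= (4 k + 1) d^2 + eta^2. The one inequality gives uniqueness, dependence on the initial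
    value and dependence on the parameters. *)
Lemma solution_gronwall (B A B' A' : R) phi psi (s t : R) :
  is_solution omega B A phi -> is_solution omega B' A' psi -> s <= t ->
  (phi t - psi t) ^+ 2 <=
  ((phi s - psi s) ^+ 2 + (2 * k * (`|B - B'| + `|A - A'|)) ^+ 2)
    * expR ((4 * k + 1) * (t - s)).
Proof.
move=> /is_solutionE dphi /is_solutionE dpsi st.
set eta := 2 * k * _; set K := 4 * k + 1.
have K1 : 1 <= K by rewrite lerDr mulr_ge0// ltW.
have K0 : 0 < K by lra.
pose D t := (phi t - psi t) ^+ 2.
pose D' t := 2 * (phi t - psi t) * (2 * k * (B + A * cos t - sin (phi t))
  - 2 * k * (B' + A' * cos t - sin (psi t))).
have dD u : is_derive u (1 : R) D (D' u) by rewrite /D /D'; der; ring.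
have D'le u : s <= u <= t -> D' u <= K * D u + eta ^+ 2.
  move=> _; rewrite /D' /D; set d := phi u - psi u.
  set E := (X in _ * X <= _).
  have hE : `|E| <= 2 * k * `|d| + eta.
    have -> : E = 2 * k * (((B - B') + (A - A') * cos u) - (sin (phi u) - sin (psi u))).
      by rewrite /E; ring.
    rewrite normrM (@ger0_norm _ (2 * k)); last by rewrite mulr_ge0 ?(ltW k0).
    rewrite /eta -mulrDr; apply: ler_wpM2l; first by rewrite mulr_ge0 ?(ltW k0).
    apply: le_trans (ler_normB _ _) _; rewrite addrC lerD//; first exact: sin_lip.
    apply: le_trans (ler_normD _ _) _; rewrite lerD2l normrM ler_piMr//.
    exact: cos_max.
  have h1 : 2 * d * E <= 2 * (`|d| * `|E|).
    by have := ler_norm (d * E); rewrite normrM; lra.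
  have h2 := ler_wpM2l (normr_ge0 d) hE.
  have dd : d ^+ 2 = `|d| ^+ 2 by rewrite real_normK ?num_real.
  rewrite /K dd; have := sqr_ge0 (`|d| - eta); nra.
have := gronwall K0 dD D'le st; rewrite /D => h.
apply: le_trans h _.
have e1 : 1 <= expR (K * (t - s)).
  by rewrite -expR0 ler_expR mulr_ge0 ?subr_ge0// ltW.
have CK : eta ^+ 2 / K <= eta ^+ 2 by rewrite ler_pdivrMr// ler_peMr// sqr_ge0.
have CK0 : 0 <= eta ^+ 2 / K by rewrite divr_ge0 ?sqr_ge0// ltW.
set e := expR _ in e1 *; have e0 : 0 <= e by lra.
have := ler_wpM2r e0 CK; lra.
Qed.

Lemma solution_unique (B A : R) phi psi (s t : R) :
  is_solution omega B A phi -> is_solution omega B A psi ->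
  phi s = psi s -> s <= t -> phi t = psi t.
Proof.
move=> h h' e st; have := solution_gronwall h h' st.
rewrite e !subrr normr0 addr0 mulr0 expr0n addr0 mul0r => q.
by apply/eqP; rewrite -subr_eq0 -sqrf_eq0 eq_le q sqr_ge0.
Qed.

Lemma solution_mono (B A : R) phi psi (s t : R) :
  is_solution omega B A phi -> is_solution omega B A psi ->
  phi s <= psi s -> s <= t -> phi t <= psi t.
Proof.
move=> h h' e st; rewrite leNgt; apply/negP => lt.
have cd : continuous (fun u => phi u - psi u).
  by move=> u; apply: cvgB; [exact: solution_continuous h u|exact: solution_continuous h' u].
have [|| c] := IVT_zero (a := s) (b := t) cd.
- by rewrite subr_le0.
- by rewrite subr_ge0 ltW.
rewrite (min_idPl st) (max_idPr st) => /andP[sc ct] /eqP; rewrite subr_eq0 => /eqP ec.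
by have E := solution_unique h h' ec ct; rewrite E ltxx in lt.
Qed.

Lemma solution_shift (B A : R) phi n (m : int) : is_solution omega B A phi ->
  is_solution omega B A (fun t => phi (t + 2 * pi * n%:R) - 2 * pi * m%:~R).
Proof.
move=> /is_solutionE h; apply/is_solutionE => t.
have cE : cos (t + 2 * pi * n%:R) = cos t.
  have -> : 2 * pi * n%:R = pi *+ 2 *+ n :> R by rewrite -[RHS]mulr_natr -[pi *+ 2]mulr_natl.
  exact: (periodicn (@cosD2pi R)).
have sE : sin (phi (t + 2 * pi * n%:R) - 2 * pi * m%:~R) = sin (phi (t + 2 * pi * n%:R)).
  set a := phi _; rewrite sinB.
  have [-> ->] : cos (2 * pi * m%:~R) = 1 :> R /\ sin (2 * pi * m%:~R) = 0 :> R.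
    have P (j : nat) : cos (2 * pi * j%:R) = 1 :> R /\ sin (2 * pi * j%:R) = 0 :> R.
      have -> : 2 * pi * j%:R = pi *+ 2 *+ j :> R by rewrite -[RHS]mulr_natr -[pi *+ 2]mulr_natl.
      rewrite -[X in cos X]add0r -[X in sin X]add0r (periodicn (@cosD2pi R)) (periodicn (@sinD2pi R)).
      by rewrite cos0 sin0.
    case: (P `|m|%N) => c s; case: (intP m) c s => [|j|j] c s.
    - by rewrite mulr0 cos0 sin0.
    - by rewrite c s.
    - by rewrite mulrNz mulrN cosN sinN c s oppr0.
  by ring.
by rewrite sE -cE; der; ring.
Qed.

(** Existence for the nonlinear equation is read off the linear one: a continuous angle of (x, y) is
    an antiderivative of its angular velocity, and phi is twice that angle. *)
Lemma solution_polar_exists (B A phi0 : R) :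
  let x := linx k (cos (phi0 / 2), sin (phi0 / 2)) B A in
  let y := liny k (cos (phi0 / 2), sin (phi0 / 2)) B A in
  exists phi r : R -> R, [/\ is_solution omega B A phi, phi 0 = phi0 &
    forall t, [/\ 0 < r t, x t = r t * cos (phi t / 2) & y t = r t * sin (phi t / 2)]].
Proof.
move=> x y; have xy : is_lin k B A x y by exact: lin_is_lin.
have x0 : x 0 = cos (phi0 / 2) by rewrite /x linx0.
have y0 : y 0 = sin (phi0 / 2) by rewrite /y liny0.
have q0 t : 0 < x t ^+ 2 + y t ^+ 2.
  by apply: (is_lin_pos k0 (a := 0) xy); rewrite x0 y0 cos2Dsin2.
have qn t := lt0r_neq0 (q0 t).
pose g t := k * (B + A * cos t - 2 * x t * y t / (x t ^+ 2 + y t ^+ 2)).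
have cg : continuous g.
  have dg t : exists d : R, is_derive t (1 : R) g d.
    have [dx dy] := xy t; have q := qn t.
    by eexists; rewrite /g; repeat (der1_step || exact: q).
  by move=> t; have [d hd] := dg t; apply: differentiable_continuous; apply/derivable1_diffP; case: hd.
have [G [G0 dG]] := antiderivative cg.
pose th t := phi0 / 2 + G t.
have dth t : is_derive t (1 : R) th (g t) by rewrite /th; der; rewrite add0r.
pose s t := - (x t * sin (th t)) + y t * cos (th t).
pose c t := x t * cos (th t) + y t * sin (th t).
(* g is the angular velocity of (x, y), so s is constant up to the length of (x, y). *)
have ds t : is_derive t (1 : R) (fun t => s t ^+ 2 / (x t ^+ 2 + y t ^+ 2)) 0.
  have [dx dy] := xy t; have q := qn t.
  eapply der1_eq; first by rewrite /s; repeat (der1_step || exact: q).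
  by rewrite /g; field.
have s0 t : s t = 0.
  have := der1_zero ds t 0; rewrite {2}/s x0 y0 /th G0 addr0 (_ : - _ + _ = 0).
    by rewrite expr0n mul0r => /eqP; rewrite mulf_eq0 invr_eq0 (negPf (qn t)) orbF sqrf_eq0 => /eqP.
  by ring.
have xE t : x t = c t * cos (th t).
  transitivity (x t * (cos (th t) ^+ 2 + sin (th t) ^+ 2) + s t * sin (th t)).
    by rewrite s0 cos2Dsin2; ring.
  by rewrite /s /c; ring.
have yE t : y t = c t * sin (th t).
  transitivity (y t * (cos (th t) ^+ 2 + sin (th t) ^+ 2) - s t * cos (th t)).
    by rewrite s0 cos2Dsin2; ring.
  by rewrite /s /c; ring.
(* As s = 0, c^2 is the squared length of (x, y), which never vanishes; so c keeps its positive sign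
   at 0 and is the radius. *)
have cn t : c t != 0.
  by apply: contraNneq (qn t) => c0; rewrite xE yE c0 !mul0r expr0n addr0.
have c0 : 0 < c 0 by rewrite /c x0 y0 /th G0 addr0 -!expr2 cos2Dsin2.
have cc : continuous c.
  have dc t : exists d : R, is_derive t (1 : R) c d.
    by have [dx dy] := xy t; eexists; rewrite /c; repeat der1_step.
  by move=> t; have [d hd] := dc t; apply: differentiable_continuous; apply/derivable1_diffP; case: hd.
have th2 t : 2 * th t / 2 = th t by field.
exists (fun t => 2 * th t), c; split.
- apply/is_solutionE => t; der.
  have s2 : sin (2 * th t) = 2 * (sin (th t) * cos (th t)).
    by rewrite (_ : 2 * th t = th t + th t); [rewrite sinD; ring|ring].
  have qE : x t ^+ 2 + y t ^+ 2 = c t ^+ 2.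
    by rewrite xE yE !exprMn -mulrDr cos2Dsin2 mulr1.
  by rewrite s2 /g qE xE yE; have := cn t => ct; field.
- by rewrite /th G0 addr0; field.
- by move=> t; rewrite th2; split=> //; exact: nonzero_pos cc cn c0 t.
Qed.

Lemma solution_exists (B A phi0 : R) :
  exists phi, is_solution omega B A phi /\ phi 0 = phi0.
Proof. by have [phi [_ [h e _]]] := solution_polar_exists B A phi0; exists phi. Qed.

Lemma solution_polar (B A : R) phi : is_solution omega B A phi ->
  let z := (cos (phi 0 / 2), sin (phi 0 / 2)) in
  exists r : R -> R, forall t, 0 <= t -> [/\ 0 < r t,
    linx k z B A t = r t * cos (phi t / 2) & liny k z B A t = r t * sin (phi t / 2)].
Proof.
move=> h z; have [psi [r [h' e rP]]] := solution_polar_exists B A (phi 0).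
by exists r => t t0; rewrite -(solution_unique h' h e t0); exact: rP.
Qed.
End phase.

(** * Angles modulo pi *)

Section trig.
Context {R : realType}.

Definition parity (n : int) : R := (-1) ^+ `|n|%N.

Lemma parity_sqr n : parity n * parity n = 1.
Proof. by rewrite /parity -exprD addnn -mul2n exprM sqrrN expr1n expr1n. Qed.

Lemma parity_neq0 n : parity n != 0.
Proof. by apply/eqP => h; have := parity_sqr n; rewrite h mul0r => /eqP; rewrite eq_sym oner_eq0. Qed.

Lemma trig_shift_nat (f : R -> R) (x : R) (n : nat) : alternating f pi ->
  f (x + pi * n%:R) = (-1) ^+ n * f x.
Proof. by move=> fa; rewrite mulr_natr alternatingn. Qed.

Lemma trig_shift (f : R -> R) (x : R) (n : int) : alternating f pi ->
  f (x + pi * n%:~R) = parity n * f x.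
Proof.
move=> fa; rewrite /parity; case: (intP n) => [|j|j].
- by rewrite mulr0 addr0 expr0 mul1r.
- exact: trig_shift_nat.
- have := trig_shift_nat (x + pi * (- j.+1%:Z)%:~R) j.+1 fa.
  rewrite -addrA mulrNz -mulrDr addNr mulr0 addr0 => ->.
  by rewrite mulrA abszN -exprD addnn -mul2n exprM sqrrN expr1n expr1n mul1r.
Qed.

Lemma sin_shift (x : R) n : sin (x + pi * n%:~R) = parity n * sin x.
Proof. by apply: trig_shift; exact: sinDpi. Qed.

Lemma cos_shift (x : R) n : cos (x + pi * n%:~R) = parity n * cos x.
Proof. by apply: trig_shift; exact: cosDpi. Qed.

Lemma floor_pi (x : R) : exists n : int, pi * n%:~R <= x < pi * n%:~R + pi.
Proof.
have p0 := pi_gt0 R; exists (Num.floor (x / pi)).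
have /andP[h1 h2] := Num.Theory.floor_itv (x / pi).
rewrite ler_pdivlMr// in h1; rewrite ltr_pdivrMr// intrD mulrDl mul1r in h2.
by apply/andP; split; lra.
Qed.

Lemma sin_eq0_int (x : R) : sin x = 0 -> exists n : int, x = pi * n%:~R.
Proof.
move=> sx; have [n /andP[n1 n2]] := floor_pi x; exists n.
have h : sin (x - pi * n%:~R) = 0.
  have := sin_shift (x - pi * n%:~R) n; rewrite subrK sx => /esym/eqP.
  by rewrite mulf_eq0 (negPf (parity_neq0 n)) => /eqP.
apply/eqP; rewrite eq_le n1 andbT leNgt; apply/negP => lt.
have : 0 < sin (x - pi * n%:~R) by apply: sin_gt0_pi; lra.
by rewrite h ltxx.
Qed.

Lemma sin_int (n : int) : sin (pi * n%:~R : R) = 0.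
Proof. by rewrite -[pi * _]add0r sin_shift sin0 mulr0. Qed.

Lemma sin_lt0_2pi (x : R) : pi < x < 2 * pi -> sin x < 0.
Proof.
move=> h; have : 0 < sin (x - pi) by apply: sin_gt0_pi; lra.
by have := sinDpi (x - pi); rewrite subrK => ->; rewrite oppr_lt0.
Qed.

Lemma polar (C S : R) : C ^+ 2 + S ^+ 2 = 1 -> exists th, C = cos th /\ S = sin th.
Proof.
move=> h; have hC := sqr_ge0 C; have hS := sqr_ge0 S.
have C1 : -1 <= C <= 1.
  by rewrite -ler_norml -(@ler_sqr _ _ 1) ?nnegrE// real_normK ?num_real// expr1n; lra.
have cK : cos (acos C) = C by apply: acosK; rewrite in_itv.
have sK : sin (acos C) = `|S| by rewrite sin_acos// -h addrC addKr sqrtr_sqr.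
case: (leP 0 S) => S0.
  by exists (acos C); rewrite cK sK ger0_norm.
by exists (- acos C); rewrite cosN sinN cK sK ltr0_norm// opprK.
Qed.

(** Both angles advance by less than pi, so from inside a cell between consecutive multiples of pi
    they end in that cell, at its upper end, or inside the next one. The sign of the sine tells
    these cases apart and is the same for a and b, hence both always share a cell. *)
Lemma lockstep (a b P Q : nat -> R) : a 0%N = 0 -> b 0%N = 0 ->
  (forall j, 0 < a j.+1 - a j < pi) -> (forall j, 0 < b j.+1 - b j < pi) ->
  (forall j, [/\ 0 < P j, 0 < Q j & P j * sin (a j) = Q j * sin (b j)]) ->
  forall j, `|a j - b j| <= pi.
Proof.
move=> a0 b0 da db PQ; have p0 := pi_gt0 R.
suff inv j : exists m : nat, (a j = pi * m%:R /\ b j = pi * m%:R) \/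
    (pi * m%:R < a j < pi * m%:R + pi /\ pi * m%:R < b j < pi * m%:R + pi).
  move=> j; have [m [[-> ->]|[/andP[? ?] /andP[? ?]]]] := inv j.
    by rewrite subrr normr0 ltW.
  by rewrite ler_norml; apply/andP; split; lra.
elim: j => [|j [m IH]]; first by exists 0%N; left; rewrite a0 b0 mulr0.
have /andP[da1 da2] := da j; have /andP[db1 db2] := db j.
case: IH => [[aj bj]|[/andP[? ?] /andP[? ?]]].
  by exists m; right; split; apply/andP; split; lra.
have [Pp Qp PQe] := PQ j.+1.
pose u := a j.+1 - pi * m%:R; pose v := b j.+1 - pi * m%:R.
have eu : a j.+1 = u + pi * m%:R by rewrite subrK.
have ev : b j.+1 = v + pi * m%:R by rewrite subrK.
have uv : P j.+1 * sin u = Q j.+1 * sin v.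
  move: PQe; rewrite eu ev !(trig_shift_nat _ _ (@sinDpi R)).
  rewrite mulrCA [RHS]mulrCA; apply: mulfI.
  by rewrite expf_neq0// oppr_eq0 oner_neq0.
have u1 : 0 < u by rewrite /u; lra.
have u2 : u < 2 * pi by rewrite /u; lra.
have v1 : 0 < v by rewrite /v; lra.
have v2 : v < 2 * pi by rewrite /v; lra.
have tri (w : R) : 0 < w -> w < 2 * pi ->
    [\/ w < pi /\ 0 < sin w, w = pi /\ sin w = 0 | pi < w /\ sin w < 0].
  move=> w1 w2; case: (ltgtP w pi) => h.
  - by apply: Or31; split => //; apply: sin_gt0_pi; rewrite w1.
  - by apply: Or33; split => //; apply: sin_lt0_2pi; rewrite h w2.
  - by apply: Or32; rewrite h sinpi.
have sgn : (0 < sin u) = (0 < sin v) /\ (sin u < 0) = (sin v < 0).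
  split.
    by rewrite -(pmulr_rgt0 _ Pp) uv pmulr_rgt0.
  by rewrite -(pmulr_rlt0 _ Pp) uv pmulr_rlt0.
have [[s1 s2] eqm] : ((0 < sin u) = (0 < sin v) /\ (sin u < 0) = (sin v < 0)) /\
    pi * m.+1%:R = pi * m%:R + pi :> R by split => //; rewrite -natr1; ring.
case: (tri u u1 u2) (tri v v1 v2) => -[hu su] [] [hv sv].
- by exists m; right; split; apply/andP; split; lra.
- by move: s1; rewrite su sv ltxx.
- by move: s1; rewrite su => /esym; lra.
- by move: s1; rewrite su sv ltxx.
- by exists m.+1; left; rewrite eqm; split; lra.
- by move: s2; rewrite su sv ltxx.
- by move: s2; rewrite su => /esym; lra.
- by move: s2; rewrite su sv ltxx.
- by exists m.+1; right; rewrite eqm; split; apply/andP; split; lra.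
Qed.

End trig.

(** * The rotation number and the monodromy *)

Section rotation.
Context {R : realType}.
Variable omega : R.
Hypothesis omega0 : 0 < omega.
Let k := (2 * omega)^-1.
Let k0 : 0 < k := rate_gt0 omega0.
Implicit Types phi psi : R -> R.

(** Stronger than convergence of the mean displacement: the deviation from the drift r is bounded
    uniformly over all solutions and all times. *)
Definition tracks (B A r C : R) := forall phi j, is_solution omega B A phi ->
  `|phi (2 * pi * j%:R) - phi 0 - 2 * pi * j%:R * r| <= C.

Lemma tracks_cvg (B A r C : R) phi : tracks B A r C -> is_solution omega B A phi ->
  phi (2 * pi * j%:R) / (2 * pi * j%:R) @[j --> \oo] --> r.
Proof.
move=> tr h; have p0 := pi_gt0 R.
have C0 : 0 <= C by apply: le_trans (tr phi 0%N h).
apply/cvgrPdist_le => e e0.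
near=> j.
have j0 : (0 < j)%N by near: j; exact: nbhs_infty_gt.
have j0' : 0 < j%:R :> R by rewrite ltr0n.
have je : (C + `|phi 0|) / e <= j%:R by near: j; exact: nbhs_infty_ger.
have s0 : 0 < 2 * pi * j%:R :> R by rewrite mulr_gt0// mulr_gt0.
set s : R := 2 * pi * j%:R in s0 *.
have -> : r - phi s / s = - (phi s - s * r) / s by field; exact: lt0r_neq0.
rewrite normrM normrN normfV (gtr0_norm s0) ler_pdivrMr//.
have h1 : `|phi s - s * r| <= C + `|phi 0|.
  have -> : phi s - s * r = (phi s - phi 0 - s * r) + phi 0 by ring.
  by apply: le_trans (ler_normD _ _) _; rewrite lerD2r; exact: tr.
apply: le_trans h1 _; move: je; rewrite ler_pdivrMr// => je.
apply: le_trans je _; rewrite mulrC ler_wpM2l ?(ltW e0)// /s.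
by have := pi_ge2 R; nra.
Unshelve. all: by end_near. Qed.

Lemma tracks_rho (B A r C : R) : tracks B A r C -> rotation_number omega (B, A) = r.
Proof.
move=> tr; apply: xget_unique => /=.
  by move=> phi h; exact: tracks_cvg tr h.
move=> r' hr'; have [phi [h _]] := solution_exists omega0 B A 0.
exact: (cvg_unique (@Rhausdorff R) (hr' phi h) (tracks_cvg tr h)).
Qed.

Lemma solution_orbit (B A : R) phi psi j : is_solution omega B A phi ->
  is_solution omega B A psi -> psi 0 = phi (2 * pi * j%:R) ->
  psi (2 * pi) = phi (2 * pi * j.+1%:R).
Proof.
move=> h h' e; have p0 := pi_gt0 R.
have hs := solution_shift omega0 j 0 h.
rewrite (solution_unique omega0 h' hs (s := 0) (t := 2 * pi)).
- by rewrite mulr0 subr0; congr phi; rewrite -natr1; ring.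
- by rewrite add0r mulr0 subr0.
- by rewrite mulr_ge0 ?ltW.
Qed.

(** Translates of phi by multiples of 2 pi are solutions too. Any psi starts between two consecutive
    translates and, by monotonicity, stays between them. *)
Lemma locked_tracks (B A : R) phi (n : int) : is_solution omega B A phi ->
  phi (2 * pi) = phi 0 + 2 * pi * n%:~R -> tracks B A n%:~R (4 * pi).
Proof.
move=> h hn psi j hpsi; have p0 := pi_gt0 R.
have orb i : phi (2 * pi * i%:R) = phi 0 + 2 * pi * i%:R * n%:~R.
  elim: i => [|i IH]; first by rewrite !mulr0 mul0r addr0.
  have hs := solution_shift omega0 0 (- (n * i%:Z)) h.
  have zE : (- (n * i%:Z))%:~R = - (n%:~R * i%:R) :> R by rewrite mulrNz intrM.
  rewrite -(solution_orbit h hs (j := i)).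
    by rewrite mulr0 addr0 hn zE -natr1; ring.
  by rewrite IH mulr0 addr0 zE; ring.
have [m /andP[m1 m2]] := floor_pi ((psi 0 - phi 0) / 2).
have j0 : 0 <= 2 * pi * j%:R :> R by rewrite mulr_ge0// mulr_ge0// ltW.
have h1 := solution_shift omega0 0 (- m) h; have h2 := solution_shift omega0 0 (- (m + 1)) h.
have a1 : phi (2 * pi * j%:R + 2 * pi * 0) - 2 * pi * (- m)%:~R <= psi (2 * pi * j%:R).
  apply: (solution_mono omega0 h1 hpsi (s := 0)) => //.
  by rewrite mulr0 addr0 mulrNz; lra.
have a2 : psi (2 * pi * j%:R) <= phi (2 * pi * j%:R + 2 * pi * 0) - 2 * pi * (- (m + 1))%:~R.
  apply: (solution_mono omega0 hpsi h2 (s := 0)) => //.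
  by rewrite mulr0 addr0 mulrNz intrD; lra.
rewrite mulr0 addr0 orb mulrNz in a1; rewrite mulr0 addr0 orb mulrNz intrD in a2.
by rewrite ler_norml; apply/andP; split; lra.
Qed.

Lemma mono_eigen (B A : R) : 4 <= trmono k B A ^+ 2 ->
  exists a b la : R, [/\ a ^+ 2 + b ^+ 2 = 1,
    mono11 k B A * a + mono12 k B A * b = la * a &
    mono21 k B A * a + mono22 k B A * b = la * b].
Proof.
rewrite /trmono; have := det_mono k0 B A.
move: (mono11 k B A) (mono12 k B A) (mono21 k B A) (mono22 k B A) => p q r s det tr.
suff [a [b [la [n0 e1 e2]]]] : exists a b la : R,
    [/\ 0 < a ^+ 2 + b ^+ 2, p * a + q * b = la * a & r * a + s * b = la * b].
  pose N := Num.sqrt (a ^+ 2 + b ^+ 2).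
  have N0 : 0 < N by rewrite sqrtr_gt0.
  have NN : N ^+ 2 = a ^+ 2 + b ^+ 2 by rewrite sqr_sqrtr// ltW.
  exists (a / N), (b / N), la; split.
  - by rewrite !exprMn exprVn -mulrDl -NN divff// expf_neq0// lt0r_neq0.
  - by rewrite !mulrA -mulrDl e1.
  - by rewrite !mulrA -mulrDl e2.
have [q0|q0] := eqVneq q 0.
  exists 0, 1, s; split; last by ring.
    by rewrite expr0n expr1n add0r.
  by rewrite q0; ring.
pose D := Num.sqrt ((p + s) ^+ 2 - 4).
have DD : D ^+ 2 = (p + s) ^+ 2 - 4 by rewrite sqr_sqrtr// subr_ge0.
pose la := (p + s + D) / 2.
have laE : la ^+ 2 - (p + s) * la + 1 = 0.
  have -> : la ^+ 2 - (p + s) * la + 1 = (D ^+ 2 - ((p + s) ^+ 2 - 4)) / 4.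
    by rewrite /la; field.
  by rewrite DD subrr mul0r.
exists q, (la - p), la; split.
- by rewrite ltr_wpDr ?sqr_ge0// exprn_even_gt0.
- by ring.
- apply/eqP; rewrite -subr_eq0; apply/eqP.
  transitivity (- (la ^+ 2 - (p + s) * la + 1) - (p * s - q * r - 1)); first by ring.
  by rewrite laE det subrr oppr0 addr0.
Qed.

Lemma hyperbolic_locked (B A : R) : 4 <= trmono k B A ^+ 2 ->
  exists phi (n : int), is_solution omega B A phi /\ phi (2 * pi) = phi 0 + 2 * pi * n%:~R.
Proof.
move=> /mono_eigen[a [b [la [ab e1 e2]]]].
have [th [aE bE]] := polar ab.
have [phi [h phi0]] := solution_exists omega0 B A (2 * th).
have th2 : phi 0 / 2 = th by rewrite phi0; field.
have [r] := solution_polar omega0 h; rewrite th2 -aE -bE => rP.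
have p2 : 0 <= 2 * pi :> R by rewrite mulr_ge0// pi_ge0.
have [r0 xE yE] := rP _ p2.
have [] := is_lin_mono k0 0 (lin_is_lin k0 (a, b) B A).
rewrite mulr1 mulr0 linx0 liny0 /= e1 e2 => x1 y1.
have : sin (phi (2 * pi) / 2 - th) = 0.
  apply: (mulfI (lt0r_neq0 r0)); rewrite mulr0 sinB mulrBr !mulrA -xE -yE x1 y1 aE bE.
  by ring.
move=> /sin_eq0_int[n hn]; exists phi, n; split => //.
rewrite phi0; lra.
Qed.

End rotation.

Lemma lip_continuous (R : realType) (f : R -> R) (L : R) :
  (forall a b, `|f a - f b| <= L * `|a - b|) -> continuous f.
Proof.
move=> fL x; have L0 : 0 <= L.
  by have := fL 1 0; rewrite subr0 normr1 mulr1; apply: le_trans.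
apply/cvgrPdist_le => e e0; near=> y.
apply: le_trans (fL x y) _.
apply: (@le_trans _ _ ((L + 1) * `|x - y|)); first by rewrite ler_wpM2r// lerDl.
rewrite mulrC -ler_pdivlMr ?ltr_wpDl//; near: y.
by apply: cvgr_dist_le => //; rewrite divr_gt0// ltr_wpDl.
Unshelve. all: by end_near. Qed.

(** * Elliptic monodromy *)

Section elliptic.
Context {R : realType}.
Variable omega : R.
Hypothesis omega0 : 0 < omega.
Let k := (2 * omega)^-1.
Let k0 : 0 < k := rate_gt0 omega0.
Implicit Types phi psi : R -> R.

Lemma period_map (B A : R) : exists P : R -> R, continuous P /\
  forall phi, is_solution omega B A phi -> phi (2 * pi) = P (phi 0).
Proof.
have /choice[S SP] := solution_exists omega0 B A.
have p2 : 0 <= 2 * pi :> R by rewrite mulr_ge0// pi_ge0.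
exists (fun a => S a (2 * pi)); split; last first.
  move=> phi h; have [h' e] := SP (phi 0).
  exact: (solution_unique omega0 h h' (esym e) p2).
pose E := expR ((4 * k + 1) * (2 * pi - 0)).
apply: (@lip_continuous _ _ (Num.sqrt E)) => a b.
have [ha ea] := SP a; have [hb eb] := SP b.
have := solution_gronwall omega0 ha hb p2.
rewrite ea eb !subrr normr0 addr0 mulr0 expr0n addr0 -/k -/E => h.
rewrite -ler_sqr ?nnegrE ?mulr_ge0 ?sqrtr_ge0// exprMn !real_normK ?num_real//.
by rewrite sqr_sqrtr ?expR_ge0// [leRHS]mulrC.
Qed.

Section elliptic_parameter.
Variables (B A : R).
Let T := trmono k B A.
Let m21 := mono21 k B A.
Hypothesis T4 : T ^+ 2 < 4.

(** The cross product of v = (a, b) and M v is a quadratic form of discriminant T^2 - 4, hence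
    definite with the sign of its leading coefficient M21. *)
Lemma elliptic_cross (a b : R) : 0 < a ^+ 2 + b ^+ 2 ->
  0 < m21 * (a * (m21 * a + mono22 k B A * b) - b * (mono11 k B A * a + mono12 k B A * b)).
Proof.
have det := det_mono k0 B A; move: T4; rewrite /T /trmono /m21.
move: (mono11 k B A) (mono12 k B A) (mono21 k B A) (mono22 k B A) det => p q r s det tr ab.
have -> : r * (a * (r * a + s * b) - b * (p * a + q * b)) =
  (r * a + (s - p) * b / 2) ^+ 2 + (4 * (p * s - q * r) - (p + s) ^+ 2) / 4 * b ^+ 2.
  by field.
rewrite det mulr1; have d0 : 0 < (4 - (p + s) ^+ 2) / 4 by lra.
have [b0|b0] := eqVneq b 0; last first.
  by rewrite ltr_wpDl ?sqr_ge0// mulr_gt0// exprn_even_gt0.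
rewrite b0 mulr0 mul0r addr0 expr0n mulr0 addr0 exprn_even_gt0//= mulf_neq0//.
  by apply/eqP => r0; move: det tr; rewrite r0 => *; have := sqr_ge0 (p - s); nra.
by apply: contraTneq ab => ->; rewrite b0 expr0n addr0 ltxx.
Qed.

Lemma elliptic_sin phi : is_solution omega B A phi ->
  0 < m21 * sin ((phi (2 * pi) - phi 0) / 2).
Proof.
move=> h; have hl := lin_is_lin k0 (cos (phi 0 / 2), sin (phi 0 / 2)) B A.
have [r rP] := solution_polar omega0 h.
have p2 : 0 <= 2 * pi :> R by rewrite mulr_ge0// pi_ge0.
have [r0 xE yE] := rP _ p2.
have [] := is_lin_mono k0 0 hl; rewrite mulr1 mulr0 linx0 liny0 /= => x1 y1.
have := elliptic_cross (a := cos (phi 0 / 2)) (b := sin (phi 0 / 2)).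
rewrite cos2Dsin2 => /(_ ltr01); rewrite -x1 -y1 xE yE.
move=> H; rewrite -(pmulr_rgt0 _ r0).
have -> : (phi (2 * pi) - phi 0) / 2 = phi (2 * pi) / 2 - phi 0 / 2 by field.
rewrite sinB; move: H; rewrite -/m21; congr (is_true (0 < _)); ring.
Qed.

(** Half the displacement over a period is a continuous function of the initial phase, and by
    [elliptic_sin] it is never a multiple of pi; so it stays between the same two multiples for all
    initial phases. *)
Lemma elliptic_winding : exists n : int, 0 < m21 * (@parity R n) /\
  forall phi, is_solution omega B A phi ->
    pi * n%:~R < (phi (2 * pi) - phi 0) / 2 < pi * n%:~R + pi.
Proof.
have [P [cP PE]] := period_map B A.
pose h a := (P a - a) / 2.
have ch : continuous h.
  move=> x; apply: cvgMl; apply: cvgB; [exact: cP|exact: cvg_id].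
have hs a : 0 < m21 * sin (h a).
  have [phi [hphi e]] := solution_exists omega0 B A a.
  by have := elliptic_sin hphi; rewrite (PE _ hphi) e.
have hn a (n : int) : h a != pi * n%:~R.
  by apply/eqP => e; have := hs a; rewrite e sin_int mulr0 ltxx.
have [n /andP[n1 n2]] := floor_pi (h 0).
have hn1 : pi * n%:~R < h 0 by rewrite lt_neqAle eq_sym hn.
have hall a : pi * n%:~R < h a < pi * n%:~R + pi.
  have c1 := @nonzero_pos R (fun a => h a - pi * n%:~R) 0.
  have c2 := @nonzero_pos R (fun a => pi * n%:~R + pi - h a) 0.
  have ctn (c : R) : continuous (fun _ : R => c) by exact: cst_continuous.
  apply/andP; split.
    rewrite -subr_gt0; apply: c1 => [x|t|]; last by rewrite subr_gt0.
      by apply: cvgB; [exact: ch|exact: ctn].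
    by rewrite subr_eq0 hn.
  rewrite -subr_gt0; apply: c2 => [x|t|]; last by rewrite subr_gt0.
    by apply: cvgB; [exact: ctn|exact: ch].
  by rewrite subr_eq0 eq_sym (_ : _ + _ = pi * (n + 1)%:~R) ?hn// intrD; ring.
exists n; split.
  have /andP[h1 h2] := hall 0; have := hs 0.
  have -> : sin (h 0) = (@parity R n) * sin (h 0 - pi * n%:~R) by rewrite -sin_shift subrK.
  rewrite mulrA pmulr_lgt0//; apply: sin_gt0_pi; lra.
by move=> phi hphi; rewrite (PE _ hphi); exact: hall.
Qed.

(** M is conjugate, up to sign, to the rotation by beta. Instead of conjugating, the orbit angles a
    i are compared with i beta: r (s i) sin (a i) and sin (i beta) obey the same second order
    recurrence and both vanish at i = 0, so they are positive multiples of each other, and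
    [lockstep] bounds the difference of the angles. *)
Lemma elliptic_rotation : exists (n : int) (beta : R),
  [/\ 0 < beta < pi, T = 2 * (@parity R n * cos beta), 0 < m21 * (@parity R n) &
      tracks omega B A (n%:~R + beta / pi) (2 * pi)].
Proof.
have p0 := pi_gt0 R; have [n [mn wn]] := elliptic_winding.
have pp := @parity_sqr R n; set sg := @parity R n in mn pp *.
have T2 : -1 < sg * T / 2 < 1.
  rewrite -ltr_norml -(@ltr_sqr _ _ 1) ?nnegrE// real_normK ?num_real// expr1n.
  have -> : (sg * T / 2) ^+ 2 = (sg * sg) * T ^+ 2 / 4 by field.
  by have := T4; rewrite pp; lra.
have /andP[T2l T2r] := T2.
pose beta := acos (sg * T / 2).
have cb : cos beta = sg * T / 2 by apply: acosK; rewrite in_itv/= !ltW.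
have b1 : 0 < beta by apply: acos_gt0; rewrite (ltW T2l).
have b2 : beta < pi by apply: acos_ltpi; rewrite T2l ltW.
exists n, beta; split => //; first by rewrite b1.
  by rewrite cb -/sg; transitivity ((sg * sg) * T); [rewrite pp mul1r|field].
move=> phi j hphi.
have [r] := solution_polar omega0 hphi; set z := (cos _, sin _) => rP.
have hl := lin_is_lin k0 z B A.
pose s i : R := 2 * pi * i%:R.
have {}rP i : [/\ 0 < r (s i), linx k z B A (s i) = r (s i) * cos (phi (s i) / 2) &
    liny k z B A (s i) = r (s i) * sin (phi (s i) / 2)].
  by apply: rP; rewrite /s !mulr_ge0// ltW.
pose X i := linx k z B A (s i); pose Y i := liny k z B A (s i).
pose th i := phi (2 * pi * i%:R) / 2.
pose a i := th i - th 0%N - pi * n%:~R * i%:R.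
pose b i := i%:R * beta.
have dth i : pi * n%:~R < th i.+1 - th i < pi * n%:~R + pi.
  have [psi [hpsi e]] := solution_exists omega0 B A (phi (2 * pi * i%:R)).
  have := wn psi hpsi; rewrite (solution_orbit omega0 hphi hpsi e) e /th.
  by rewrite mulrBl.
have da i : 0 < a i.+1 - a i < pi.
  have /andP[? ?] := dth i; rewrite /a -natr1; apply/andP; split; lra.
have db i : 0 < b i.+1 - b i < pi.
  by rewrite /b -natr1; apply/andP; split; lra.
(* Up to the sign sg^i, this is the cross product of the initial direction with the i-th orbit
   point, so it is linear in that point. *)
pose c i := sin (a i) * r (s i).
have cE i : c i = sg ^+ i * (cos (th 0%N) * Y i - sin (th 0%N) * X i).
  have [r0] := rP i; rewrite /X /Y -/(th i) => -> ->.
  have -> : cos (th 0%N) * (r (s i) * sin (th i)) - sin (th 0%N) * (r (s i) * cos (th i))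
    = r (s i) * sin (th i - th 0%N) by rewrite sinB; ring.
  have -> : th i - th 0%N = a i + pi * n%:~R * i%:R by rewrite /a subrK.
  have ss m x : sin (x + pi * n%:~R * m%:R) = sg ^+ m * sin x.
    elim: m => [|m IH]; first by rewrite mulr0 addr0 expr0 mul1r.
    rewrite -natr1 mulrDr mulr1 addrA sin_shift IH exprS -/sg; ring.
  rewrite ss; have : sg ^+ i * sg ^+ i = 1 by rewrite -exprMn pp expr1n.
  rewrite /c => e; transitivity ((sg ^+ i * sg ^+ i) * (sin (a i) * r (s i))).
    by rewrite e mul1r.
  by ring.
(* Cayley-Hamilton: M^2 = T M - 1, with one factor sg for each period. *)
have cS i : c i.+2 = sg * T * c i.+1 - c i.
  have det := det_mono k0 B A.
  have [x1 y1] := is_lin_mono k0 i hl; have [x2 y2] := is_lin_mono k0 i.+1 hl.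
  rewrite -/(X i) -/(Y i) -/(X i.+1) -/(Y i.+1) in x1 y1.
  rewrite -/(X i.+1) -/(Y i.+1) -/(X i.+2) -/(Y i.+2) in x2 y2.
  rewrite !cE x2 y2 !exprS mulrA pp mul1r.
  rewrite [X in _ = X - _](_ : _ = (sg * sg) *
    (T * (sg ^+ i * (cos (th 0%N) * Y i.+1 - sin (th 0%N) * X i.+1)))); last by ring.
  rewrite pp mul1r x1 y1 /T /trmono.
  move: det; move: (mono11 k B A) (mono12 k B A) (mono21 k B A) (mono22 k B A) => p q u v det.
  have qu : q * u = p * v - 1 by rewrite -det; ring.
  apply/eqP; rewrite -subr_eq0; apply/eqP.
  transitivity (sg ^+ i * (cos (th 0%N) * Y i - sin (th 0%N) * X i) * (q * u - p * v + 1)); first by ring.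
  by rewrite qu; ring.
have c0 : c 0%N = 0 by rewrite /c /a subrr mulr0 subrr sin0 mul0r.
have b0 : b 0%N = 0 by rewrite /b mul0r.
have b1E : b 1%N = beta by rewrite /b mul1r.
have key i : c i * sin beta = c 1%N * sin (b i) /\ c i.+1 * sin beta = c 1%N * sin (b i.+1).
  elim: i => [|i [IH1 IH2]].
    by rewrite c0 b0 b1E sin0 mul0r mulr0.
  split => //; rewrite cS mulrBl IH1 -[_ * c i.+1 * _]mulrA IH2.
  have -> : sin (b i.+2) = 2 * cos beta * sin (b i.+1) - sin (b i).
    have -> : b i.+2 = b i.+1 + beta by rewrite /b -[i.+2%:R]natr1; ring.
    have -> : b i = b i.+1 - beta by rewrite /b -[i.+1%:R]natr1; ring.
    by rewrite sinD sinB; ring.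
  by rewrite cb; field.
have sb : 0 < sin beta by apply: sin_gt0_pi; rewrite b1.
have a0 : a 0%N = 0 by rewrite /a subrr mulr0 subrr.
have c1 : 0 < c 1%N.
  have [r0 _ _] := rP 1%N; rewrite /c mulr_gt0//.
  by apply: sin_gt0_pi; have := da 0%N; rewrite a0 subr0.
have := @lockstep R a b (fun i => r (s i) * sin beta) (fun=> c 1%N) a0 b0 da db _ j.
have -> : phi (2 * pi * j%:R) - phi 0 - 2 * pi * j%:R * (n%:~R + beta / pi) = 2 * (a j - b j).
  rewrite /a /b /th mulr0; move: (pi : R) (lt0r_neq0 p0) (phi _) (phi 0) => q q0 x y.
  by field.
rewrite normrM (@ger0_norm _ 2)// ler_pM2l//; apply=> i.
have [r0 _ _] := rP i; split => //; first exact: mulr_gt0.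
by rewrite -(key i).1 /c; ring.
Qed.

End elliptic_parameter.

Lemma rotation_dichotomy (B A : R) : let rho := rotation_number omega (B, A) in
  tracks omega B A rho (4 * pi) /\
  ((trmono k B A ^+ 2 < 4 /\ trmono k B A = 2 * cos (pi * rho) /\
      0 < mono21 k B A * sin (pi * rho)) \/
   (4 <= trmono k B A ^+ 2 /\ exists n : int, rho = n%:~R)).
Proof.
move=> rho; have p0 := pi_gt0 R; case: (ltP (trmono k B A ^+ 2) 4) => T4.
  have [n [beta [/andP[b1 b2] TE mn tr]]] := elliptic_rotation T4.
  have rE : rho = n%:~R + beta / pi := tracks_rho omega0 tr.
  have pr : pi * rho = beta + pi * n%:~R.
    by rewrite rE mulrDr mulrCA divff ?lt0r_neq0// mulr1 addrC.
  split.
    move=> phi j h; apply: le_trans (_ : 2 * pi <= _); last by lra.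
    by rewrite rE; exact: tr.
  left; split => //; rewrite pr cos_shift sin_shift; split => //.
  by rewrite mulrA mulr_gt0//; apply: sin_gt0_pi; rewrite b1.
have [phi [n [h hn]]] := hyperbolic_locked omega0 T4.
have tr := locked_tracks omega0 h hn.
have rE : rho = n%:~R := tracks_rho omega0 tr.
by split; [rewrite rE|right; split => //; exists n].
Qed.

End elliptic.

(** * Dependence of the rotation number on the parameters *)

Section parameters.
Context {R : realType}.
Variable omega : R.
Hypothesis omega0 : 0 < omega.
Let k := (2 * omega)^-1.
Let k0 : 0 < k := rate_gt0 omega0.
Let rho (B A : R) := rotation_number omega (B, A).

(** The mean displacement over j periods is within 2 / j of rho for all parameters at once, by
    [rotation_dichotomy]. With j fixed by e, the displacement itself depends continuously on (B,
    A). *)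
Lemma rho_near (B A e : R) : 0 < e -> exists2 d : R, 0 < d &
  forall B' A', `|B' - B| <= d -> `|A' - A| <= d -> `|rho B' A' - rho B A| <= e.
Proof.
move=> e0; have p0 := pi_gt0 R; have p2 := pi_ge2 R; have hk := k0.
pose j := (Num.bound (8 / e)).+1.
have jb : 8 / e <= j%:R.
  have := archi_boundP (_ : 0 <= 8 / e); rewrite divr_ge0 ?(ltW e0)// => /(_ isT) h.
  by apply: ltW; apply: lt_trans h _; rewrite ltr_nat.
have j1 : 1 <= j%:R :> R by rewrite ler1n.
have s0 : 0 <= 2 * pi * j%:R :> R by rewrite !mulr_ge0// ltW.
pose E := expR ((4 * k + 1) * (2 * pi * j%:R - 0)).
have E1 : 1 <= E.
  rewrite -expR0 ler_expR mulr_ge0 ?subr0//; lra.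
have E0 : 0 < E by apply: lt_le_trans E1.
exists (e / (4 * k * E)); first by rewrite divr_gt0 ?mulr_gt0.
move=> B' A' dB dA.
have [phi [h ph0]] := solution_exists omega0 B A 0.
have [psi [h' ps0]] := solution_exists omega0 B' A' 0.
have [tr _] := rotation_dichotomy omega0 B A; have {}tr := tr phi j h.
have [tr' _] := rotation_dichotomy omega0 B' A'; have {}tr' := tr' psi j h'.
have g := solution_gronwall omega0 h' h s0.
rewrite ph0 ps0 subrr expr0n add0r -/k -/E in g.
set eta := 2 * k * _ in g.
have eta0 : 0 <= eta by rewrite mulr_ge0 ?addr_ge0// mulr_ge0 ?ltW.
have etaE : eta * E <= e.
  have : eta <= 2 * k * (2 * (e / (4 * k * E))).
    by apply: ler_wpM2l; [lra|lra].
  have -> : 2 * k * (2 * (e / (4 * k * E))) = e / E.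
    by field; rewrite !lt0r_neq0.
  by rewrite ler_pdivlMr.
have gE : `|psi (2 * pi * j%:R) - phi (2 * pi * j%:R)| <= e.
  rewrite -ler_sqr ?nnegrE ?(ltW e0)// real_normK ?num_real//; apply: le_trans g _.
  apply: (@le_trans _ _ ((eta * E) ^+ 2)).
    have -> : (eta * E) ^+ 2 = eta ^+ 2 * (E * E) by ring.
    by apply: ler_wpM2l; [exact: sqr_ge0|rewrite ler_peMl// ltW].
  rewrite lerXn2r ?nnegrE//; [exact: mulr_ge0 eta0 (ltW E0)|exact: ltW].
rewrite ph0 -/(rho B A) subr0 in tr; rewrite ps0 -/(rho B' A') subr0 in tr'.
set x := psi _ in gE tr'; set y := phi _ in gE tr.
have je : 8 <= j%:R * e by rewrite -ler_pdivrMr.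
have pj : 0 < 2 * pi * j%:R :> R by apply: mulr_gt0; lra.
rewrite -(ler_pM2l pj) -[X in X * `|_|]gtr0_norm// -normrM.
have -> : 2 * pi * j%:R * (rho B' A' - rho B A) =
  - (x - 2 * pi * j%:R * rho B' A') + (x - y) + (y - 2 * pi * j%:R * rho B A) by ring.
apply: le_trans (ler_normD _ _) _.
have := ler_normD (- (x - 2 * pi * j%:R * rho B' A')) (x - y); rewrite normrN => h1.
have h2 : 8 * pi <= j%:R * e * pi by rewrite ler_pM2r.
have h3 : e <= j%:R * e * (pi - 1).
  rewrite -mulrA mulrCA ler_peMr ?(ltW e0)// -[leLHS]mulr1 ler_pM//; lra.
lra.
Qed.

(** After the drift 2 k B t and the term 2 k A sin t, zero at whole periods, are removed from phi,
    the derivative is at most 2 k = 1 / omega in absolute value. *)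
Lemma rho_bound (B A : R) : `|rho B A * omega - B| <= 1.
Proof.
have p0 := pi_gt0 R; have hk := k0.
have [phi [h _]] := solution_exists omega0 B A 0.
have [tr _] := rotation_dichotomy omega0 B A.
have dphi := (is_solutionE omega0 B A phi).1 h.
have bnd j : `|rho B A - 2 * k * B| <= 2 * k + 2 / j.+1%:R.
  set s : R := 2 * pi * j.+1%:R; have s0 : 0 < s by rewrite !mulr_gt0.
  pose f t := phi t - 2 * k * B * t - 2 * k * A * sin t.
  have df t : is_derive t (1 : R) f (- (2 * k * sin (phi t))).
    by rewrite /f; der; rewrite -/k; ring.
  have := der1_bound (a := 0) (b := s) (C := 2 * k) df _ (ltW s0).
  have ss : sin s = 0.
    by rewrite (_ : s = pi * (2 * j.+1%:Z)%:~R) ?sin_int// intrM /s; ring.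
  rewrite /f ss sin0 subr0 => /(_ _) hf.
  have {}hf : `|phi s - phi 0 - 2 * k * B * s| <= 2 * k * s.
    have -> : phi s - phi 0 - 2 * k * B * s = phi s - 2 * k * B * s - 2 * k * A * 0
        - (phi 0 - 2 * k * B * 0 - 2 * k * A * 0) by ring.
    apply: hf => t _; rewrite normrN normrM ger0_norm ?mulr_ge0 ?(ltW k0)//.
    by rewrite ler_piMr ?mulr_ge0 ?(ltW k0)// sin_max.
  have := tr phi j.+1 h; rewrite -/s -/(rho B A) => t1.
  rewrite -(ler_pM2l s0) -[X in X * `|_|](gtr0_norm s0) -normrM.
  have -> : s * (rho B A - 2 * k * B) = - (phi s - phi 0 - s * rho B A) + (phi s - phi 0 - 2 * k * B * s).
    by ring.
  apply: le_trans (ler_normD _ _) _; rewrite normrN.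
  have -> : s * (2 * k + 2 / j.+1%:R) = 2 * k * s + 4 * pi.
    by rewrite /s; field; rewrite nat1r.
  lra.
have lim : `|rho B A - 2 * k * B| <= 2 * k.
  apply/ler_addgt0Pr => e e0.
  have := archi_boundP (_ : 0 <= 2 / e); rewrite divr_ge0 ?(ltW e0)// => /(_ isT).
  set j := Num.bound _ => hj; apply: le_trans (bnd j) _; rewrite lerD2l.
  rewrite ler_pdivrMr// mulrC -ler_pdivrMr//; apply: le_trans (ltW hj) _.
  by rewrite ler_nat.
have w2 : 2 * k * omega = 1 by rewrite /k; field; exact: lt0r_neq0.
have -> : rho B A * omega - B = (rho B A - 2 * k * B) * omega.
  by transitivity (rho B A * omega - 2 * k * omega * B); [rewrite w2 mul1r|ring].
by rewrite normrM (gtr0_norm omega0); have := ler_wpM2r (ltW omega0) lim; rewrite w2.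
Qed.

(** Between consecutive multiples of pi the cosine is monotone, in the direction given by the sign
    of the sine; the product covers both parities of n. *)
Lemma cos_cmp (n : int) (a b : R) : pi * n%:~R < a < pi * n%:~R + pi ->
  pi * n%:~R < b < pi * n%:~R + pi -> sin b * (cos a - cos b) < 0 -> b < a.
Proof.
move=> /andP[a1 a2] /andP[b1 b2].
rewrite -[a](subrK (pi * n%:~R)) -[b](subrK (pi * n%:~R)).
set u := a - _; set v := b - _; rewrite !sin_shift !cos_shift -mulrBr.
rewrite mulrACA parity_sqr mul1r ltrD2r.
have u0 : 0 < u < pi by rewrite /u; apply/andP; split; lra.
have v0 : 0 < v < pi by rewrite /v; apply/andP; split; lra.
have hu : u \in `[0, pi] by rewrite in_itv /=; case/andP: u0 => ? ?; apply/andP; split; lra.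
have hv : v \in `[0, pi] by rewrite in_itv /=; case/andP: v0 => ? ?; apply/andP; split; lra.
by rewrite pmulr_rlt0 ?sin_gt0_pi// subr_lt0 ltr_cos.
Qed.

End parameters.

(** * The derivative of the trace *)

Section trace_derivative.
Context {R : realType}.
Variable k : R.
Hypothesis k0 : 0 < k.

Definition trace_sign (q r : R) : R := if r == 0 then q else - r.

(* tr (M J S) for M = (p q; r s) in SL2 with |tr M| <= 2 and S = X^T X, where
   X = (x1 x2; y1 y2) is in SL2. *)
Lemma trace_form_sign (p q r s x1 x2 y1 y2 : R) : p * s - q * r = 1 ->
  (p + s) ^+ 2 <= 4 -> (q != 0) || (r != 0) -> x1 * y2 - x2 * y1 = 1 ->
  0 < trace_sign q r * (q * (x1 ^+ 2 + y1 ^+ 2) + (s - p) * (x1 * x2 + y1 * y2)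
                        - r * (x2 ^+ 2 + y2 ^+ 2)).
Proof.
move=> det tr qr W; rewrite /trace_sign; case: (eqVneq r 0) => [r0|rn0].
  have sp : (s - p) ^+ 2 = (p + s) ^+ 2 - 4 * (p * s - q * r) by rewrite r0; ring.
  have sp0 : s - p = 0.
    by apply/eqP; rewrite -sqrf_eq0 eq_le sqr_ge0 andbT sp det; lra.
  have -> : q * (x1 ^+ 2 + y1 ^+ 2) + (s - p) * (x1 * x2 + y1 * y2) - r * (x2 ^+ 2 + y2 ^+ 2)
    = q * (x1 ^+ 2 + y1 ^+ 2).
    by rewrite sp0 r0; ring.
  rewrite mulrA pmulr_rgt0.
    rewrite lt_neqAle addr_ge0 ?sqr_ge0// andbT eq_sym paddr_eq0 ?sqr_ge0// !sqrf_eq0.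
    apply/negP => /andP[/eqP x0 /eqP y0]; move/eqP: W.
    by rewrite x0 y0 mul0r mulr0 subrr eq_sym oner_eq0.
  by rewrite -expr2 exprn_even_gt0//=; case/orP: qr => //; rewrite r0 eqxx.
(* Multiplying the form by - r completes squares. F is semidefinite since T^2 <= 4, and its zeros
   lie on one line; the two rows of X are independent, so they cannot both be zeros. *)
pose F a b := (r * b - (s - p) * a / 2) ^+ 2 + (4 - (p + s) ^+ 2) / 4 * a ^+ 2.
have FE : - r * (q * (x1 ^+ 2 + y1 ^+ 2) + (s - p) * (x1 * x2 + y1 * y2) - r * (x2 ^+ 2 + y2 ^+ 2))
   = F x1 x2 + F y1 y2.
  have qr' : r * q = p * s - 1 by rewrite -det; ring.
  rewrite /F; transitivity (- (r * q) * (x1 ^+ 2 + y1 ^+ 2)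
    - r * (s - p) * (x1 * x2 + y1 * y2) + r ^+ 2 * (x2 ^+ 2 + y2 ^+ 2)); first by ring.
  by rewrite qr'; field.
have c0 : 0 <= (4 - (p + s) ^+ 2) / 4 by lra.
have F0 a b : 0 <= F a b by rewrite addr_ge0 ?sqr_ge0// mulr_ge0// sqr_ge0.
rewrite FE lt_neqAle addr_ge0 ?F0// andbT eq_sym paddr_eq0 ?F0//.
have Fz a b : F a b = 0 -> b = (s - p) / (2 * r) * a.
  move/eqP; rewrite /F paddr_eq0 ?sqr_ge0//; last by rewrite mulr_ge0// sqr_ge0.
  rewrite sqrf_eq0 subr_eq0 => /andP[/eqP e _].
  by apply: (mulfI rn0); rewrite e; field.
apply/negP => /andP[/eqP/Fz e1 /eqP/Fz e2]; move/eqP: W.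
rewrite e1 e2 (_ : _ - _ = 0); last by ring.
by rewrite eq_sym oner_eq0.
Qed.

Section at_parameters.
Variables (B A : R).
Let x1 u := linx k (1, 0) (B + u) A.
Let y1 u := liny k (1, 0) (B + u) A.
Let x2 u := linx k (0, 1) (B + u) A.
Let y2 u := liny k (0, 1) (B + u) A.

Let p := mono11 k B A.
Let q := mono12 k B A.
Let r := mono21 k B A.
Let s := mono22 k B A.

(** With X_u the fundamental matrix at B + u and J the rotation by a right angle, this is tr (M
    X_0^{-1} J X_u). At u = 0 it is tr (M J X_0^T X_0), because det X_0 = 1. *)
Let L u t := - (p * y2 0 t - q * y1 0 t) * y1 u t + (q * x1 0 t - p * x2 0 t) * x1 u t
  - (r * y2 0 t - s * y1 0 t) * y2 u t + (s * x1 0 t - r * x2 0 t) * x2 u t.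

(** For fixed t, L is a combination of functions of u in the coefficient algebra with bounds common
    to all t in the period, so [isA_lip] is uniform in t. *)
Lemma trace_der_perturb : exists2 C : R, 0 < C &
  forall u t, `|u| <= 1 -> 0 <= t <= 2 * pi -> `|L u t - L 0 t| <= C * `|u|.
Proof.
have p2 : 0 <= 2 * pi :> R by rewrite mulr_ge0// pi_ge0.
have [K1 h1] := lin_psum_isA (1, 0) k0 B A p2; have [K2 h2] := lin_psum_isA (0, 1) k0 B A p2.
pose N := `|p| + `|q| + `|r| + `|s|; pose K := Num.max K1 K2.
have K1K : K1 <= K by rewrite le_max lexx.
have K2K : K2 <= K by rewrite le_max lexx orbT.
have hK t : `|t| <= 2 * pi ->
    [/\ isA K (fun u v => linx k (1, 0) (B + u) (A + v) t),
        isA K (fun u v => liny k (1, 0) (B + u) (A + v) t),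
        isA K (fun u v => linx k (0, 1) (B + u) (A + v) t) &
        isA K (fun u v => liny k (0, 1) (B + u) (A + v) t)].
  move=> tt; have [a1 b1] := h1 t tt; have [a2 b2] := h2 t tt.
  by split; [exact: isA_le a1|exact: isA_le b1|exact: isA_le a2|exact: isA_le b2].
have K0 : 0 <= K.
  by have [h _ _ _] := hK 0 (eq_ind_r (fun z => z <= _) p2 (normr0 R)); exact: isA_ge0 h.
have N0 : 0 <= N by rewrite !addr_ge0.
exists (2 * (4 * (N * K) * K) + 1); first by rewrite ltr_wpDl// !mulr_ge0.
move=> u t u1 /andP[t0 t2].
have [X1 Y1 X2 Y2] := hK t (eq_ind_r (fun z => z <= _) t2 (ger0_norm t0)).
have z1 : `|(0 : R)| <= 1 by rewrite normr0.
have coef (a b x y : R) : `|x| <= K -> `|y| <= K -> `|a| + `|b| <= N ->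
    `|a * x - b * y| * K <= N * K * K.
  move=> xK yK abN; apply: ler_wpM2r => //; apply: le_trans (ler_normB _ _) _.
  rewrite !normrM; apply: (@le_trans _ _ (`|a| * K + `|b| * K)).
    by rewrite lerD// ler_wpM2l.
  by rewrite -mulrDl ler_wpM2r.
have b1 := isA_norm X1 z1 z1; have b2 := isA_norm Y1 z1 z1.
have b3 := isA_norm X2 z1 z1; have b4 := isA_norm Y2 z1 z1.
rewrite /= (addr0 A) in b1 b2 b3 b4.
have n1 : `|p| + `|q| <= N by rewrite /N -addrA lerDl addr_ge0.
have n2 : `|q| + `|p| <= N by rewrite addrC.
have n3 : `|r| + `|s| <= N by rewrite /N -[leRHS]addrA lerDr addr_ge0.
have n4 : `|s| + `|r| <= N by rewrite addrC.
have := isA_lip (isA_add (isA_sub (isA_sub (isA_scale (q * x1 0 t - p * x2 0 t) X1)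
  (isA_scale (p * y2 0 t - q * y1 0 t) Y1)) (isA_scale (r * y2 0 t - s * y1 0 t) Y2))
  (isA_scale (s * x1 0 t - r * x2 0 t) X2)) u1.
rewrite !(addr0 A) => H.
apply: le_trans (_ : 2 * (4 * (N * K) * K) * `|u| <= _); last first.
  by rewrite ler_wpM2r// lerDl.
apply: le_trans (ler_wpM2r (normr_ge0 u) (_ : _ <= _)).
  by move: H; congr (is_true (`|_| <= _ * _)); rewrite /L /x1 /y1 /x2 /y2; ring.
have := coef _ _ _ _ b1 b3 n2; have := coef _ _ _ _ b4 b2 n1.
have := coef _ _ _ _ b4 b2 n3; have := coef _ _ _ _ b1 b3 n4.
by rewrite /x1 /y1 /x2 /y2; lra.
Qed.

(** The sign of dT/dB is stated as an increment bound valid for u of either sign. The integrand at u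
    = 0 has a minimum m > 0 over the period, and |u| <= e costs at most half of it; integrating k m
    / 2 over 2 pi gives c. *)
Lemma trace_derivative : trmono k B A ^+ 2 <= 4 ->
  (mono12 k B A != 0) || (mono21 k B A != 0) ->
  exists c e : R, [/\ 0 < c, 0 < e & forall u, `|u| <= e -> c * u ^+ 2 <=
    trace_sign (mono12 k B A) (mono21 k B A) * u * (trmono k (B + u) A - trmono k B A)].
Proof.
move=> tr qr; set sg := trace_sign _ _; have hk := k0; have p0 := pi_gt0 R.
have det := det_mono k0 B A.
have l1 u : is_lin k (B + u) A (x1 u) (y1 u) := lin_is_lin k0 _ _ _.
have l2 u : is_lin k (B + u) A (x2 u) (y2 u) := lin_is_lin k0 _ _ _.
have W t : x1 0 t * y2 0 t - x2 0 t * y1 0 t = 1.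
  have := is_lin_wronskian (l1 0) (l2 0) t 0.
  by rewrite /x1 /x2 /y1 /y2 !linx0 !liny0 /= mulr1 mulr0 subr0.
have Lpos t : 0 < sg * L 0 t.
  have := trace_form_sign det tr qr (W t); rewrite -/sg.
  by congr (is_true (0 < _ * _)); rewrite /L -/p -/q -/r -/s; ring.
have cL u : continuous (L u).
  have dL t : exists d : R, is_derive t (1 : R) (L u) d.
    have [? ?] := l1 u t; have [? ?] := l2 u t; have [? ?] := l1 0 t; have [? ?] := l2 0 t.
    by eexists; rewrite /L; repeat der1_step.
  by move=> t; have [d hd] := dL t; apply: differentiable_continuous; apply/derivable1_diffP; case: hd.
have [tm _ tmin] : exists2 c, c \in `[0, 2 * pi]%R & forall t, t \in `[0, 2 * pi]%R -> sg * L 0 c <= sg * L 0 t.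
  apply: (@EVT_min _ (fun t => sg * L 0 t)); first by rewrite mulr_ge0// pi_ge0.
  by apply: continuous_subspaceT => t; apply: cvgMr; exact: cL.
set m := sg * L 0 tm in tmin; have m0 : 0 < m := Lpos tm.
have [C C0 LC] := trace_der_perturb.
have sg0 : 0 <= `|sg| := normr_ge0 _.
pose e := m / (2 * (C * (`|sg| + 1))).
have sg1 : 0 < `|sg| + 1 by lra.
have e0 : 0 < e by rewrite divr_gt0// !mulr_gt0.
exists (k * m * pi), (Num.min 1 e); split.
- exact: mulr_gt0 (mulr_gt0 hk m0) p0.
- by rewrite lt_min ltr01.
move=> u; rewrite le_min => /andP[u1 ue].
(* tr (M X_0^{-1} X_u): it equals T(B) at time 0, and T(B + u) at time 2 pi, where X_0 = M. *)
pose G t := (p * y2 0 t - q * y1 0 t) * x1 u t + (q * x1 0 t - p * x2 0 t) * y1 u t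
  + (r * y2 0 t - s * y1 0 t) * x2 u t + (s * x1 0 t - r * x2 0 t) * y2 u t.
have dG t : is_derive t (1 : R) G (u * k * L u t).
  have [? ?] := l1 u t; have [? ?] := l2 u t; have [? ?] := l1 0 t; have [? ?] := l2 0 t.
  by rewrite /G /L; der; ring.
have Gle : k * m / 2 * u ^+ 2 * (2 * pi) - k * m / 2 * u ^+ 2 * 0
    <= sg * u * G (2 * pi) - sg * u * G 0.
  have d1 t : is_derive t (1 : R) (fun t => k * m / 2 * u ^+ 2 * t) (k * m / 2 * u ^+ 2).
    by der; ring.
  have d2 t : is_derive t (1 : R) (fun t => sg * u * G t) (sg * u * (u * k * L u t)).
    by der; ring.
  apply: (der1_cmp d1 d2).
  - move=> t t02; have h1 := LC u t u1 t02.
    have h2 : m <= sg * L 0 t by apply: tmin; rewrite in_itv.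
    have h3 : `|sg * (L u t - L 0 t)| <= m / 2.
      rewrite normrM; apply: (@le_trans _ _ (`|sg| * (C * e))).
        by rewrite ler_wpM2l//; apply: le_trans h1 _; rewrite ler_wpM2l// ltW.
      apply: (@le_trans _ _ ((`|sg| + 1) * (C * e))).
        by apply: ler_wpM2r; [exact: mulr_ge0 (ltW C0) (ltW e0)|rewrite lerDl].
      rewrite le_eqVlt; apply/orP; left; apply/eqP; rewrite /e; field.
      by rewrite !lt0r_neq0.
    have h4 : m / 2 <= sg * L u t.
      by move: h3; rewrite ler_norml => /andP[h3 _]; lra.
    have h5 := ler_wpM2l (mulr_ge0 (ltW hk) (sqr_ge0 u)) h4; lra.
  - by rewrite mulr_ge0// ltW.
have G0 : G 0 = trmono k B A.
  by rewrite /G /x1 /x2 /y1 /y2 !linx0 !liny0 /trmono /= -/p -/s; ring.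
have G2 : G (2 * pi) = trmono k (B + u) A.
  rewrite /G /x1 /x2 /y1 /y2 addr0 /trmono /mono11 /mono22.
  rewrite -/(mono11 k B A) -/(mono12 k B A) -/(mono21 k B A) -/(mono22 k B A) -/p -/q -/r -/s.
  have d1 : p * s - q * r = 1 := det.
  transitivity ((p * s - q * r) * linx k (1, 0) (B + u) A (2 * pi) + (p * s - q * r) * liny k (0, 1) (B + u) A (2 * pi)).
    by ring.
  by rewrite d1 !mul1r.
rewrite G0 G2 in Gle; lra.
Qed.

End at_parameters.
End trace_derivative.

(** * Bessel functions *)

Lemma der1_le_on (R : realType) (f f' : R -> R) (a b : R) :
  (forall t, a <= t <= b -> is_derive t (1 : R) f (f' t)) ->
  (forall t, a <= t <= b -> 0 <= f' t) -> a <= b -> f a <= f b.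
Proof.
move=> df f0 ab.
have [||c cab] := @MVT_segment R f f' a b ab.
- by move=> t; rewrite in_itv /= => /andP[h1 h2]; apply: df; rewrite (ltW h1) (ltW h2).
- apply: derivable_within_continuous => t; rewrite in_itv /= => tab.
  by have [] := df t tab.
by rewrite -subr_ge0 => ->; rewrite mulr_ge0 ?subr_ge0// f0.
Qed.

Lemma quadratic_is_derive (R : realType) (f : R -> R) (x d C : R) :
  (forall h, `|f (x + h) - f x - h * d| <= C * h ^+ 2) -> is_derive x (1 : R) f d.
Proof.
move=> fC; have C0 : 0 <= C by have := fC 1; rewrite expr1n mulr1; apply: le_trans.
have h : (h^-1 *: (f (h *: 1 + x) - f x) @[h --> 0^'] --> d)%classic.
  apply/cvgrPdist_le => e e0; near=> h.
  have h0 : h != 0 by near: h; exact: nbhs_dnbhs_neq.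
  have he : `|h| <= e / (C + 1).
    near: h; apply: dnbhs0_le; rewrite divr_gt0//; lra.
  rewrite /GRing.scale /= mulr1 [h + x]addrC.
  have -> : d - h^-1 * (f (x + h) - f x) = - (h^-1 * (f (x + h) - f x - h * d)).
    by field.
  rewrite normrN normrM normfV mulrC ler_pdivrMr ?normr_gt0//.
  apply: le_trans (fC h) _; rewrite -real_normK ?num_real// expr2 mulrA ler_wpM2r//.
  move: he; rewrite ler_pdivlMr; last by lra.
  by have := normr_ge0 h; nra.
apply: DeriveDef; first by apply/cvg_ex; exists d.
exact: cvg_lim h.
Unshelve. all: by end_near. Qed.

Lemma cos_taylor (R : realType) (a d : R) :
  `|cos (a + d) - cos a + d * sin a| <= d ^+ 2.
Proof.
pose g s := cos (a + s) - cos a + s * sin a.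
have dg s : is_derive s (1 : R) g (sin a - sin (a + s)) by rewrite /g; der; ring.
have gs s : `|sin a - sin (a + s)| <= `|s|.
  by apply: le_trans (sin_lip _ _) _; rewrite opprD addNKr normrN.
have g0 : g 0 = 0 by rewrite /g addr0 subrr mul0r addr0.
rewrite -/(g d); case: (leP 0 d) => d0.
  have := der1_bound (C := `|d|) dg _ d0; rewrite g0 !subr0 => h.
  apply: le_trans (h _) _; last by rewrite ger0_norm.
  move=> t /andP[t0 td]; apply: le_trans (gs t) _.
  by rewrite !ger0_norm.
have := der1_bound (C := `|d|) dg _ (ltW d0); rewrite g0 !sub0r normrN => h.
apply: le_trans (h _) _; last by rewrite ltr0_norm// mulrNN.
move=> t /andP[t0 td]; apply: le_trans (gs t) _.
by rewrite !ler0_norm ?(ltW d0)// lerN2.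
Qed.

(** Plays the role of the integral from 0; the zero function is only the default of [xget] when no
    antiderivative exists. *)
Definition prim (R : realType) (f : R -> R) : R -> R :=
  xget (fun=> 0) [set F | F 0 = 0 /\ forall t, is_derive t (1 : R) F (f t)].

Lemma primP (R : realType) (f : R -> R) : continuous f ->
  prim f 0 = 0 /\ forall t, is_derive t (1 : R) (prim f) (f t).
Proof.
move=> /antiderivative[F FP].
exact: (@xgetPex _ (fun=> 0) [set F | F 0 = 0 /\ forall t, is_derive t (1 : R) F (f t)]
  (ex_intro _ F FP)).
Qed.

Section bessel.
Context {R : realType}.
Implicit Types (n : int) (x t : R).

Definition angle n x t : R := n%:~R * t + x * sin t.

(* 2 pi times the Bessel function J_n at -x. *)
Definition bes n x : R := prim (fun t => cos (angle n x t)) (2 * pi).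

Lemma angle_der n x t : is_derive t (1 : R) (angle n x) (n%:~R + x * cos t).
Proof. by rewrite /angle; der; ring. Qed.

Lemma continuous_cos_angle n x : continuous (fun t => cos (angle n x t)).
Proof.
have d t := angle_der n x t.
by apply: (@der1_continuous _ _ (fun t => - sin (angle n x t) * (n%:~R + x * cos t))) => t; der.
Qed.

Lemma continuous_sin_angle n x : continuous (fun t => sin (angle n x t)).
Proof.
have d t := angle_der n x t.
by apply: (@der1_continuous _ _ (fun t => cos (angle n x t) * (n%:~R + x * cos t))) => t; der.
Qed.

Lemma prim_cos_der n x t :
  is_derive t (1 : R) (prim (fun t => cos (angle n x t))) (cos (angle n x t)).
Proof. by have [_] := primP (@continuous_cos_angle n x). Qed.

Lemma prim_cos0 n x : prim (fun t => cos (angle n x t)) 0 = 0.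
Proof. by have [] := primP (@continuous_cos_angle n x). Qed.

Lemma bes_le n x : `|bes n x| <= 2 * pi.
Proof.
have p2 : 0 <= 2 * pi :> R by rewrite mulr_ge0// pi_ge0.
have := der1_bound (C := 1) (prim_cos_der n x) _ p2.
rewrite prim_cos0 !subr0 mul1r; apply=> t _; exact: cos_max.
Qed.

Lemma angleS n x t : angle (n + 1) x t = angle n x t + t.
Proof. by rewrite /angle intrD; ring. Qed.

Lemma angleP n x t : angle (n - 1) x t = angle n x t - t.
Proof. by rewrite /angle intrD mulrNz; ring. Qed.

(** Differentiation under the integral: the defect of the difference quotient is followed as a
    function of the upper limit t, and its t-derivative is a Taylor remainder of the cosine, at most
    h^2. *)
Lemma bes_der n x : is_derive x (1 : R) (bes n) ((bes (n + 1) x - bes (n - 1) x) / 2).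
Proof.
apply: (@quadratic_is_derive _ _ _ _ (2 * pi)) => h.
pose G t := prim (fun t => cos (angle n (x + h) t)) t - prim (fun t => cos (angle n x t)) t
  - h * ((prim (fun t => cos (angle (n + 1) x t)) t - prim (fun t => cos (angle (n - 1) x t)) t) / 2).
pose G' t := cos (angle n x t + h * sin t) - cos (angle n x t) + h * sin t * sin (angle n x t).
have dG t : is_derive t (1 : R) G (G' t).
  have d1 := prim_cos_der n (x + h) t; have d2 := prim_cos_der n x t.
  have d3 := prim_cos_der (n + 1) x t; have d4 := prim_cos_der (n - 1) x t.
  rewrite /G; der; rewrite angleS angleP cosD cosB /G'.
  have -> : angle n (x + h) t = angle n x t + h * sin t by rewrite /angle; ring.
  by field.
have G0 : G 0 = 0 by rewrite /G !prim_cos0; ring.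
have p2 : 0 <= 2 * pi :> R by rewrite mulr_ge0// pi_ge0.
have := der1_bound (C := h ^+ 2) dG _ p2; rewrite G0 !subr0 [h ^+ 2 * _]mulrC; apply.
move=> t _; apply: le_trans (cos_taylor _ _) _.
by rewrite exprMn ler_piMr ?sqr_ge0// -real_normK ?num_real// exprn_ile1// sin_max.
Qed.

(** The cosines of [angle] at n + 1 and n - 1 add up to 2 cos t cos (angle), so the combination
    integrates the derivative of 2 sin (angle), which vanishes at both ends. *)
Lemma bes_rec n x : x * (bes (n + 1) x + bes (n - 1) x) = - (2 * n%:~R * bes n x).
Proof.
pose G t := x * (prim (fun t => cos (angle (n + 1) x t)) t + prim (fun t => cos (angle (n - 1) x t)) t)
  + 2 * n%:~R * prim (fun t => cos (angle n x t)) t - 2 * sin (angle n x t).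
have dG t : is_derive t (1 : R) G 0.
  have d1 := angle_der n x t; have d2 := prim_cos_der n x t.
  have d3 := prim_cos_der (n + 1) x t; have d4 := prim_cos_der (n - 1) x t.
  by rewrite /G; der; rewrite angleS angleP cosD cosB; ring.
have e2 : angle n x (2 * pi) = pi * (2 * n)%:~R.
  rewrite /angle (_ : 2 * pi = pi * 2%:Z%:~R); last by ring.
  by rewrite sin_int mulr0 addr0 intrM; ring.
have G0 : G 0 = 0.
  by rewrite /G !prim_cos0 /angle sin0 !mulr0 !addr0 sin0; ring.
have G2 : G (2 * pi) = x * (bes (n + 1) x + bes (n - 1) x) + 2 * n%:~R * bes n x.
  by rewrite /G e2 sin_int mulr0 subr0.
have := der1_zero dG (2 * pi) 0; rewrite G0 G2 => /eqP; by rewrite addr_eq0 => /eqP.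
Qed.

Lemma bes00 : bes 0 0 = 2 * pi.
Proof.
pose G t := prim (fun t => cos (angle 0 0 t)) t - t.
have dG t : is_derive t (1 : R) G 0.
  have d := prim_cos_der 0 0 t.
  by rewrite /G; der; rewrite /angle !mul0r addr0 cos0 subrr.
have := der1_zero dG (2 * pi) 0; rewrite /G prim_cos0 subrr => /eqP.
by rewrite subr_eq0 => /eqP.
Qed.

Lemma bes_all_zero n x : 0 < x -> bes n x = 0 -> bes (n + 1) x = 0 -> bes 0 x = 0 /\ bes 1 x = 0.
Proof.
move=> x0; have xn : x != 0 by rewrite lt0r_neq0.
have up m : bes m x = 0 -> bes (m + 1) x = 0 -> bes (m + 1 + 1) x = 0.
  move=> e1 e2; have := bes_rec (m + 1) x; rewrite addrK e1 e2 mulr0 oppr0 addr0 => /eqP.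
  by rewrite mulf_eq0 (negPf xn) => /eqP.
have down m : bes m x = 0 -> bes (m + 1) x = 0 -> bes (m - 1) x = 0.
  move=> e1 e2; have := bes_rec m x; rewrite e1 e2 mulr0 oppr0 add0r => /eqP.
  by rewrite mulf_eq0 (negPf xn) => /eqP.
have upj (j : nat) m : bes m x = 0 -> bes (m + 1) x = 0 -> bes (m + j%:Z) x = 0 /\ bes (m + j%:Z + 1) x = 0.
  move=> e1 e2; elim: j => [|j [h1 h2]]; first by rewrite addr0.
  by rewrite -[j.+1]addn1 PoszD addrA; split => //; exact: up.
have downj (j : nat) m : bes m x = 0 -> bes (m + 1) x = 0 -> bes (m - j%:Z) x = 0 /\ bes (m - j%:Z + 1) x = 0.
  move=> e1 e2; elim: j => [|j [h1 h2]]; first by rewrite subr0.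
  by rewrite -[j.+1]addn1 PoszD opprD addrA subrK; split => //; exact: down.
case: n => j e1 e2.
  by have := downj j _ e1 e2; rewrite subrr add0r.
by have := upj j.+1 _ e1 e2; rewrite NegzE addNr add0r.
Qed.

(** Two consecutive zeros at x spread by the recurrence to the indices 0 and 1. Then D(t) = t^2
    (J_0^2 + J_1^2), up to a constant, is nondecreasing and vanishes at 0 and x, so [bes 0] vanishes
    at some t <= 1 / 2. But it starts at 2 pi with slope at most 2 pi. *)
Lemma bes_nonzero n x : 0 < x -> 0 < bes n x ^+ 2 + bes (n + 1) x ^+ 2.
Proof.
move=> x0; rewrite lt_neqAle addr_ge0 ?sqr_ge0// andbT eq_sym paddr_eq0 ?sqr_ge0//.
rewrite !sqrf_eq0; apply/negP => /andP[/eqP e1 /eqP e2].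
have [b0 b1] := bes_all_zero x0 e1 e2.
pose D t := t ^+ 2 * (bes 0 t ^+ 2 + bes 1 t ^+ 2).
pose D' t := 2 * t * (bes 0 t ^+ 2 + bes 1 t ^+ 2) + t ^+ 2 *
   (bes 0 t * (bes (0 + 1) t - bes (0 - 1) t) + bes 1 t * (bes (1 + 1) t - bes (1 - 1) t)).
have dD t : is_derive t (1 : R) D (D' t).
  have d0 := bes_der 0 t; have d1 := bes_der 1 t.
  by rewrite /D /D'; der; rewrite expr1; field.
have D'E t : D' t = 2 * t * bes 0 t ^+ 2.
  have r0 := bes_rec 0 t; have r1 := bes_rec 1 t.
  rewrite add0r sub0r mulr0 mul0r oppr0 in r0; rewrite subrr in r1.
  rewrite /D' add0r sub0r subrr.
  have h0 : t * bes (-1) t = - (t * bes 1 t) by apply/eqP; rewrite -addr_eq0 addrC -mulrDr r0.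
  have h1 : t * bes (1 + 1) t = - 2 * bes 1 t - t * bes 0 t by move: r1; lra.
  transitivity (2 * t * (bes 0 t ^+ 2 + bes 1 t ^+ 2) + t * (bes 0 t * (t * bes 1 t - t * bes (-1) t) + bes 1 t * (t * bes (1 + 1) t - t * bes 0 t))).
    by ring.
  by rewrite h0 h1; ring.
have Dmono a b : 0 <= a -> a <= b -> D a <= D b.
  move=> a0 ab; apply: (der1_le dD) => // t /andP[at_ _].
  by rewrite D'E mulr_ge0 ?sqr_ge0// mulr_ge0// (le_trans a0).
have D0 : D 0 = 0 by rewrite /D expr0n mul0r.
have Dx : D x = 0 by rewrite /D b0 b1 expr0n addr0 mulr0.
pose t := Num.min x (1 / 2).
have t0 : 0 < t by rewrite lt_min x0; lra.
have tx : t <= x by rewrite ge_min lexx.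
have th : t <= 1 / 2 by rewrite ge_min lexx orbT.
have Dt : D t = 0.
  have h1 := Dmono t x (ltW t0) tx; have h2 := Dmono 0 t (lexx 0) (ltW t0).
  by rewrite Dx in h1; rewrite D0 in h2; apply/eqP; rewrite eq_le h1 h2.
have bt : bes 0 t = 0.
  move/eqP: Dt; rewrite /D mulf_eq0 sqrf_eq0 (gt_eqF t0)/= paddr_eq0 ?sqr_ge0// sqrf_eq0.
  by case/andP => /eqP.
have p0 := pi_gt0 R.
have hb s : `|(bes (0 + 1) s - bes (0 - 1) s) / 2| <= 2 * pi.
  rewrite normrM (@ger0_norm _ 2^-1) ?invr_ge0//.
  have := bes_le (0 + 1) s; have := bes_le (0 - 1) s.
  have := ler_normB (bes (0 + 1) s) (bes (0 - 1) s); lra.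
have := der1_bound (bes_der 0) (fun s _ => hb s) (ltW t0).
rewrite bt bes00 subr0 sub0r normrN gtr0_norm ?mulr_gt0//; nra.
Qed.

(** For a = [bes n] and b = [bes (n + 1)], x (a^2 + b^2) stays away from 0. If a were O(1 / x), then
    b^2 would be of order 1 / x and (a b)' close to b^2, so a b would grow by a fixed amount on
    [X, 2 X]; yet a b would be O(1 / X). *)
Lemma bes_not_small n (C x0 : R) :
  ~ (forall x, x0 <= x -> `|bes n x| * x <= C).
Proof.
move=> small.
pose m : R := 2 * n%:~R + 1; pose c := `|m|.
have c0 : 0 <= c := normr_ge0 _.
pose x1 := 1 + `|x0| + 4 * c.
have x10 : 0 < x1 by rewrite /x1; have := normr_ge0 x0; lra.
have C0 : 0 <= C.
  by apply: le_trans (small x1 _); [rewrite mulr_ge0// ltW|rewrite /x1; have := ler_norm x0; lra].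
pose a := bes n; pose b := bes (n + 1).
(* The cross term with m = 2 n + 1 cancels the term m (a^2 - b^2) in the derivative of x (a^2 +
   b^2), leaving only - m a b / x. *)
pose Q x := x * (a x ^+ 2 + b x ^+ 2) + m * (a x * b x).
pose a' x := (bes (n + 1) x - bes (n - 1) x) / 2.
pose b' x := (bes (n + 1 + 1) x - bes (n + 1 - 1) x) / 2.
have da x : is_derive x (1 : R) a (a' x) := bes_der n x.
have db x : is_derive x (1 : R) b (b' x) := bes_der (n + 1) x.
have a'E x : 0 < x -> a' x = b x + n%:~R / x * a x.
  move=> xp; have xn := lt0r_neq0 xp; apply: (mulfI xn).
  have := bes_rec n x; rewrite -/(a x) -/(b x) => h.
  have h2 : x * bes (n - 1) x = - (2 * n%:~R * a x) - x * b x by move: h; lra.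
  transitivity ((x * b x - x * bes (n - 1) x) / 2); first by rewrite /a' -/(b x); ring.
  by rewrite h2; field.
have b'E x : 0 < x -> b' x = - a x - (n%:~R + 1) / x * b x.
  move=> xp; have xn := lt0r_neq0 xp; apply: (mulfI xn).
  have := bes_rec (n + 1) x; rewrite addrK -/(a x) -/(b x) intrD => h.
  have h2 : x * bes (n + 1 + 1) x = - (2 * (n%:~R + 1) * b x) - x * a x by move: h; lra.
  transitivity ((x * bes (n + 1 + 1) x - x * a x) / 2); first by rewrite /b' addrK -/(a x); ring.
  by rewrite h2; field.
pose Q' x := (a x ^+ 2 + b x ^+ 2) + x * (2 * a x * a' x + 2 * b x * b' x)
   + m * (a' x * b x + a x * b' x).
have dQ x : is_derive x (1 : R) Q (Q' x) by rewrite /Q /Q'; der; ring.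
have Q'E x : 0 < x -> Q' x = - m * (a x * b x) / x.
  move=> xp; rewrite /Q' a'E// b'E// /m; field; exact: lt0r_neq0.
have ab x : 2 * `|a x * b x| <= a x ^+ 2 + b x ^+ 2.
  rewrite -[a x ^+ 2]real_normK ?num_real// -[b x ^+ 2]real_normK ?num_real// normrM.
  by have := sqr_ge0 (`|a x| - `|b x|); lra.
have Qpos x : x1 <= x -> x * (a x ^+ 2 + b x ^+ 2) <= 2 * Q x.
  move=> xx; have h : `|m * (a x * b x)| <= x * (a x ^+ 2 + b x ^+ 2) / 2.
    rewrite normrM -/c; have h1 := ler_wpM2l c0 (ab x).
    have cx : c <= x by apply: le_trans xx; rewrite /x1; have := normr_ge0 x0; lra.
    have S0 : 0 <= a x ^+ 2 + b x ^+ 2 by rewrite addr_ge0 ?sqr_ge0.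
    have := ler_wpM2r S0 cx; lra.
  by move: h; rewrite ler_norml /Q => /andP[h _]; lra.
(* |Q'| <= c Q / x^2 for x >= x1, and the exponential factor compensates exactly this rate, so E is
   nondecreasing and Q has a positive lower bound. *)
pose E x := Q x * expR (- (c / x)).
have dE x : x1 <= x -> is_derive x (1 : R) E ((Q' x + c * Q x / x ^+ 2) * expR (- (c / x))).
  move=> xx; have xn : x != 0 by rewrite lt0r_neq0// (lt_le_trans x10).
  by rewrite /E; have d := dQ x; eapply der1_eq; [repeat (der1_step || exact: xn)|field].
have Emono x : x1 <= x -> E x1 <= E x.
  move=> xx.
  have dd t : x1 <= t <= x -> is_derive t (1 : R) E ((Q' t + c * Q t / t ^+ 2) * expR (- (c / t))).
    by move=> /andP[t1 _]; exact: dE t1.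
  apply: (der1_le_on dd) xx => t /andP[t1 _].
  apply: mulr_ge0; last exact: expR_ge0.
  have tp : 0 < t by apply: lt_le_trans t1.
  rewrite Q'E//; have := Qpos t t1; have := ab t.
  set S := _ + _ => h1 h2.
  have -> : - m * (a t * b t) / t + c * Q t / t ^+ 2 = (c * Q t - t * (m * (a t * b t))) / t ^+ 2.
    by field; exact: lt0r_neq0.
  rewrite divr_ge0 ?sqr_ge0// subr_ge0.
  have h3 : m * (a t * b t) <= c * `|a t * b t| by rewrite -normrM; exact: ler_norm.
  have h4 := ler_wpM2l (ltW tp) h3; have h5 := ler_wpM2l c0 h2.
  have h6 := ler_wpM2l (mulr_ge0 c0 (ltW tp)) h1; lra.
pose q := E x1.
have q0 : 0 < q.
  rewrite mulr_gt0 ?expR_gt0//.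
  have := Qpos x1 (lexx _); have := mulr_gt0 x10 (bes_nonzero n x10); rewrite -/(a x1) -/(b x1).
  lra.
have Qq x : x1 <= x -> q <= Q x.
  move=> xx; apply: le_trans (Emono x xx) _; rewrite /E.
  have h := Qpos x xx; have xp : 0 < x by apply: lt_le_trans xx.
  have Q0 : 0 <= Q x.
    have : 0 <= x * (a x ^+ 2 + b x ^+ 2) by rewrite mulr_ge0 ?addr_ge0 ?sqr_ge0// ltW.
    lra.
  by rewrite ler_piMr// -expR0 ler_expR oppr_le0 divr_ge0// ltW.
have p0 := pi_gt0 R; have p2 := pi_ge2 R.
have bb x : `|b x| <= 2 * pi := bes_le _ _.
pose N := C ^+ 2 + c * (2 * pi * C) + 2 * pi * C.
have N0 : 0 <= N by rewrite !addr_ge0 ?sqr_ge0 ?mulr_ge0// ltW.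
pose X := x1 + 8 * N / q + 1 + 32 * (2 * pi * C) / q.
have piC : 0 <= 2 * pi * C by rewrite !mulr_ge0// ltW.
have u1 : 0 <= 8 * N / q by apply: divr_ge0; [exact: mulr_ge0|exact: ltW].
have u2 : 0 <= 32 * (2 * pi * C) / q by apply: divr_ge0; [exact: mulr_ge0|exact: ltW].
have Xx1 : x1 <= X by rewrite /X; move: u1 u2; clear; lra.
have XN : 8 * N <= X * q.
  by rewrite -ler_pdivrMr// /X; move: u2 (ltW x10); clear; lra.
have XC : 32 * (2 * pi * C) < X * q.
  by rewrite -ltr_pdivrMr// /X; move: u1 (ltW x10); clear; lra.
have X0 : 0 < X by apply: lt_le_trans Xx1.
have sm x : X <= x -> `|a x| * x <= C /\ `|a x * b x| * x <= 2 * pi * C.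
  move=> xx; have h : `|a x| * x <= C.
    apply: small; apply: le_trans xx; apply: le_trans Xx1.
    by rewrite /x1; have := ler_norm x0; lra.
  split => //; rewrite normrM mulrAC mulrC ler_pM// mulr_ge0//.
  by apply: ltW; apply: lt_le_trans xx.
(* P increases by at least q / 8 on [X, 2 X], whereas |P| < q / 32 at both ends. *)
pose P x := a x * b x.
pose P' x := a' x * b x + a x * b' x.
have dP x : is_derive x (1 : R) P (P' x) by rewrite /P /P'; der.
have P'ge x : X <= x <= 2 * X -> q / (8 * X) <= P' x.
  move=> /andP[xX x2X]; have xp : 0 < x by apply: lt_le_trans xX.
  have [s1 s2] := sm x xX.
  have -> : P' x = (x * b x ^+ 2 - x * a x ^+ 2 - a x * b x) / x.
    by rewrite /P' a'E// b'E//; field; exact: lt0r_neq0.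
  have e1 : x * (x * a x ^+ 2) <= C ^+ 2.
    have -> : x * (x * a x ^+ 2) = (`|a x| * x) ^+ 2 by rewrite exprMn real_normK ?num_real//; ring.
    by rewrite lerXn2r// nnegrE// mulr_ge0// ltW.
  have e2 : x * (m * (a x * b x)) <= c * (2 * pi * C).
    apply: le_trans (ler_norm _) _; rewrite normrM (gtr0_norm xp) normrM -/c mulrCA.
    by rewrite ler_wpM2l// mulrC.
  have e3 : x * (a x * b x) <= 2 * pi * C.
    apply: le_trans (ler_norm _) _; rewrite normrM (gtr0_norm xp); by rewrite mulrC.
  have qx : x * q <= x * Q x by rewrite ler_pM2l// Qq// (le_trans Xx1).
  have xq : X * q <= x * q by rewrite ler_pM2r.
  have e4 : 4 * N <= x * q by move: XN xq N0; clear; lra.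
  have e5 : x * q / 2 <= x * (x * b x ^+ 2 - x * a x ^+ 2 - a x * b x).
    have QE : x * Q x = x * (x * b x ^+ 2) + x * (x * a x ^+ 2) + x * (m * (a x * b x)).
      by rewrite /Q; ring.
    rewrite QE in qx; have N2 : N = C ^+ 2 + c * (2 * pi * C) + 2 * pi * C by [].
    move: e1 e2 e3 e4 qx N2 piC (mulr_ge0 c0 piC) (sqr_ge0 C); clear.
    lra.
  have e6 : q / 4 <= x * b x ^+ 2 - x * a x ^+ 2 - a x * b x.
    by rewrite -(ler_pM2l xp); apply: le_trans e5; move: xp q0; clear; nra.
  rewrite ler_pdivlMr//; apply: le_trans e6.
  have -> : q / (8 * X) * x = q * (x / X) / 8 by field; exact: lt0r_neq0.
  have : x / X <= 2 by rewrite ler_pdivrMr.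
  by move=> hx; have := ler_wpM2l (ltW q0) hx; lra.
have XX : X <= 2 * X by lra.
have d1 t : is_derive t (1 : R) (fun t => q / (8 * X) * t) (q / (8 * X)) by der; ring.
have := der1_cmp d1 dP P'ge XX.
have -> : q / (8 * X) * (2 * X) - q / (8 * X) * X = q / 8 by field; exact: lt0r_neq0.
have [_ s1] := sm X (lexx _); have [_ s2] := sm (2 * X) XX.
have f1 : `|P X| <= 2 * pi * C / X by rewrite ler_pdivlMr.
have f2 : `|P (2 * X)| <= 2 * pi * C / X.
  rewrite ler_pdivlMr//; apply: le_trans s2; rewrite ler_wpM2l//.
have f3 : 2 * pi * C / X < q / 32.
  by rewrite ltr_pdivrMr//; move: XC; clear; lra.
have := ler_norm (- P X); rewrite normrN; have := ler_norm (P (2 * X)).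
move: f1 f2 f3 q0; clear; move: (P X) (P (2 * X)) (2 * pi * C / X) => u v w *; lra.
Qed.

End bessel.

(** * Oscillatory integrals with large amplitude *)

Section oscillatory.
Context {R : realType}.
Implicit Types (n : int) (r t : R).

Lemma prim_sin_der n x t :
  is_derive t (1 : R) (prim (fun t => sin (angle n x t))) (sin (angle n x t)).
Proof. by have [_] := primP (@continuous_sin_angle R n x). Qed.

Lemma prim_sin0 n x : prim (fun t => sin (angle n x t)) 0 = 0 :> R.
Proof. by have [] := primP (@continuous_sin_angle R n x). Qed.

(* First derivative estimate with amplitude x = r^2: dividing by the phase speed
   s is replaced by the multiplier s / (s^2 + r^2). *)
Lemma oscillatory_bound n r (f f' F : R -> R) :
  1 <= r -> n%:~R ^+ 2 <= r ^+ 2 ->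
  (forall t, is_derive t (1 : R) f ((n%:~R + r ^+ 2 * cos t) * f' t)) ->
  (forall t, is_derive t (1 : R) F (f' t)) -> F 0 = 0 ->
  (forall t, `|f t| <= 1) -> (forall t, `|f' t| <= 1) ->
  forall t, 0 <= t <= 2 * pi -> `|F t| <= 100 / r.
Proof.
move=> r1 nr df dF F0 f1 f'1 t /andP[t0 t2].
have r0 : 0 < r by lra.
have rn : r != 0 by rewrite lt0r_neq0.
have r2 : 0 < r ^+ 2 by rewrite exprn_gt0.
pose s u : R := n%:~R + r ^+ 2 * cos u.
pose q u : R := s u ^+ 2 + r ^+ 2.
have q0 u : 0 < q u by rewrite /q ltr_wpDl// sqr_ge0.
have qn u : q u != 0 by rewrite lt0r_neq0.
pose w u := s u / q u.
pose w' u := - (r ^+ 2 * sin u) * (r ^+ 2 - s u ^+ 2) / q u ^+ 2.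
have ds u : is_derive u (1 : R) s (- (r ^+ 2 * sin u)) by rewrite /s; der; ring.
have dw u : is_derive u (1 : R) w (w' u).
  have d := ds u; rewrite /w /w' /q; have hq := qn u; rewrite /q in hq.
  by eapply der1_eq; [repeat (der1_step || exact: hq)|field].
pose ka u := r ^+ 2 / q u.
have ka0 u : 0 <= ka u by rewrite divr_ge0// ltW.
have w'le u : `|w' u| <= ka u.
  rewrite /w' /ka normrM normfV (ger0_norm (sqr_ge0 _)) ler_pdivrMr ?exprn_gt0//.
  have -> : r ^+ 2 / q u * q u ^+ 2 = r ^+ 2 * q u by field.
  rewrite normrM normrN normrM (gtr0_norm r2); apply: ler_pM => //.
  - by rewrite mulr_ge0// ltW.
  - by rewrite ler_piMr ?sin_max// ltW.
  - by have := sqr_ge0 (s u); rewrite /q ler_norml => ?; apply/andP; split; lra.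
pose at_ u := atan (s u / r).
pose at' u := - (r ^+ 3 * sin u) / q u.
have dat u : is_derive u (1 : R) at_ (at' u).
  have d := ds u; rewrite /at_ /at'; der.
  have hq : r ^+ 2 + s u ^+ 2 != 0 by rewrite addrC; exact: qn.
  have e1 : 1 + (s u / r) ^+ 2 = (r ^+ 2 + s u ^+ 2) / r ^+ 2 by field.
  by rewrite e1 /q; field; rewrite rn andbT; exact: qn.
have at1 u : `|at_ u| <= 2.
  have h1 := atan_gtNpi2 (s u / r); have h2 := atan_ltpi2 (s u / r).
  have h3 := pihalf_lt2 R; rewrite /at_ ler_norml; apply/andP; split; lra.
(* An explicit majorant for the integral of ka. The part ka sin^2 comes from differentiating the
   arctangent of s / r; the part ka cos^2 is at most 2 / r^2 because r^4 cos^2 = (s - n)^2 <= 2 q.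
   The term 2 u / r absorbs the derivative of the sine factor. *)
pose g u := - (sin u * at_ u) / r + (2 / r + 2 / r ^+ 2) * u.
pose g' u := - (cos u * at_ u + sin u * at' u) / r + (2 / r + 2 / r ^+ 2).
have dg u : is_derive u (1 : R) g (g' u).
  by have d := dat u; rewrite /g /g'; eapply der1_eq; [repeat (der1_step || exact: rn)|field].
have kag u : ka u <= g' u.
  have h1 : - (sin u * at' u) / r = ka u * sin u ^+ 2 by rewrite /at' /ka; field; rewrite rn qn.
  have h2 : ka u * cos u ^+ 2 <= 2 / r ^+ 2.
    rewrite /ka mulrAC ler_pdivrMr// -(ler_pM2l r2).
    have -> : r ^+ 2 * (r ^+ 2 * cos u ^+ 2) = (s u - n%:~R) ^+ 2 by rewrite /s; ring.
    have -> : r ^+ 2 * (2 / r ^+ 2 * q u) = 2 * q u by field.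
    rewrite /q; have := sqr_ge0 (s u + n%:~R); lra.
  have h3 : - (cos u * at_ u) / r + 2 / r >= 0.
    rewrite -mulrDl divr_ge0 ?(ltW r0)// addrC subr_ge0; apply: le_trans (ler_norm _) _.
    rewrite normrM; apply: le_trans (at1 u); rewrite ler_piMl// cos_max//.
  have -> : ka u = ka u * cos u ^+ 2 + ka u * sin u ^+ 2.
    by rewrite -mulrDr cos2Dsin2 mulr1.
  by rewrite -h1 /g'; move: h2 h3; clear; lra.
(* Integration by parts with multiplier w: since w s = 1 - ka, what remains is ka f' - w' f, at most
   2 ka. The total is at most 70 / r from the integral and 1 / r from each end. *)
pose G u := F u - w u * f u.
pose G' u := f' u - (w' u * f u + w u * (s u * f' u)).
have dG u : is_derive u (1 : R) G (G' u).
  by have d1 := dw u; have d2 := df u; have d3 := dF u; rewrite /G /G'; der; rewrite -/(s u); ring.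
have G'le u : 0 <= u <= t -> `|G' u| <= 2 * g' u.
  move=> _; have -> : G' u = ka u * f' u - w' u * f u.
    by rewrite /G' /ka /w /q; have hq := qn u; rewrite /q in hq; field.
  apply: le_trans (ler_normB _ _) _.
  rewrite (normrM (ka u)) (normrM (w' u)) (ger0_norm (ka0 u)).
  have e1 : ka u * `|f' u| <= ka u by rewrite ler_piMr.
  have e2 : `|w' u| * `|f u| <= ka u by apply: le_trans (w'le u); rewrite ler_piMr.
  by have := kag u; move: e1 e2; clear; lra.
have d2g u : is_derive u (1 : R) (fun u => 2 * g u) (2 * g' u) by have d := dg u; der; ring.
have := der1_norm dG d2g G'le t0.
have wle u : `|w u * f u| <= 1 / r.
  rewrite normrM; apply: (@le_trans _ _ `|w u|); first by rewrite ler_piMr.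
  rewrite /w normrM normfV (gtr0_norm (q0 u)) ler_pdivrMr// mul1r [leRHS]mulrC ler_pdivlMr// /q.
  have := sqr_ge0 (`|s u| - r); rewrite -[s u ^+ 2]real_normK ?num_real//.
  have := sqr_ge0 `|s u|; have := sqr_ge0 r; lra.
have gle : g t - g 0 <= 35 / r.
  rewrite /g sin0 mul0r oppr0 mul0r mulr0 addr0 subr0.
  have rr : 2 / r ^+ 2 <= 2 / r.
    by rewrite ler_pM2l// lef_pV2 ?posrE// expr2 ler_peMl// ltW.
  have h1 : - (sin t * at_ t) / r <= 2 / r.
    rewrite ler_pM2r ?invr_gt0//; apply: le_trans (ler_norm _) _; rewrite normrN normrM.
    by apply: le_trans (at1 t); rewrite ler_piMl// sin_max.
  have t8 : t <= 8 by have := pihalf_lt2 R; lra.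
  have h2 : (2 / r + 2 / r ^+ 2) * t <= (4 / r) * 8.
    have i0 : 0 <= 2 / r by rewrite divr_ge0// ltW.
    rewrite ler_pM//.
      by rewrite addr_ge0// divr_ge0// ltW.
    by move: rr; clear; lra.
  have ri : 0 < r^-1 by rewrite invr_gt0.
  by move: h1 h2 ri; clear; lra.
rewrite /G F0 => h.
have := wle t; have := wle 0.
have -> : F t = (F t - w t * f t - (0 - w 0 * f 0)) + w t * f t - w 0 * f 0 by ring.
move=> h0 ht; apply: le_trans (ler_normB _ _) _.
have := ler_normD (F t - w t * f t - (0 - w 0 * f 0)) (w t * f t).
have ri : 0 < r^-1 by rewrite invr_gt0.
by move: h gle h0 ht ri; clear; lra.
Qed.

Lemma prim_angle_bound n r t : 1 <= r -> n%:~R ^+ 2 <= r ^+ 2 -> 0 <= t <= 2 * pi ->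
  `|prim (fun t => cos (angle n (r ^+ 2) t)) t| <= 100 / r /\
  `|prim (fun t => sin (angle n (r ^+ 2) t)) t| <= 100 / r.
Proof.
move=> r1 nr tt; split.
  apply: (@oscillatory_bound n r (fun t => sin (angle n (r ^+ 2) t)) (fun t => cos (angle n (r ^+ 2) t))) tt => //.
  - by move=> u; have d := angle_der n (r ^+ 2) u; der; ring.
  - by move=> u; exact: prim_cos_der.
  - exact: prim_cos0.
  - by move=> u; exact: sin_max.
  - by move=> u; exact: cos_max.
apply: (@oscillatory_bound n r (fun t => - cos (angle n (r ^+ 2) t)) (fun t => sin (angle n (r ^+ 2) t))) tt => //.
- by move=> u; have d := angle_der n (r ^+ 2) u; der; ring.
- by move=> u; exact: prim_sin_der.
- exact: prim_sin0.
- by move=> u; rewrite normrN; exact: cos_max.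
- by move=> u; exact: sin_max.
Qed.

End oscillatory.

(** * Hyperbolic points on integer levels *)

Section averaging.
Context {R : realType}.
Variable omega : R.
Hypothesis omega0 : 0 < omega.
Let k := (2 * omega)^-1.
Let k0 : 0 < k := rate_gt0 omega0.
Let W := 2 * k.
Implicit Types phi : R -> R.

Section fixed_parameters.
Variables (n : int) (r B : R).
Hypotheses (r1 : 1 <= r) (nr : n%:~R ^+ 2 <= r ^+ 2) (nB : `|n%:~R * omega - B| <= 1).
Let A := omega * r ^+ 2.
Let Th := angle n (r ^+ 2).
Let Fc := prim (fun t : R => cos (angle n (r ^+ 2) t)).
Let Fs := prim (fun t : R => sin (angle n (r ^+ 2) t)).
Let eps := 100 / r.
Let dl := W * B - n%:~R.
Hypothesis periodic : forall phi, is_solution omega B A phi ->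
  phi (2 * pi) = phi 0 + 2 * pi * n%:~R.

Let W0 : 0 < W. Proof. by rewrite /W mulr_gt0. Qed.
Let Ww : W * omega = 1. Proof. by rewrite /W /k; field; exact: lt0r_neq0. Qed.
Let eps0 : 0 < eps. Proof. by rewrite divr_gt0//; apply: lt_le_trans r1. Qed.
Let Fce t : 0 <= t <= 2 * pi -> `|Fc t| <= eps.
Proof. by move=> tt; case: (prim_angle_bound r1 nr tt). Qed.
Let Fse t : 0 <= t <= 2 * pi -> `|Fs t| <= eps.
Proof. by move=> tt; case: (prim_angle_bound r1 nr tt). Qed.
Let dFc t : is_derive t (1 : R) Fc (cos (Th t)) := prim_cos_der n (r ^+ 2) t.
Let dFs t : is_derive t (1 : R) Fs (sin (Th t)) := prim_sin_der n (r ^+ 2) t.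
Let Fc0 : Fc 0 = 0 := prim_cos0 n (r ^+ 2).
Let Fs0 : Fs 0 = 0 := prim_sin0 n (r ^+ 2).

Let Th2 : Th (2 * pi) = Th 0 + 2 * pi * n%:~R.
Proof.
rewrite /Th /angle (_ : 2 * pi = pi * 2%:Z%:~R); last by ring.
by rewrite sin_int sin0 !mulr0 !addr0; ring.
Qed.

Let dl_le : `|dl| <= W.
Proof.
have -> : dl = - (W * (n%:~R * omega - B)).
  by rewrite /dl; transitivity (W * B - W * omega * n%:~R); [rewrite Ww mul1r|ring].
by rewrite normrN normrM (gtr0_norm W0) ler_piMr// ltW.
Qed.

Definition lag phi t : R := phi t - Th t.
Definition lag' phi t : R := dl - W * sin (phi t).
(** With Z = Fc + i Fs, the integral of exp (i Th), the four functions are the real and imaginary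
    parts of exp (i lag) Z and of its square. *)
Definition av_re phi t : R := cos (lag phi t) * Fc t - sin (lag phi t) * Fs t.
Definition av_im phi t : R := sin (lag phi t) * Fc t + cos (lag phi t) * Fs t.
Definition av_re2 phi t : R :=
  (cos (lag phi t) ^+ 2 - sin (lag phi t) ^+ 2) * (Fc t ^+ 2 - Fs t ^+ 2)
  - 2 * sin (lag phi t) * cos (lag phi t) * (2 * Fc t * Fs t).
Definition av_im2 phi t : R :=
  2 * sin (lag phi t) * cos (lag phi t) * (Fc t ^+ 2 - Fs t ^+ 2)
  + (cos (lag phi t) ^+ 2 - sin (lag phi t) ^+ 2) * (2 * Fc t * Fs t).
(** The lag with two correctors: the first cancels the fast forcing W sin phi, the second the part
    with phase 2 lag + Th that the first one creates. *)
Definition averaged phi t : R :=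
  lag phi t + W * av_im phi t + W ^+ 2 / 4 * av_im2 phi t.

Section solution.
Variable phi : R -> R.
Hypothesis sol : is_solution omega B A phi.
Let psi := lag phi.
Let psi' := lag' phi.
Let Re := av_re phi.
Let Im := av_im phi.
Let Re2 := av_re2 phi.
Let Im2 := av_im2 phi.
Let K := averaged phi.

Let dpsi t : is_derive t (1 : R) psi (psi' t).
Proof.
have d1 := (is_solutionE omega0 B A phi).1 sol t.
have d2 := angle_der n (r ^+ 2) t.
rewrite /psi /psi' /lag /lag' /Th /dl; der; rewrite -/k -/W /A.
transitivity (W * B + (W * omega) * r ^+ 2 * cos t - W * sin (phi t) - (n%:~R + r ^+ 2 * cos t)).
  by ring.
by rewrite Ww; ring.
Qed.

Let sin_phi t : sin (phi t) = sin (psi t) * cos (Th t) + cos (psi t) * sin (Th t).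
Proof. by rewrite -sinD /psi /lag subrK. Qed.

Lemma averaged_der1 t :
  is_derive t (1 : R) (fun t => psi t + W * Im t) (dl + W * psi' t * Re t).
Proof.
have d1 := dpsi t; have d2 := dFc t; have d3 := dFs t.
by rewrite /Im /av_im -/psi; der; rewrite /Re /av_re -/psi /psi' /lag' sin_phi; ring.
Qed.

(** The term sin (Th) Fc - cos (Th) Fs is of first order in eps and cannot be averaged away, but it
    does not involve phi. The others are O(eps^2), for [dl] is O(eps) by [detuning_le]. *)
Lemma averaged_der2 t : is_derive t (1 : R) K
  (dl - W ^+ 2 / 2 * (sin (Th t) * Fc t - cos (Th t) * Fs t) + dl * W * Re t
   + W ^+ 2 / 2 * psi' t * Re2 t).
Proof.
have d1 := dpsi t; have d2 := dFc t; have d3 := dFs t.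
rewrite /K /averaged /av_im /av_im2 -/psi; der.
rewrite /Re /Re2 /av_re /av_re2 -/psi /psi' /lag' sin_phi.
have h := cos2Dsin2 (psi t).
transitivity (dl - W ^+ 2 / 2 * (cos (psi t) ^+ 2 + sin (psi t) ^+ 2) * (sin (Th t) * Fc t - cos (Th t) * Fs t)
  + dl * W * (cos (psi t) * Fc t - sin (psi t) * Fs t)
  + W ^+ 2 / 2 * (dl - W * (sin (psi t) * cos (Th t) + cos (psi t) * sin (Th t))) *
   ((cos (psi t) ^+ 2 - sin (psi t) ^+ 2) * (Fc t ^+ 2 - Fs t ^+ 2)
  - 2 * sin (psi t) * cos (psi t) * (2 * Fc t * Fs t))).
  by field.
by rewrite h mulr1.
Qed.

Lemma psi'_le t : `|psi' t| <= 2 * W.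
Proof.
rewrite /psi' /lag'; apply: le_trans (ler_normB _ _) _; rewrite normrM (gtr0_norm W0).
have : W * `|sin (phi t)| <= W by rewrite ler_piMr ?sin_max// ltW.
by have := dl_le; lra.
Qed.

Let rot_le (a b u v : R) : `|a| <= 1 -> `|b| <= 1 -> `|a * u| + `|b * v| <= `|u| + `|v|.
Proof. by move=> a1 b1; rewrite !normrM lerD// ler_piMl. Qed.

Lemma Re_le t : 0 <= t <= 2 * pi -> `|Re t| <= 2 * eps.
Proof.
move=> tt; have h1 := Fce tt; have h2 := Fse tt.
apply: le_trans (ler_normB _ _) (le_trans (rot_le _ _ (cos_max _) (sin_max _)) _); lra.
Qed.

Lemma Im_le t : 0 <= t <= 2 * pi -> `|Im t| <= 2 * eps.
Proof.
move=> tt; have h1 := Fce tt; have h2 := Fse tt.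
apply: le_trans (ler_normD _ _) (le_trans (rot_le _ _ (sin_max _) (cos_max _)) _); lra.
Qed.

Let quad_le t : 0 <= t <= 2 * pi ->
  `|Fc t ^+ 2 - Fs t ^+ 2| + `|2 * Fc t * Fs t| <= 3 * eps ^+ 2.
Proof.
move=> tt; have h1 := Fce tt; have h2 := Fse tt.
have s1 : `|Fc t| ^+ 2 <= eps ^+ 2 by rewrite lerXn2r// nnegrE// ltW.
have s2 : `|Fs t| ^+ 2 <= eps ^+ 2 by rewrite lerXn2r// nnegrE// ltW.
have s3 : `|Fc t| * `|Fs t| <= eps * eps by rewrite ler_pM.
have e1 : `|Fc t ^+ 2 - Fs t ^+ 2| <= eps ^+ 2.
  rewrite -[Fc t ^+ 2]real_normK ?num_real// -[Fs t ^+ 2]real_normK ?num_real//.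
  have := sqr_ge0 `|Fc t|; have := sqr_ge0 `|Fs t|; rewrite ler_norml => *.
  by apply/andP; split; lra.
by rewrite normrM normrM (@ger0_norm _ 2)//; lra.
Qed.

Let trig2 t : `|cos (psi t) ^+ 2 - sin (psi t) ^+ 2| <= 1 /\ `|2 * sin (psi t) * cos (psi t)| <= 1.
Proof.
have -> : cos (psi t) ^+ 2 - sin (psi t) ^+ 2 = cos (psi t + psi t) by rewrite cosD; ring.
have -> : 2 * sin (psi t) * cos (psi t) = sin (psi t + psi t) by rewrite sinD; ring.
by split; [exact: cos_max|exact: sin_max].
Qed.

Lemma Re2_le t : 0 <= t <= 2 * pi -> `|Re2 t| <= 3 * eps ^+ 2.
Proof.
move=> tt; have [h1 h2] := trig2 t; apply: le_trans (quad_le tt).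
exact: le_trans (ler_normB _ _) (rot_le _ _ h1 h2).
Qed.

Lemma Im2_le t : 0 <= t <= 2 * pi -> `|Im2 t| <= 3 * eps ^+ 2.
Proof.
move=> tt; have [h1 h2] := trig2 t; apply: le_trans (quad_le tt).
exact: le_trans (ler_normD _ _) (rot_le _ _ h2 h1).
Qed.

Lemma psi_periodic : psi (2 * pi) = psi 0.
Proof. by rewrite /psi /lag periodic// Th2; ring. Qed.

Let D := W + 4 * W ^+ 2.

(** After one averaging the lag drifts at the rate dl + O(eps), while periodicity returns it to its
    initial value; so dl itself is O(eps). *)
Lemma detuning_le : `|dl| <= D * eps.
Proof.
have p0 := pi_gt0 R; have p2 := pi_ge2 R.
have pp : 0 <= 2 * pi :> R by rewrite mulr_ge0// ltW.
have dG t : is_derive t (1 : R) (fun t => (psi t + W * Im t) - dl * t) (W * psi' t * Re t).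
  by have d := averaged_der1 t; der; ring.
have G'le t : 0 <= t <= 2 * pi -> `|W * psi' t * Re t| <= 4 * W ^+ 2 * eps.
  move=> tt; rewrite normrM normrM (gtr0_norm W0).
  have h1 : W * `|psi' t| <= W * (2 * W) by apply: ler_wpM2l; [exact: ltW|exact: psi'_le].
  have h2 := ler_pM (mulr_ge0 (ltW W0) (normr_ge0 _)) (normr_ge0 _) h1 (Re_le tt).
  by move: h2; lra.
have := der1_bound dG G'le pp; rewrite psi_periodic subr0.
have -> : Im 0 = 0 by rewrite /Im /av_im Fc0 Fs0; ring.
have h1 : `|W * Im (2 * pi)| <= W * (2 * eps).
  rewrite normrM (gtr0_norm W0) ler_wpM2l ?(ltW W0)//; apply: Im_le; rewrite pp lexx//.
have -> : psi 0 + W * Im (2 * pi) - dl * (2 * pi) - (psi 0 + W * 0 - dl * 0) =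
   W * Im (2 * pi) - 2 * pi * dl by ring.
move=> h2; have : `|2 * pi * dl| <= W * (2 * eps) + 4 * W ^+ 2 * eps * (2 * pi).
  have -> : 2 * pi * dl = W * Im (2 * pi) - (W * Im (2 * pi) - 2 * pi * dl) by ring.
  by apply: le_trans (ler_normB _ _) _; exact: lerD.
have pi2 : 0 < 2 * pi :> R by rewrite mulr_gt0.
rewrite normrM (gtr0_norm pi2) => h3.
have h4 : W * (2 * eps) <= W * eps * (2 * pi).
  have := mulr_gt0 W0 eps0 => we; nra.
rewrite -(ler_pM2l pi2) /D; lra.
Qed.

Lemma averaged_endpoints : K (2 * pi) - K 0 =
  W * Im (2 * pi) + W ^+ 2 / 4 * Im2 (2 * pi).
Proof.
rewrite /K /averaged -/psi -/Im -/Im2 psi_periodic.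
have -> : Im 0 = 0 by rewrite /Im /av_im Fc0 Fs0; ring.
have -> : Im2 0 = 0 by rewrite /Im2 /av_im2 Fc0 Fs0; ring.
by ring.
Qed.

End solution.

(** The solutions start with lag pi / 2 and - pi / 2, so that the first corrector at 2 pi is Fc (2
    pi) and its opposite. In the difference of the averaged lags the common first order term drops
    out and twice W [bes] is left. *)
Lemma bes_small : `|bes n (r ^+ 2)| <= (16 * (W + 4 * W ^+ 2) + 24 * W ^+ 2 + W) * eps ^+ 2.
Proof.
have p0 := pi_gt0 R; have p2 := pi_ge2 R; have p4 : pi <= 4 :> R by have := pihalf_lt2 R; lra.
have pp : 0 <= 2 * pi :> R by rewrite mulr_ge0// ltW.
have [phi [h ph0]] := solution_exists omega0 B A (pi / 2).
have [psi [h' ps0]] := solution_exists omega0 B A (- (pi / 2)).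
have w0 := W0; have e0 := eps0.
set D := W + 4 * W ^+ 2; have dle := detuning_le h; rewrite -/D in dle.
have dd t : is_derive t (1 : R) (fun t => averaged phi t - averaged psi t)
  (W * (dl * av_re phi t) - W * (dl * av_re psi t)
   + (W ^+ 2 / 2 * (lag' phi t * av_re2 phi t) - W ^+ 2 / 2 * (lag' psi t * av_re2 psi t))).
  by have d1 := averaged_der2 h t; have d2 := averaged_der2 h' t; der; ring.
have bound t : 0 <= t <= 2 * pi ->
  `|W * (dl * av_re phi t) - W * (dl * av_re psi t)
   + (W ^+ 2 / 2 * (lag' phi t * av_re2 phi t) - W ^+ 2 / 2 * (lag' psi t * av_re2 psi t))|
    <= (4 * W * D + 6 * W ^+ 3) * eps ^+ 2.
  move=> tt.
  have m1 (d a : R) (u v : R) : `|d| <= u -> `|a| <= v -> `|d * a| <= u * v.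
    by move=> du av; rewrite normrM ler_pM.
  have w2 : 0 <= W ^+ 2 / 2 by rewrite divr_ge0// sqr_ge0.
  have g (c x y : R) : 0 <= c -> `|x| <= y -> `|c * x| <= c * y.
    by move=> c0 xy; rewrite normrM ger0_norm// ler_wpM2l.
  have f1 := g W _ _ (ltW w0) (m1 _ _ _ _ dle (Re_le phi tt)).
  have f2 := g W _ _ (ltW w0) (m1 _ _ _ _ dle (Re_le psi tt)).
  have f3 := g _ _ _ w2 (m1 _ _ _ _ (psi'_le phi t) (Re2_le phi tt)).
  have f4 := g _ _ _ w2 (m1 _ _ _ _ (psi'_le psi t) (Re2_le psi tt)).
  apply: le_trans (ler_normD _ _) _.
  apply: le_trans (lerD (ler_normB _ _) (ler_normB _ _)) _.
  apply: le_trans (lerD (lerD f1 f2) (lerD f3 f4)) _.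
  by rewrite le_eqVlt; apply/orP; left; apply/eqP; field.
have tt : 0 <= 2 * (pi : R) <= 2 * pi by rewrite pp lexx.
have i1 := Im2_le phi tt; have i2 := Im2_le psi tt.
have Th0 : Th 0 = 0 by rewrite /Th /angle sin0 !mulr0 addr0.
have l1 : av_im phi (2 * pi) = bes n (r ^+ 2).
  rewrite /av_im (psi_periodic h) /lag ph0 Th0 subr0 sin_pihalf cos_pihalf mul0r addr0.
  by rewrite mul1r.
have l2 : av_im psi (2 * pi) = - bes n (r ^+ 2).
  rewrite /av_im (psi_periodic h') /lag ps0 Th0 subr0 sinN cosN sin_pihalf cos_pihalf.
  by rewrite mul0r addr0 mulN1r.
have := der1_bound dd bound pp.
have -> : averaged phi (2 * pi) - averaged psi (2 * pi) - (averaged phi 0 - averaged psi 0)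
  = (averaged phi (2 * pi) - averaged phi 0) - (averaged psi (2 * pi) - averaged psi 0) by ring.
rewrite (averaged_endpoints h) (averaged_endpoints h') l1 l2 subr0.
set b := bes _ _; set c1 := av_im2 phi _ in i1 *; set c2 := av_im2 psi _ in i2 *.
move=> H.
have w24 : 0 <= W ^+ 2 / 4 by rewrite divr_ge0// sqr_ge0.
have H2 : `|2 * W * b| <= (4 * W * D + 6 * W ^+ 3) * eps ^+ 2 * (2 * pi)
    + W ^+ 2 / 4 * (6 * eps ^+ 2).
  have -> : 2 * W * b = (W * b + W ^+ 2 / 4 * c1 - (W * - b + W ^+ 2 / 4 * c2))
      - W ^+ 2 / 4 * (c1 - c2) by ring.
  apply: le_trans (ler_normB _ _) _; apply: lerD => //.
  rewrite normrM (ger0_norm w24) ler_wpM2l//; apply: le_trans (ler_normB _ _) _; lra.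
have W2 : 0 < 2 * W by rewrite mulr_gt0.
move: H2; rewrite normrM (gtr0_norm W2) => H2.
rewrite -(ler_pM2l W2); apply: le_trans H2 _.
have D0 : 0 < D by rewrite addr_gt0// mulr_gt0// exprn_gt0.
have A0 : 0 <= (4 * W * D + 6 * W ^+ 3) * eps ^+ 2.
  apply: mulr_ge0 (sqr_ge0 _); apply: addr_ge0.
    exact: mulr_ge0 (mulr_ge0 (ler0n _ 4) (ltW w0)) (ltW D0).
  exact: mulr_ge0 (ler0n _ 6) (exprn_ge0 3 (ltW w0)).
have := ler_wpM2l A0 p4; have := sqr_ge0 (W * eps); lra.
Qed.

End fixed_parameters.

Let rho (B A : R) := rotation_number omega (B, A).

(** By [rho_bound] the values of rho at B = r omega - 1 and B = r omega + 1 enclose r. *)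
Lemma level_exists (A r : R) : exists B, rho B A = r.
Proof.
have bd B := rho_bound omega0 B A.
have cf : continuous (fun B => rho B A - r).
  move=> B; apply: cvgB; last exact: cvg_cst.
  apply/cvgrPdist_le => e e0; have [d d0 hd] := rho_near omega0 B A e0.
  near=> B'; rewrite distrC; apply: hd; last by rewrite subrr normr0 ltW.
  by rewrite distrC; near: B'; apply: cvgr_dist_le => //; exact: cvg_id.
have [||B _ hB] := IVT_zero (a := r * omega - 1) (b := r * omega + 1) cf.
- have := bd (r * omega - 1); rewrite ler_norml -/(rho _ _) => /andP[_ h].
  by rewrite subr_le0 -(ler_pM2r omega0); lra.
- have := bd (r * omega + 1); rewrite ler_norml -/(rho _ _) => /andP[h _].
  by rewrite subr_ge0 -(ler_pM2r omega0); lra.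
by exists B; apply/eqP; rewrite -subr_eq0 hB.
Unshelve. all: by end_near. Qed.

Lemma int_rho_trace (B A : R) (n : int) : rho B A = n%:~R -> 4 <= trmono k B A ^+ 2.
Proof.
move=> e; have [_ [[_ [_]]|[]//]] := rotation_dichotomy omega0 B A.
by rewrite -/(rho B A) e sin_int mulr0 ltxx.
Qed.

Lemma near_int (a b : int) : `|a%:~R - b%:~R : R| < 1 -> a = b.
Proof.
rewrite -intrB -intr_norm -[1]/(1%:~R) ltr_int => h.
by apply/eqP; rewrite -subr_eq0 -normr_eq0; lia.
Qed.

(* If the level set n contained no hyperbolic parameter, the trace would be
   extremal along it, which forces the monodromy to be plus or minus identity. *)
Lemma nonhyperbolic_scalar (B A : R) (n : int) : rho B A = n%:~R ->
  (forall B' A', rho B' A' = n%:~R -> trmono k B' A' ^+ 2 <= 4) ->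
  mono12 k B A = 0 /\ mono21 k B A = 0.
Proof.
move=> e flat.
have T4 : trmono k B A ^+ 2 = 4.
  by apply/eqP; rewrite eq_le flat// (int_rho_trace e).
case: (boolP ((mono12 k B A != 0) || (mono21 k B A != 0))) => [qr|]; last first.
  by rewrite negb_or !negbK => /andP[/eqP-> /eqP->].
have T4' : trmono k B A ^+ 2 <= 4 by rewrite T4.
have [c [e1 [c0 e10 der]]] := trace_derivative k0 T4' qr.
have half0 : 0 < 1 / 2 :> R by lra.
have [d d0 hd] := rho_near omega0 B A half0.
(* Nearby rho varies by at most 1 / 2, so a nearby point with integer rho is on the same level n,
   where [flat] applies; the other points are elliptic. *)
have T4u u : `|u| <= d -> trmono k (B + u) A ^+ 2 <= 4.
  move=> ud; have [_ [[/ltW//]|[_ [m hm]]]] := rotation_dichotomy omega0 (B + u) A.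
  apply: flat; rewrite -/(rho _ _) in hm; rewrite hm; congr (_%:~R); apply: near_int.
  rewrite -hm -e; apply: le_lt_trans (hd (B + u) A _ _) _; last by lra.
    by rewrite addrC addKr.
  by rewrite subrr normr0 ltW.
pose u := Num.min d e1.
have u0 : 0 < u by rewrite lt_min d0.
have nu : `|u| = u by rewrite gtr0_norm.
have ud : `|u| <= d by rewrite nu ge_min lexx.
have ue : `|u| <= e1 by rewrite nu ge_min lexx orbT.
have p1 := der u ue; have p2 := der (- u); rewrite normrN sqrrN in p2; have {}p2 := p2 ue.
have t1 := T4u u ud; have t2 := T4u (- u); rewrite normrN in t2; have {}t2 := t2 ud.
move: p1 p2 t1 t2 T4; set T := trmono k B A; set T1 := trmono k (B + u) A.
set T2 := trmono k (B - u) A; set sg := trace_sign _ _ => p1 p2 t1 t2 T4.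
have cu : 0 < c * u ^+ 2 by rewrite mulr_gt0// exprn_gt0.
have h1 : 0 < sg * (T1 - T).
  by rewrite -(pmulr_rgt0 _ u0) mulrA [u * sg]mulrC; apply: lt_le_trans p1.
have h2 : sg * (T2 - T) < 0.
  rewrite -(pmulr_rlt0 _ u0) mulrA [u * sg]mulrC -oppr_gt0 -mulNr -mulrN.
  exact: lt_le_trans p2.
(* T^2 = 4 bounds T1^2 and T2^2, so T1 and T2 lie on the same side of T, while the slope bound puts
   them on opposite sides. *)
have q1 : T * (T1 - T) <= 0 by have := sqr_ge0 (T1 - T); lra.
have q2 : T * (T2 - T) <= 0 by have := sqr_ge0 (T2 - T); lra.
have h3 : 0 <= (T * (T1 - T)) * (T * (T2 - T)) by rewrite mulr_le0.
have h4 : (sg * (T1 - T)) * (sg * (T2 - T)) < 0 by rewrite pmulr_rlt0.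
have h5 : 0 <= (T1 - T) * (T2 - T) by move: h3; rewrite mulrACA -expr2 T4 pmulr_rge0.
by have := mulr_ge0 (sqr_ge0 sg) h5; rewrite expr2 -mulrACA leNgt h4.
Qed.

(** With zero off-diagonal entries, det M = 1 and T^2 <= 4 force M to be plus or minus the identity.
    Every direction then returns to its own line, and its winding number must be n because it
    determines rho. *)
Lemma scalar_periodic (B A : R) (n : int) : rho B A = n%:~R ->
  mono12 k B A = 0 -> mono21 k B A = 0 -> trmono k B A ^+ 2 <= 4 ->
  forall phi, is_solution omega B A phi -> phi (2 * pi) = phi 0 + 2 * pi * n%:~R.
Proof.
move=> e q0 r0 T4 phi h.
have det := det_mono k0 B A; rewrite q0 mul0r subr0 in det.
have ps : mono11 k B A = mono22 k B A.
  move: T4; rewrite /trmono => T4; apply/eqP; rewrite -subr_eq0 -sqrf_eq0 eq_le sqr_ge0 andbT.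
  have -> : (mono11 k B A - mono22 k B A) ^+ 2 =
    (mono11 k B A + mono22 k B A) ^+ 2 - 4 * (mono11 k B A * mono22 k B A) by ring.
  by rewrite det; lra.
have [r rP] := solution_polar omega0 h.
have p2 : 0 <= 2 * pi :> R by rewrite mulr_ge0// pi_ge0.
have [rp xE yE] := rP _ p2.
have [] := is_lin_mono k0 0 (lin_is_lin k0 (cos (phi 0 / 2), sin (phi 0 / 2)) B A).
rewrite mulr1 mulr0 linx0 liny0 /= q0 r0 !mul0r addr0 add0r xE yE ps => x1 y1.
have : sin (phi (2 * pi) / 2 - phi 0 / 2) = 0.
  apply: (mulfI (lt0r_neq0 rp)); rewrite mulr0 sinB mulrBr !mulrA x1 y1; ring.
move=> /sin_eq0_int[m hm].
have hphi : phi (2 * pi) = phi 0 + 2 * pi * m%:~R by lra.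
suff <- : m = n by [].
apply: (@intr_inj R); rewrite -e; apply/esym.
exact: (tracks_rho omega0 (locked_tracks omega0 h hphi)).
Qed.

Lemma int_level_hyperbolic (n : int) : exists B A, rho B A = n%:~R /\ 4 < trmono k B A ^+ 2.
Proof.
apply: contrapT => no.
have flat B A : rho B A = n%:~R -> trmono k B A ^+ 2 <= 4.
  by move=> e; rewrite leNgt; apply/negP => T4; apply: no; exists B, A.
(* The factor 10000 is the square of the constant 100 in [eps], and eps^2 = 10000 / x for r^2 =
   x. *)
pose C : R := (16 * (W + 4 * W ^+ 2) + 24 * W ^+ 2 + W) * 10000.
apply: (@bes_not_small R n C (1 + n%:~R ^+ 2)) => x hx.
have n2 := sqr_ge0 (n%:~R : R).
have x1 : 1 <= x by lra.
have x0 : 0 <= x by lra.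
pose r := Num.sqrt x; have rx : r ^+ 2 = x by rewrite sqr_sqrtr.
have r1 : 1 <= r by rewrite -sqrtr1 ler_sqrt//; lra.
have nr : n%:~R ^+ 2 <= r ^+ 2 by rewrite rx; lra.
have [B e] := level_exists (omega * r ^+ 2) n%:~R.
have [q0 r0] := nonhyperbolic_scalar e flat.
have nB : `|n%:~R * omega - B| <= 1 by rewrite -e; exact: rho_bound.
have := bes_small r1 nr nB (scalar_periodic e q0 r0 (flat _ _ e)).
have r2 : 0 < r ^+ 2 by rewrite exprn_gt0//; apply: lt_le_trans r1.
rewrite -(ler_pM2r r2) rx => h; apply: le_trans h _.
have rn : r != 0 by rewrite lt0r_neq0//; apply: lt_le_trans r1.
rewrite /C -rx; move: (16 * _ + _ + _) => c.
by rewrite le_eqVlt; apply/orP; left; apply/eqP; field.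
Qed.

End averaging.

(** * Level sets of the rotation number *)

(** Growth is known only at points of the level, so f might a priori jump back below r by another
    route. It is below r at x2, just left of b; the last point s of [a, x2] with f >= r would by
    continuity lie on the level and have values below r to its right. *)
Lemma unique_level (R : realType) (f : R -> R) (r a b : R) :
  (forall x e, 0 < e -> exists2 d, 0 < d &
    forall y, `|y - x| <= d -> `|f y - f x| <= e) ->
  (forall x, f x = r -> exists2 e, 0 < e &
    forall u, 0 < u <= e -> f (x - u) < r < f (x + u)) ->
  f a = r -> f b = r -> a < b -> False.
Proof.
move=> cf incr fa fb ab; have [e e0 he] := incr b fb.
pose x2 := b - Num.min e ((b - a) / 2).
have [m0 me mb] : [/\ 0 < Num.min e ((b - a) / 2), Num.min e ((b - a) / 2) <= e &
    Num.min e ((b - a) / 2) <= (b - a) / 2].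
  by rewrite lt_min !ge_min !lexx orbT e0 divr_gt0 ?subr_gt0.
have ax2 : a < x2 by rewrite /x2; move: mb ab; clear; lra.
have fx2 : f x2 < r by have /andP[] := he _ (introT andP (conj m0 me)).
pose S := [set x | a <= x <= x2 /\ r <= f x].
have Sa : S a by split; rewrite ?lexx ?fa ?(ltW ax2).
have supS : has_sup S by split; [exists a|exists x2 => x [/andP[]]].
pose s := sup S.
have as_ : a <= s by exact: sup_upper_bound supS _ Sa.
have sx2 : s <= x2.
  by apply: ge_sup; [exists a|move=> x [/andP[]]].
have ubS x : S x -> x <= s by move: x; apply: sup_upper_bound.
have right y : s < y -> y <= x2 -> f y < r.
  move=> sy yx; rewrite ltNge; apply/negP => ry.
  have /ubS : S y by split => //; rewrite yx andbT (le_trans as_)// ltW.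
  by rewrite leNgt sy.
have [fs|fs|fs] := ltgtP (f s) r.
- have h : 0 < (r - f s) / 2 by rewrite divr_gt0 ?subr_gt0.
  have [d d0 hd] := cf s _ h.
  have [x Sx xs] := sup_adherent d0 supS.
  have xs' := ubS _ Sx; have [_ rx] := Sx.
  have : `|x - s| <= d.
    by rewrite ler0_norm ?subr_le0//; move: xs; rewrite -/s; clear; lra.
  move=> /hd; rewrite ler_norml => /andP[_]; move: rx fs; clear; lra.
- have sx : s < x2.
    by rewrite lt_neqAle sx2 andbT; apply/eqP => E; move: fs; rewrite E ltNge ltW.
  have h : 0 < (f s - r) / 2 by rewrite divr_gt0 ?subr_gt0.
  have [d d0 hd] := cf s _ h.
  pose t := Num.min d (x2 - s).
  have [t0 td tx] : [/\ 0 < t, t <= d & t <= x2 - s].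
    by rewrite lt_min !ge_min !lexx orbT d0 subr_gt0.
  have := right (s + t); rewrite ltrDl t0 => /(_ isT) h1.
  have h2 : f (s + t) < r by apply: h1; move: tx; clear; lra.
  have := hd (s + t); rewrite addrAC subrr add0r gtr0_norm// => /(_ td).
  rewrite ler_norml => /andP[h3 _]; move: h2 h3 fs; clear; lra.
- have sx : s < x2.
    by rewrite lt_neqAle sx2 andbT; apply/eqP => E; move: fx2; rewrite -E fs ltxx.
  have [d d0 hd] := incr s fs.
  pose t := Num.min d (x2 - s).
  have [t0 td tx] : [/\ 0 < t, t <= d & t <= x2 - s].
    by rewrite lt_min !ge_min !lexx orbT d0 subr_gt0.
  have := right (s + t); rewrite ltrDl t0 => /(_ isT) h1.
  have h2 : f (s + t) < r by apply: h1; move: tx; clear; lra.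
  have /andP[_] := hd _ (introT andP (conj t0 td)); move: h2; clear; lra.
Qed.

Lemma nonint_strip (R : realType) (x : R) :
  x \isn't a Num.int <-> exists n : int, n%:~R < x < n%:~R + 1.
Proof.
split=> [xn|[n /andP[nx xn]]].
  exists (Num.floor x); have := floor_itv x.
  rewrite intrD => /andP[h ->]; rewrite andbT lt_neqAle h andbT.
  by apply/eqP => E; move: xn; rewrite -E intr_int.
apply/negP => /intrP[m E]; move: nx xn; rewrite E ltr_int.
by rewrite -[1]/(1%:~R) -intrD ltr_int; lia.
Qed.

Lemma pi_strip (R : realType) (n : int) (x : R) : n%:~R < x < n%:~R + 1 ->
  pi * n%:~R < pi * x < pi * n%:~R + pi.
Proof.
by move=> /andP[a b]; rewrite -[X in _ + X]mulr1 -mulrDr !ltr_pM2l ?pi_gt0// a.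
Qed.

Lemma sin_same_sign (R : realType) (n : int) (a b : R) :
  pi * n%:~R < a < pi * n%:~R + pi -> pi * n%:~R < b < pi * n%:~R + pi ->
  0 < sin a * sin b.
Proof.
move=> /andP[a1 a2] /andP[b1 b2].
rewrite -[a](subrK (pi * n%:~R)) -[b](subrK (pi * n%:~R)) !sin_shift.
rewrite mulrACA parity_sqr mul1r mulr_gt0//; apply: sin_gt0_pi; apply/andP; split;
  lra.
Qed.

Lemma cos_inj_strip (R : realType) (n : int) (a b : R) :
  pi * n%:~R < a < pi * n%:~R + pi -> pi * n%:~R < b < pi * n%:~R + pi ->
  cos a = cos b -> a = b.
Proof.
move=> /andP[a1 a2] /andP[b1 b2].
rewrite -[a](subrK (pi * n%:~R)) -[b](subrK (pi * n%:~R)) !cos_shift.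
move=> /(mulfI (parity_neq0 n)) E; congr (_ + _); apply: cos_inj E; rewrite in_itv/=; apply/andP; split; lra.
Qed.

(** * Strict monotonicity of the rotation number in B *)

Section rotation.
Context {R : realType}.
Variable omega : R.
Hypothesis omega0 : 0 < omega.
Let k := (2 * omega)^-1.
Let k0 : 0 < k := rate_gt0 omega0.
Let rho (B A : R) := rotation_number omega (B, A).

Lemma nonint_trace B A : rho B A \isn't a Num.int ->
  [/\ trmono k B A ^+ 2 < 4, trmono k B A = 2 * cos (pi * rho B A) &
   0 < mono21 k B A * sin (pi * rho B A)].
Proof.
move=> rn; have [_ []] := rotation_dichotomy omega0 B A; first by case=> ? [].
by move=> [_ [n E]]; move: rn; rewrite /rho E intr_int.
Qed.

Lemma trace_slope B A : rho B A \isn't a Num.int -> exists c e : R,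
  [/\ 0 < c, 0 < e & forall u, `|u| <= e ->
    c * u ^+ 2 <= - mono21 k B A * u * (trmono k (B + u) A - trmono k B A)].
Proof.
move=> /nonint_trace[T4 _ ms].
have m0 : mono21 k B A != 0 by apply: contraTneq ms => ->; rewrite mul0r ltxx.
have := trace_derivative k0 (ltW T4) (introT orP (or_intror m0)).
by rewrite /trace_sign (negPf m0).
Qed.

Lemma rho_stays n B A : n%:~R < rho B A < n%:~R + 1 -> exists2 d : R, 0 < d &
  forall B' A', `|B' - B| <= d -> `|A' - A| <= d -> n%:~R < rho B' A' < n%:~R + 1.
Proof.
move=> /andP[h1 h2].
have e0 : 0 < Num.min (rho B A - n%:~R) (n%:~R + 1 - rho B A) / 2.
  by rewrite divr_gt0// lt_min !subr_gt0 h1.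
have [d d0 hd] := rho_near omega0 B A e0; exists d => // B' A' hB hA.
have := hd B' A' hB hA; set m := Num.min _ _; rewrite -/(rho B A) -/(rho B' A').
have m1 : m <= rho B A - n%:~R by rewrite ge_min lexx.
have m2 : m <= n%:~R + 1 - rho B A by rewrite ge_min lexx orbT.
rewrite ler_norml => /andP[a b]; apply/andP; split; move: m1 m2 a b e0; rewrite -/m; clear; lra.
Qed.

Lemma rho_incr B A : rho B A \isn't a Num.int -> exists2 e : R, 0 < e &
  forall u, 0 < u <= e -> rho (B - u) A < rho B A < rho (B + u) A.
Proof.
move=> rn; have [T4 TE ms] := nonint_trace rn.
have [n hn] := (nonint_strip _).1 rn; have [d d0 hd] := rho_stays hn.
have [c [e [c0 e0 he]]] := trace_slope rn.
have {}he u : `|u| <= e -> `|u| <= d -> c * u ^+ 2 <=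
    - mono21 k B A * u * (2 * (cos (pi * rho (B + u) A) - cos (pi * rho B A))).
  move=> ue ud; have := he u ue; rewrite TE.
  have hu : n%:~R < rho (B + u) A < n%:~R + 1.
    by apply: hd; rewrite ?subrr ?normr0 ?(ltW d0)// addrAC subrr add0r.
  have [_ -> _] := nonint_trace ((nonint_strip _).2 (ex_intro _ n hu)).
  by rewrite -mulrBr.
exists (Num.min e d); first by rewrite lt_min e0.
move=> u /andP[u0]; rewrite le_min => /andP[ue ud].
have nu : `|u| = u by rewrite gtr0_norm.
have nu' : `|- u| = u by rewrite normrN.
have cu : 0 < c * u ^+ 2 by rewrite mulr_gt0 ?exprn_gt0.
have hp : n%:~R < rho (B + u) A < n%:~R + 1.
  by apply: hd; rewrite ?subrr ?normr0 ?(ltW d0)// addrAC subrr add0r nu.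
have hm : n%:~R < rho (B - u) A < n%:~R + 1.
  by apply: hd; rewrite ?subrr ?normr0 ?(ltW d0)// addrAC subrr add0r nu'.
(* M21 and sin (pi rho) have the same sign, so the slope of the trace can be expressed by the sine,
   as [cos_cmp] needs. *)
have key D : 0 < mono21 k B A * D -> 0 < sin (pi * rho B A) * D.
  move=> h; rewrite -(pmulr_rgt0 _ ms).
  have -> : mono21 k B A * sin (pi * rho B A) * (sin (pi * rho B A) * D) =
    sin (pi * rho B A) ^+ 2 * (mono21 k B A * D) by ring.
  rewrite mulr_gt0// exprn_even_gt0//=; apply/eqP => E.
  by move: ms; rewrite E mulr0 ltxx.
have p0 := pi_gt0 R.
apply/andP; split; rewrite -(ltr_pM2l p0).
- apply: (cos_cmp (n := n)); rewrite ?pi_strip//.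
  have := he (- u); rewrite nu' => /(_ ue ud); rewrite sqrrN => h.
  set D := cos _ - cos _.
  have {h}/key h : 0 < mono21 k B A * (- D).
    rewrite -(pmulr_rgt0 _ u0); rewrite -[cos _ - _]opprB -/D in h.
    by move: h cu; clear; lra.
  have h2 := sin_same_sign (pi_strip hm) (pi_strip hn).
  rewrite -oppr_gt0 -(pmulr_rgt0 _ h2).
  set s2 := sin (pi * rho B A) in h h2 *; set s1 := sin _ in h2 *.
  have -> : s1 * s2 * - (s1 * D) = s1 ^+ 2 * (s2 * - D) by ring.
  rewrite mulr_gt0// exprn_even_gt0//=; apply/eqP => E.
  by move: h2; rewrite E mul0r ltxx.
- apply: (cos_cmp (n := n)); rewrite ?pi_strip//.
  have := he u; rewrite nu => /(_ ue ud) h.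
  set D := cos _ - cos _ in h *.
  have {h}/key h : 0 < mono21 k B A * (- D).
    by rewrite -(pmulr_rgt0 _ u0); move: h cu; clear; lra.
  by rewrite -oppr_gt0 -mulrN.
Qed.

Lemma level_unique A B1 B2 : rho B1 A \isn't a Num.int ->
  rho B1 A = rho B2 A -> B1 = B2.
Proof.
move=> rn E.
have cf x e : 0 < e -> exists2 d : R, 0 < d &
    forall y, `|y - x| <= d -> `|rho y A - rho x A| <= e.
  move=> e0; have [d d0 hd] := rho_near omega0 x A e0; exists d => // y hy.
  by apply: hd => //; rewrite subrr normr0 (ltW d0).
have incr x : rho x A = rho B1 A -> exists2 e : R, 0 < e &
    forall u, 0 < u <= e -> rho (x - u) A < rho B1 A < rho (x + u) A.
  by move=> xE; rewrite -xE; apply: rho_incr; rewrite xE.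
have [h|h|//] := ltgtP B1 B2.
- by case: (@unique_level _ (rho^~ A) _ _ _ cf incr (erefl _) (esym E) h).
- by case: (@unique_level _ (rho^~ A) _ _ _ cf incr (esym E) (erefl _) h).
Qed.

End rotation.

(** * Analyticity *)

Lemma diff_criterion (R : realType) (V W : normedModType R) (f : V -> W)
  (df : {linear V -> W}) x : continuous df ->
  (forall e, 0 < e -> exists2 d, 0 < d &
    forall h, `|h| < d -> `|f (h + x) - f x - df h| <= e * `|h|) ->
  differentiable f x /\ 'd f x = df :> (V -> W).
Proof.
move=> cdf fh; have H : f \o shift x = cst (f x) + df +o_ 0 id.
  apply/eqaddoP => e e0; have [d d0 hd] := fh e e0; apply/nbhs_normP.
  exists d => // h; rewrite /ball_/= sub0r normrN => /hd.
  by rewrite !fctE/= opprD addrA.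
have E : 'd f x = df :> (V -> W) by exact: diff_unique.
by split => //; apply/diff_locallyP; rewrite E.
Qed.

Section analytic_maps.
Context {R : realType}.

Lemma isA_psum (c : nat -> R) (s : R) : entire c ->
  exists K : R, isA K (fun u _ => psum c (s * u)).
Proof.
move=> ce; have [K [K0 cK]] := entire_geometric s ce.
exists (2 * K); apply: (@isA_series _ _ (fun m => K * (1 / 8) ^+ m)
  (fun m u _ => c m * (s * u) ^+ m)).
- move=> m; have := isA_scale (c m * s ^+ m) (isA_mono m 0); rewrite mulr1.
  by move/(isA_le (cK m)); apply: isA_ext => u v _ _; rewrite exprMn expr0 mulr1 mulrA.
- move=> n; suff -> : \sum_(m < n) K * (1 / 8) ^+ m = K * (8 / 7) * (1 - (1 / 8) ^+ n).
    have := exprn_ge0 n (_ : 0 <= 1 / 8 :> R); rewrite divr_ge0// => /(_ isT) h.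
    by have := mulr_ge0 K0 h; move: K0; clear; lra.
  elim: n => [|n IH]; first by rewrite big_ord0 expr0 subrr mulr0.
  by rewrite big_ord_recr/= IH exprS; field.
- by move=> u v _ _; exact: psum_cvg.
Qed.

Lemma isA_cos (a s : R) : exists K, isA K (fun u _ => cos (a + s * u)).
Proof.
have ce : entire (cosc R) := @cosc_entire R.
have [K1 h1] := isA_psum s ce; have [K2 h2] := isA_psum s (entire_diffs ce).
exists (`|cos a| * K1 + `|sin a| * K2).
apply: isA_ext (isA_add (isA_scale (cos a) h1) (isA_scale (sin a) h2)) => u v _ _.
(* The sine series is obtained as minus the differentiated cosine series. *)
have -> : psum (pseries_diffs (cosc R)) (s * u) = - sin (s * u).
  have d1 := psum_der (s * u) ce; have d2 := is_derive_cos (s * u).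
  have E : psum (cosc R) = cos by apply/funext => t; exact: psum_cosc.
  rewrite E in d1; case: d1 => _ <-; by case: d2.
by rewrite psum_cosc cosD mulrN.
Qed.

(** The square of expansion may be taken inside a prescribed neighbourhood, where rho stays in one
    strip between integers. *)
Lemma analytic2_isA_small (f : R * R -> R) p (d : R) : 0 < d -> analytic2_at f p ->
  exists e K : R, 0 < e <= d /\
    isA K (fun u v => f (p.1 + e * u, p.2 + e * v) - f p).
Proof.
move=> d0 /analytic2_isA[e [K [e0 fK]]].
have h := isA_sub fK (isA_cst (f p)).
pose t := Num.min 1 (d / e).
have [t0 t1 td] : [/\ 0 < t, t <= 1 & t <= d / e].
  by rewrite lt_min !ge_min !lexx orbT ltr01 divr_gt0.
have := isA_rescale (d := t) h; rewrite !mulr0 !addr0 -surjective_pairing subrr.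
move=> /(_ (erefl _)); rewrite (ltW t0) t1 => /(_ isT) {}h.
exists (e * t), (t * (K + `|f p|)); split.
  by rewrite mulr_gt0//= mulrC -ler_pdivlMr.
by apply: isA_ext h => u v _ _; rewrite !mulrA.
Qed.

Lemma cos_lower (a : R) : sin a != 0 -> exists e c : R, [/\ 0 < e, 0 < c &
  forall x, `|x| <= e -> c * `|x| <= `|cos (a + x) - cos a|].
Proof.
move=> sa; have s0 : 0 < `|sin a| by rewrite normr_gt0.
exists (`|sin a| / 2), (`|sin a| / 2); split; rewrite ?divr_gt0// => x xe.
have h1 : `|x * sin a| <= `|cos (a + x) - cos a| + `|cos (a + x) - cos a + x * sin a|.
  have {1}-> : x * sin a = (cos (a + x) - cos a + x * sin a) - (cos (a + x) - cos a).
    by ring.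
  by apply: le_trans (ler_normB _ _) _; rewrite addrC.
have h2 := cos_taylor a x; rewrite -real_normK ?num_real// in h2.
rewrite normrM in h1; have h3 := ler_wpM2r (normr_ge0 x) xe.
move: h1 h2 h3; clear; lra.
Qed.

Lemma analytic2_snd (f : R * R -> R) p : analytic2_at f p ->
  analytic1_at (fun y => f (p.1, y)) p.2.
Proof.
move=> [a [e [e0 fa]]]; exists (a 0%N), e; split=> // v ve.
have := fa 0 v; rewrite normr0 => /(_ e0 ve)[_]; rewrite addr0.
apply: cvg_trans; apply: near_eq_cvg; near=> n.
have n0 : (0 < n)%N by near: n; exact: nbhs_infty_gt.
rewrite /pseries /series/= -(prednK n0) big_mkord.
rewrite [LHS]big_ord_recl/= [X in _ + X]big1 ?addr0.
  by apply: eq_bigr => i _; rewrite expr0 mulr1.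
by move=> i _; rewrite big1// => j _; rewrite exprS mul0r mulr0 mul0r.
Unshelve. all: by end_near. Qed.

Lemma analytic2_taylor (f : R * R -> R) p : analytic2_at f p ->
  exists al be C d : R, [/\ 0 <= C, 0 < d & forall h s, s <= d -> `|h.1| <= s ->
    `|h.2| <= s -> `|f (p + h) - f p - (al * h.1 + be * h.2)| <= C * s ^+ 2].
Proof.
move=> /analytic2_isA[e [K [e0 [a fa]]]].
have K0 : 0 <= K by apply: isA_ge0; exists a; exact: fa.
exists (a 1%N 0%N / e), (a 0%N 1%N / e), (K / e ^+ 2), e; split => //.
  by rewrite divr_ge0// exprn_ge0// ltW.
move=> h s sd h1 h2; have en0 := lt0r_neq0 e0.
have sm (x : R) : `|x| <= s -> `|x / e| <= s / e.
  by move=> xs; rewrite normrM (gtr0_norm (_ : 0 < e^-1)) ?invr_gt0// ler_pM2r ?invr_gt0.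
have := has_coef_taylor (s := s / e) fa _ (sm _ h1) (sm _ h2).
rewrite ler_pdivrMr// mul1r => /(_ sd).
rewrite -(has_coef_origin fa) !mulr0 !addr0 -surjective_pairing.
rewrite !(mulrCA e) !mulfV// !mulr1 => H.
have -> : f (p + h) - f p - (a 1%N 0%N / e * h.1 + a 0%N 1%N / e * h.2) =
  f (p.1 + h.1, p.2 + h.2) - (f p + a 1%N 0%N * (h.1 / e) + a 0%N 1%N * (h.2 / e)).
  by rewrite (_ : p + h = (p.1 + h.1, p.2 + h.2))//; ring.
apply: le_trans H _; rewrite expr_div_n mulrA [leRHS]mulrAC//.
Qed.

Definition pair_form (al be : R) (h : R * R) : R := al * h.1 + be * h.2.

Lemma pair_form_linear al be : linear (pair_form al be : R * R -> R^o).
Proof.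
move=> c x y; rewrite /pair_form /= /GRing.scale/=; ring.
Qed.

HB.instance Definition _ al be := GRing.isLinear.Build R (R * R)%type R^o _
  (pair_form al be) (pair_form_linear al be).

Lemma analytic2_diff (f : R * R -> R) p (al be C d : R) : 0 <= C -> 0 < d ->
  (forall h s, s <= d -> `|h.1| <= s -> `|h.2| <= s ->
    `|f (p + h) - f p - (al * h.1 + be * h.2)| <= C * s ^+ 2) ->
  differentiable f p /\ ('d f p : R * R -> R) = pair_form al be.
Proof.
move=> C0 d0 fh; apply: (diff_criterion (V := (R * R)%type) (W := R^o)).
  move=> x; apply: cvgD; apply: cvgMr; [exact: cvg_fst|exact: cvg_snd].
move=> e e0; pose t := Num.min d (e / (C + 1)).
have C1 : 0 < C + 1 by lra.
have [t0 td te] : [/\ 0 < t, t <= d & t <= e / (C + 1)].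
  by rewrite lt_min !ge_min !lexx orbT d0 divr_gt0.
exists t => // h ht.
have := fh h `|h|; rewrite (le_trans (ltW ht) td) => /(_ isT).
rewrite !le_max !lexx ?orbT => /(_ isT isT) H.
rewrite [h + p]addrC; apply: le_trans H _; rewrite expr2 mulrA ler_wpM2r//.
have h1 : `|h| * (C + 1) <= e by rewrite -ler_pdivlMr//; exact: le_trans (ltW ht) te.
by have := normr_ge0 h; lra.
Qed.

Lemma analytic2_continuous (f : R * R -> R) p : analytic2_at f p ->
  {for p, continuous f}.
Proof.
move=> /analytic2_taylor[al [be [C [d [C0 d0 h]]]]].
by have [/differentiable_continuous] := analytic2_diff C0 d0 h.
Qed.

End analytic_maps.

Lemma neg_prod_le (R : realType) (m y D : R) :
  - m * y * D <= `|y| * (`|m| * `|D|).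
Proof.
apply: le_trans (ler_norm _) _; rewrite !normrM normrN (mulrC `|m|) mulrA.
exact: lexx.
Qed.

Lemma isA_cos_diff (R : realType) (r s : R) : exists K,
  isA K (fun u _ => 2 * cos (pi * (r + s * u)) - 2 * cos (pi * r)).
Proof.
have [K cK] := isA_cos (pi * r) (pi * s).
exists (`|2| * K + `|2 * cos (pi * r)|).
apply: isA_ext (isA_sub (isA_scale 2 cK) (isA_cst (2 * cos (pi * r)))) => u v _ _.
by rewrite mulrDr mulrA.
Qed.

Lemma strip_eta (R : realType) (n : int) (r : R) : n%:~R < r < n%:~R + 1 -> exists2 e, 0 < e &
  forall x, `|x| <= e -> n%:~R < r + x < n%:~R + 1.
Proof.
move=> /andP[h1 h2]; exists (Num.min (r - n%:~R) (n%:~R + 1 - r) / 2).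
  by rewrite divr_gt0// lt_min !subr_gt0 h1.
move=> x; set m := Num.min _ _.
have m1 : m <= r - n%:~R by rewrite ge_min lexx.
have m2 : m <= n%:~R + 1 - r by rewrite ge_min lexx orbT.
by rewrite ler_norml => /andP[a b]; apply/andP; split; move: m1 m2 h1 h2 a b; clear; lra.
Qed.

Section rotation_analytic.
Context {R : realType}.
Variable omega : R.
Hypothesis omega0 : 0 < omega.
Let k := (2 * omega)^-1.
Let k0 : 0 < k := rate_gt0 omega0.
Let rho (p : R * R) := rotation_number omega p.
Let T (p : R * R) := trmono k p.1 p.2.

Definition level_graph (q : R * R) : R :=
  xget 0 [set B | rotation_number omega (B, q.2) = q.1].

Lemma level_graphP q : rho (level_graph q, q.2) = q.1.
Proof.
apply: (xgetPex 0 (P := [set B | rho (B, q.2) = q.1])).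
exact: level_exists omega0 q.2 q.1.
Qed.

Lemma level_graph_rho p : rho p \isn't a Num.int -> level_graph (rho p, p.2) = p.1.
Proof.
case: p => B A /= rn; have /= E := level_graphP (rho (B, A), A).
apply: (@level_unique _ _ omega0 A _ _ _ E).
exact: (eq_ind_r (fun x => x \isn't a Num.int) rn E).
Qed.

Lemma rho_continuous : continuous rho.
Proof.
move=> [B A]; apply/cvgrPdist_lt => e e0.
have e2 : 0 < e / 2 by rewrite divr_gt0.
have [d d0 hd] := rho_near omega0 B A e2.
exists (ball B d, ball A d) => /=; first by split; exact: nbhsx_ballx.
move=> [B' A'] [/= h1 h2]; rewrite /ball/= in h1 h2.
rewrite distrC; apply: le_lt_trans (hd B' A' _ _) _; first by rewrite distrC ltW.
  by rewrite distrC ltW.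
by lra.
Qed.

Lemma trace_nonint_eq n p : n%:~R < rho p < n%:~R + 1 -> T p = 2 * cos (pi * rho p).
Proof.
move=> hn; have rn := (nonint_strip _).2 (ex_intro _ n hn).
case: p hn rn => B A hn rn; by have [_ h _] := nonint_trace omega0 rn; exact: h.
Qed.

Lemma sin_neq0_nonint p : rho p \isn't a Num.int -> sin (pi * rho p) != 0.
Proof.
case: p => B A /(nonint_trace omega0)[_ _ h]; apply/eqP => E.
by move: h; rewrite /rho in E; rewrite E mulr0 ltxx.
Qed.

(** The increment xi of rho is solved from 2 cos (pi (rho p + xi)) = T, where the cosine has nonzero
    slope because sin (pi rho) does not vanish. The bound eta keeps rho p + xi in the strip (n, n +
    1), where the cosine is injective, so the solution found is the true rho. *)
Lemma rho_analytic p : rho p \isn't a Num.int -> analytic2_at rho p.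
Proof.
move=> rn; have [n hn] := (nonint_strip _).1 rn.
have [d d0 hd] : exists2 d : R, 0 < d & forall B' A', `|B' - p.1| <= d ->
    `|A' - p.2| <= d -> n%:~R < rho (B', A') < n%:~R + 1.
  by apply: (rho_stays omega0); rewrite -surjective_pairing.
have [eta eta0 heta] := strip_eta hn.
have [e [Kw [/andP[e0 ed] wK]]] := analytic2_isA_small d0 (trmono_analytic k0 p).
have [Kf fK] := isA_cos_diff (rho p) 1.
have [e1 [c [e10 c0 hc]]] := cos_lower (sin_neq0_nonint rn).
have p0 := pi_gt0 R.
have Fc x : `|x| <= e1 / pi -> 2 * c * pi * `|x| <=
    `|2 * cos (pi * (rho p + 1 * x)) - 2 * cos (pi * rho p)|.
  rewrite ler_pdivlMr// mulrC => xe; have := hc (pi * x).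
  rewrite (normrM pi) (gtr0_norm p0) => /(_ xe).
  have n2 : `|2| = 2 :> R by rewrite gtr0_norm.
  have -> (s : R) : 2 * c * s * `|x| = 2 * (c * (s * `|x|)) by ring.
  by rewrite mul1r mulrDr -mulrBr (normrM 2) n2 ler_pM2l.
have := isA_implicit fK wK (isA_cst 0); rewrite mulr0 addr0 subrr => /(_ (e1 / pi) (2 * c * pi) eta).
rewrite !mulr0 !addr0 -surjective_pairing subrr => /(_ erefl erefl erefl).
case=> //; [by rewrite divr_gt0|by rewrite !mulr_gt0|].
move=> t [L [xi [/andP[t0 t1] xiL hxi]]].
apply: (@isA_analytic2 _ _ _ (e * t) (`|rho p| + L)); first exact: mulr_gt0.
apply: isA_ext (isA_add (isA_cst (rho p)) xiL) => u v u1 v1.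
have [xe xE] := hxi u v u1 v1.
have small (y : R) : `|y| <= 1 -> `|e * t * y| <= d.
  move=> y1; rewrite normrM gtr0_norm ?mulr_gt0//; apply: le_trans ed.
  by rewrite -mulrA ler_piMr ?(ltW e0)// mulr_ile1// ltW.
have hs : n%:~R < rho (p.1 + e * t * u, p.2 + e * t * v) < n%:~R + 1.
  by apply: hd; rewrite addrAC subrr add0r small.
move: xE; rewrite !mulrA mul1r -/(T p) (trace_nonint_eq hn).
rewrite -[trmono _ _ _]/(T (p.1 + e * t * u, p.2 + e * t * v)) (trace_nonint_eq hs).
have n2 : 2 != 0 :> R by rewrite pnatr_eq0.
move=> /addIr/(mulfI n2) E.
apply: (mulfI (lt0r_neq0 p0)); apply: cos_inj_strip E; apply: pi_strip; last exact: hs.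
exact: heta.
Qed.

(** Here the unknown is the increment of B in T(B, A) = 2 cos (pi r), with r and A as variables;
    [trace_slope] supplies the lower bound in B, and uniqueness on the level identifies the solution
    with [level_graph]. *)
Lemma level_graph_analytic q : q.1 \isn't a Num.int -> analytic2_at level_graph q.
Proof.
case: q => r A /= rn; set B := level_graph (r, A).
have rE : rho (B, A) = r := level_graphP (r, A).
have rn' : rotation_number omega (B, A) \isn't a Num.int by rewrite -/(rho (B, A)) rE.
have [n hn] := (nonint_strip _).1 rn.
have [d d0 hd] : exists2 d : R, 0 < d & forall B' A', `|B' - B| <= d ->
    `|A' - A| <= d -> n%:~R < rho (B', A') < n%:~R + 1.
  by apply: (rho_stays omega0); rewrite -/(rho (B, A)) rE.
have [eta eta0 heta] := strip_eta hn.
have [_ TE ms] := nonint_trace omega0 rn'.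
have m0 : mono21 k B A != 0 by apply: contraTneq ms => ->; rewrite mul0r ltxx.
have [c [e1 [c0 e10 hc]]] := trace_slope omega0 rn'.
have de0 : 0 < Num.min d eta by rewrite lt_min d0.
have [e [Kf [/andP[e0]]]] := analytic2_isA_small de0 (trmono_analytic k0 (B, A)).
rewrite le_min /= => /andP[ed ee] fK.
have [Kw wK] := isA_cos_diff r e.
have sg0 : 0 < `|mono21 k B A| by rewrite normr_gt0.
have Fc x : `|x| <= e1 / e -> c * e / `|mono21 k B A| * `|x| <=
    `|trmono k (B + e * x) A - trmono k B A|.
  rewrite ler_pdivlMr// mulrC => xe; have ne : `|e * x| = e * `|x|.
    by rewrite normrM gtr0_norm.
  have := hc (e * x); rewrite ne => /(_ xe).
  set D := _ - _ => h; have {}h : c * (e * `|x|) ^+ 2 <= (e * `|x|) * (`|mono21 k B A| * `|D|).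
    by rewrite -ne real_normK ?num_real//; apply: le_trans h _; exact: neg_prod_le.
  have [->|x0] := eqVneq x 0; first by rewrite normr0 mulr0.
  have ex : 0 < e * `|x| by rewrite mulr_gt0// normr_gt0.
  rewrite mulrAC ler_pdivrMr// [leRHS]mulrC -(ler_pM2l ex); apply: le_trans h.
  by rewrite le_eqVlt; apply/orP; left; apply/eqP; ring.
have vK : isA 1 (fun _ v : R => v).
  by apply: isA_ext (isA_mono 0 1) => u v _ _; rewrite expr0 mul1r expr1.
have := isA_implicit fK wK vK; rewrite /= !mulr0 !addr0 !subrr.
move=> /(_ (e1 / e) (c * e / `|mono21 k B A|) 1 erefl erefl erefl).
case=> //; [by rewrite divr_gt0|by rewrite divr_gt0 ?mulr_gt0|].
move=> t [L [xi [/andP[t0 t1] xiL hxi]]].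
apply: (@isA_analytic2 _ _ _ (e * t) (`|B| + `|e| * L)); first exact: mulr_gt0.
apply: isA_ext (isA_add (isA_cst B) (isA_scale e xiL)) => u v u1 v1 /=.
have [xe xE] := hxi u v u1 v1.
have small (y : R) : `|y| <= 1 -> `|e * t * y| <= e.
  move=> y1; rewrite normrM gtr0_norm ?mulr_gt0//.
  by rewrite -mulrA ler_piMr ?(ltW e0)// mulr_ile1// ltW.
have hs : n%:~R < rho (B + e * xi u v, A + e * t * v) < n%:~R + 1.
  apply: hd; rewrite addrAC subrr add0r; last exact: le_trans (small _ v1) ed.
  by rewrite normrM gtr0_norm//; apply: le_trans ed; rewrite ler_piMr// ltW.
have hr : n%:~R < r + e * t * u < n%:~R + 1.
  by apply: heta; apply: le_trans (small _ u1) ee.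
suff E : rho (B + e * xi u v, A + e * t * v) = r + e * t * u.
  have := @level_graph_rho (B + e * xi u v, A + e * t * v).
  by rewrite E/= => ->//; apply/nonint_strip; exists n.
move: xE; rewrite !mulrA -[trmono _ (B + _) _]/(T (B + e * xi u v, A + e * t * v)).
have n2 : 2 != 0 :> R by rewrite pnatr_eq0.
have -> : trmono k B A = 2 * cos (pi * r) by rewrite -[RHS]/(2 * cos (pi * r)) -rE.
rewrite (trace_nonint_eq hs) => /addIr/(mulfI n2) E.
apply: (mulfI (lt0r_neq0 (pi_gt0 R))).
apply: cos_inj_strip E; apply: pi_strip; [exact: hs|exact: hr].
Qed.

(** If the B-derivative of rho vanished, rho and hence T = 2 cos (pi rho) would change by O(x^2)
    under a shift x of B. The slope bound would then read c x^2 <= M x^3, false for x <= c / (M +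
    1). *)
Lemma rho_diff p : rho p \isn't a Num.int -> exists al be : R,
  [/\ al != 0, differentiable rho p & ('d rho p : R * R -> R) = pair_form al be].
Proof.
move=> rn; have [al [be [C [d [C0 d0 h]]]]] := analytic2_taylor (rho_analytic rn).
have [df dE] := analytic2_diff C0 d0 h.
exists al, be; split => //.
apply/eqP => al0; case: p {df dE} rn h => B A /= rn h.
have rn' : rotation_number omega (B, A) \isn't a Num.int by exact: rn.
have [n hn] := (nonint_strip _).1 rn.
have [d1 d10 hd1] := rho_stays omega0 hn.
have [_ TE ms] := nonint_trace omega0 rn'.
have m0 : mono21 k B A != 0 by apply: contraTneq ms => ->; rewrite mul0r ltxx.
have [c [e1 [c0 e10 hc]]] := trace_slope omega0 rn'.
pose M := 2 * pi * `|mono21 k B A| * C.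
pose x := Num.min (Num.min d d1) (Num.min e1 (c / (M + 1))).
have M0 : 0 <= M by rewrite !mulr_ge0// pi_ge0.
have [x0 xd xd1 xe1 xc] : [/\ 0 < x, x <= d, x <= d1, x <= e1 & x <= c / (M + 1)].
  by rewrite !lt_min !ge_min !lexx !orbT d0 d10 e10 divr_gt0//; apply: ltr_wpDl.
have nx : `|x| = x by rewrite gtr0_norm.
have := h (x, 0) x xd; rewrite /= nx normr0 lexx (ltW x0) al0 mul0r mulr0 addr0 subr0.
rewrite -[(B, A) + (x, 0)]/(B + x, A + 0) addr0 => /(_ isT isT) hx.
have hs : n%:~R < rho (B + x, A) < n%:~R + 1.
  by apply: hd1; rewrite ?subrr ?normr0 ?(ltW d10)// addrAC subrr add0r nx.
have := hc x; rewrite nx => /(_ xe1).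
rewrite -[trmono _ (B + x) _]/(T (B + x, A)) (trace_nonint_eq hs) TE -mulrBr => H.
have := cos_lip (pi * rho (B + x, A)) (pi * rho (B, A)).
have p0 := pi_gt0 R; rewrite -mulrBr (normrM pi) (gtr0_norm p0) => cl.
have {}H := le_trans H (neg_prod_le _ _ _); rewrite nx (normrM 2) in H.
have n2 : `|2| = 2 :> R by rewrite gtr0_norm.
rewrite n2 in H.
have h1 := le_trans cl (ler_wpM2l (ltW p0) hx).
have h2 : `|mono21 k B A| * (2 * `|cos (pi * rho (B + x, A)) - cos (pi * rho (B, A))|)
    <= x * (M * x).
  apply: le_trans (ler_wpM2l (normr_ge0 _) (ler_wpM2l (ler0n _ 2) h1)) _.
  rewrite /M le_eqVlt; apply/orP; left; apply/eqP; move: pi => q; ring.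
have h3 := le_trans H (ler_wpM2l (ltW x0) h2).
have : x * (x * c) <= x * (x * (M * x)) by move: h3; rewrite expr2; congr (is_true (_ <= _)); ring.
rewrite !ler_pM2l// => h4.
move: xc; rewrite ler_pdivlMr ?ltr_wpDl// mulrDr mulr1 [x * M]mulrC => h5.
by have := le_lt_trans h4 (lt_le_trans _ h5); rewrite ltrDl => /(_ x0); rewrite ltxx.
Qed.
End rotation_analytic.

(** * Interiors of the levels and charts of the fibration *)

Section topology.
Context {R : realType}.
Variable omega : R.
Hypothesis omega0 : 0 < omega.
Let rho (p : R * R) := rotation_number omega p.

Lemma strip_open (n : int) : open [set x : R | n%:~R < x < n%:~R + 1].
Proof.
rewrite openE => r /strip_eta[e e0 he]; apply/nbhs_ballP; exists e => // y.
rewrite /ball/= distrC => /ltW/he; by rewrite addrC subrK.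
Qed.

Lemma nonintegers_open : open (@nonintegers R).
Proof.
have -> : @nonintegers R = \bigcup_n [set x : R | n%:~R < x < n%:~R + 1].
  apply/seteqP; split=> x.
    by move=> /nonint_strip[n hn]; exists n.
  by move=> [n _ hn]; apply/nonint_strip; exists n.
by apply: bigcup_open => n _; exact: strip_open.
Qed.

Lemma rho_preimage_open (V : set R) : open V -> open (rho @^-1` V).
Proof. by apply: open_comp => p _; exact: rho_continuous omega0 p. Qed.

Lemma analytic2_proj2 (p : R * R) : analytic2_at snd p.
Proof.
apply: (@isA_analytic2 _ _ _ 1 (`|p.2| + 1)) => //=.
apply: isA_ext (isA_add (isA_cst p.2) (isA_mono 0 1)) => u v _ _.
by rewrite expr0 expr1 !mul1r.
Qed.

(** The chart (rho, A) is inverted by [level_graph], analytic jointly in (r, A), so a whole strip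
    between integers is straightened at once. *)
Lemma level_chart (n : int) : let V := [set x : R | n%:~R < x < n%:~R + 1] in
  analytic_diffeo (rho @^-1` (@nonintegers R) `&` rho @^-1` V) (V `*` setT)
    (fun p => (rho p, p.2)).
Proof.
move=> V; have VW x : V x -> nonintegers x.
  by move=> hx; apply/nonint_strip; exists n.
split.
- by apply: openI; apply: rho_preimage_open; [exact: nonintegers_open|exact: strip_open].
- have -> : V `*` [set: R] = fst @^-1` V by apply/seteqP; split => q //= [].
  by apply: open_comp; [move=> q _; exact: cvg_fst|exact: strip_open].
- split=> p [pU _]; [exact: rho_analytic|exact: analytic2_proj2].
- by move=> p [_ pV].
- exists (fun q => (level_graph omega q, q.2)); split.
  + by split=> q [/VW qV _]; [exact: level_graph_analytic|exact: analytic2_proj2].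
  + by move=> q [qV _]; rewrite /= /preimage/= /rho (level_graphP omega0 q); split => //; exact: VW.
  + move=> p /set_mem[pU _] /=; rewrite (level_graph_rho omega0 pU).
    by rewrite -surjective_pairing.
  + by move=> q _ /=; rewrite /rho (level_graphP omega0 q) -surjective_pairing.
Qed.

(** A graph over the A-axis contains no segment in the direction of B. *)
Lemma nonint_level_interior r : r \isn't a Num.int -> interior (level omega r) = set0.
Proof.
move=> rn; apply/seteqP; split=> // -[B A] /= /nbhs_ballP[e /= e0 he].
have e2 : 0 < e / 2 by rewrite divr_gt0.
have E1 : rho (B, A) = r by apply: he; exact: ballxx.
have E2 : rho (B + e / 2, A) = r.
  apply: he; split; last exact: ballxx.
  rewrite /ball/= opprD addrA subrr add0r normrN gtr0_norm//.
  by rewrite ltr_pdivrMr// ltr_pMr// ltr1n.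
have : B = B + e / 2.
  apply: (@level_unique _ _ omega0 A); first by rewrite -/(rho (B, A)) E1.
  by rewrite -/(rho (B, A)) -/(rho (B + e / 2, A)) E1 E2.
by move/eqP; rewrite -[X in X == _]addr0 (inj_eq (addrI B)) eq_sym (gt_eqF e2).
Qed.

(** Around a point with T^2 > 4 this inequality persists and makes rho an integer; being continuous,
    rho is then equal to n near that point. *)
Lemma int_level_interior (n : int) : interior (level omega n%:~R) !=set0.
Proof.
have [B [A [rE T4]]] := int_level_hyperbolic omega0 n; exists (B, A).
pose k := (2 * omega)^-1; pose T (p : R * R) := trmono k p.1 p.2.
have cT : {for (B, A), continuous T}.
  exact: analytic2_continuous (trmono_analytic (rate_gt0 omega0) (B, A)).
have h1 : \forall q \near (B, A), 4 < T q * T q.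
  have cTT : T q * T q @[q --> (B, A)] --> T (B, A) * T (B, A) by exact: cvgM.
  by apply: cvgr_gt cTT _ _; rewrite -expr2.
have h2 : \forall q \near (B, A), `|rho (B, A) - rho q| < 1.
  by have /cvgrPdist_lt := @rho_continuous _ _ omega0 (B, A); apply.
apply: filterS2 h1 h2 => -[B' A'] h1 h2; rewrite /level/=.
have /intrP[m mE] : rho (B', A') \is a Num.int.
  apply/negPn/negP => /(nonint_trace omega0)[]; rewrite expr2 => h.
  by move: (lt_trans h1 h); rewrite ltxx.
rewrite -/(rho (B', A')) mE; congr (_%:~R); apply/esym.
move: h2; rewrite mE /rho rE; exact: near_int.
Qed.

End topology.

Theorem proposition5p3 (R : realType) (omega : R) (homega : 0 < omega) :
  let rho : R * R -> R := rotation_number omega in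
  let W : set R := @nonintegers R in
  let U : set (R * R) := rho @^-1` W in
  [/\ U = ~` (\bigcup_(D in [set D | phase_lock_area omega D]) D),
      analytic2_on U rho,
      analytic_submersion U W rho,
      analytic_fibration U W rho &
      forall r : R, W r ->
        exists g : R -> R,
          (forall A : R, analytic1_at g A) /\
          level omega r = [set p : R * R | p.1 = g p.2]].
Proof.
move=> rho W U; have Uan : analytic2_on U rho by move=> p; exact: rho_analytic.
split=> //.
- apply/seteqP; split=> p.
    move=> pU [_ [r [-> [q qr]]] pr]; move: qr.
    by rewrite nonint_level_interior// -pr.
  move=> pD; apply/negP => /intrP[n nE]; apply: pD; exists (level omega n%:~R) => //.
  by exists n%:~R; split => //; exact: int_level_interior.
- split=> //; [exact: rho_preimage_open homega _ (@nonintegers_open R)|exact: nonintegers_open|].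
  move=> p /(rho_diff homega)[al [be [al0 df dE]]]; split=> // y _.
  exists (y / al, 0) => //; rewrite dE /pair_form /= mulr0 addr0 mulrC divfK//.
- move=> r /nonint_strip[n hn]; exists [set x | n%:~R < x < n%:~R + 1]; split => //.
  + exact: strip_open.
  + by move=> x hx; apply/nonint_strip; exists n.
  + by exists (fun p => (rho p, p.2)); split => //; exact: level_chart.
- move=> r rW; exists (fun A => level_graph omega (r, A)); split=> [A|].
    exact: (analytic2_snd (@level_graph_analytic _ _ homega (r, A) rW)).
  apply/seteqP; split=> -[B A] /=; rewrite /level/=.
    by move=> E; rewrite -E level_graph_rho//= E.
  by move=> ->; exact: level_graphP homega (r, A).
Qed.
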